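(* Let $\pi$ be an irreducible admissible representation of $\mathrm{GL}_2(F)$ which is not the trivial representation. Then the full theta lift $\Theta(\pi)$ of $\pi$ to $\mathrm{GL}_2(F)$ (for the dual pair $(\mathrm{GL}_2(F),\mathrm{GL}_2(F))$) is irreducible.
   Context: $F$ is a nonarchimedean local field of characteristic $0$ with normalized absolute value $|\cdot|$. For positive integers $n\le m$, let $\mathcal S(M_{n\times m}(F))$ be the space of locally constant compactly supported complex functions on $n\times m$ matrices, with $\mathrm{GL}_n(F)\times\mathrm{GL}_m(F)$ acting by $((g_1,g_2)f)(M)=f(g_1^{-1}Mg_2)$. The Weil representation is $\omega_{n,m}:=\mathcal S(M_{n\times m}(F))\otimes(|\det|^{-m/2}\boxtimes|\det|^{n/2})$. For an irreducible admissible representation $\pi$ of $\mathrm{GL}_n(F)$, the full theta lift is the representation of $\mathrm{GL}_m(F)$ given by $\Theta(\pi)=\Theta_{n,m}(\pi):=(\omega_{n,m}\otimes\pi^\vee)_{\mathrm{GL}_n(F)}$, where $V_{G}$ denotes the maximal quotient of $V$ on which $G$ acts trivially; equivalently the maximal $\pi$-isotypic quotient of $\omega_{n,m}$ is $\pi\otimes\Theta(\pi)$. *)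

(* Defs.v *)
From HB Require Import structures.
From mathcomp Require Import all_boot all_order all_algebra.
From mathcomp Require Import reals complex.
Set Implicit Arguments.
Unset Strict Implicit.
Unset Printing Implicit Defensive.
Import Order.TTheory GRing.Theory Num.Theory.
Local Open Scope ring_scope.

(* F is given with its normalized discrete valuation v : F -> int      *)
(* (the value v 0 is irrelevant; 0 has valuation +oo), and q is the    *)
(* cardinality of the residue field.                                   *)

Definition vge (F : fieldType) (v : F -> int) (N : int) (x : F) : bool :=
  (x == 0) || (N <= v x).

Definition residue_card (F : fieldType) (v : F -> int) (q : nat) : Prop :=
  exists s : seq F,
    [/\ size s = q,
        (forall i, (i < q)%N -> vge v 0 s`_i),
        (forall i j, (i < q)%N -> (j < q)%N -> i != j -> ~~ vge v 1 (s`_i - s`_j)) &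
        (forall x, vge v 0 x -> exists2 i, (i < q)%N & vge v 1 (x - s`_i))].

Definition v_complete (F : fieldType) (v : F -> int) : Prop :=
  forall u : nat -> F,
    (forall N : int, exists M : nat, forall i j, (M <= i)%N -> (M <= j)%N ->
        vge v N (u i - u j)) ->
    exists l : F, forall N : int, exists M : nat, forall i, (M <= i)%N ->
        vge v N (u i - l).

Definition nonarch_local_field_char0 (F : fieldType) (v : F -> int) (q : nat) : Prop :=
  [pchar F] =i pred0 /\
  [/\ (forall x y : F, x != 0 -> y != 0 -> v (x * y) = v x + v y),
      (forall x y : F, x != 0 -> y != 0 -> x + y != 0 ->
          Num.min (v x) (v y) <= v (x + y)),
      (exists pi : F, pi != 0 /\ v pi = 1),
      residue_card v q &
      v_complete v].

(* |x|^(s/2) for the normalized absolute value |x| = q^(-v x), x != 0,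
   with values in an algebraically closed numeric field C (the positive
   square root of q is used). *)
Definition abs_halfpow (C : numClosedFieldType) (F : fieldType) (v : F -> int)
  (q : nat) (s : int) (x : F) : C :=
  (sqrtC (q%:R : C)) ^ (- (s * v x)).

Definition GL (F : fieldType) (n : nat) (g : 'M[F]_n) : Prop := g \in unitmx.

(* K_N = 1 + p^N M_n(O)   (N >= 1): a basis of open compact subgroups *)
Definition congr_sub (F : fieldType) (v : F -> int) (n : nat) (N : int)
  (k : 'M[F]_n) : Prop :=
  GL k /\ forall i j, vge v N ((k - 1%:M) i j).

Definition lin_map (C : fieldType) (U W : lmodType C) (f : U -> W) : Prop :=
  forall (a : C) (x y : U), f (a *: x + y) = a *: f x + f y.

Definition subspace (C : fieldType) (V : lmodType C) (W : V -> Prop) : Prop :=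
  [/\ W 0, (forall x y, W x -> W y -> W (x + y)) & (forall (a : C) x, W x -> W (a *: x))].

Definition is_rep (F : fieldType) (n : nat) (C : fieldType) (V : lmodType C)
  (act : 'M[F]_n -> V -> V) : Prop :=
  [/\ (forall g, GL g -> lin_map (act g)),
      (forall x, act 1%:M x = x) &
      (forall g h x, GL g -> GL h -> act (g *m h) x = act g (act h x))].

Definition smooth_rep (F : fieldType) (v : F -> int) (n : nat) (C : fieldType)
  (V : lmodType C) (act : 'M[F]_n -> V -> V) : Prop :=
  forall x, exists N : int, 0 < N /\ forall k, congr_sub v N k -> act k x = x.

Definition admissible_rep (F : fieldType) (v : F -> int) (n : nat) (C : fieldType)
  (V : lmodType C) (act : 'M[F]_n -> V -> V) : Prop :=
  forall N : int, 0 < N -> exists s : seq V, forall x,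
    (forall k, congr_sub v N k -> act k x = x) ->
    exists c : 'I_(size s) -> C, x = \sum_(i < size s) c i *: s`_i.

Definition irreducible_rep (F : fieldType) (n : nat) (C : fieldType)
  (V : lmodType C) (act : 'M[F]_n -> V -> V) : Prop :=
  (exists x : V, x != 0) /\
  forall W : V -> Prop, subspace W ->
    (forall g x, GL g -> W x -> W (act g x)) ->
    (forall x, W x -> x = 0) \/ (forall x, W x).

Definition irr_adm_rep (F : fieldType) (v : F -> int) (n : nat) (C : fieldType)
  (V : lmodType C) (act : 'M[F]_n -> V -> V) : Prop :=
  [/\ is_rep act, smooth_rep v act, admissible_rep v act & irreducible_rep act].

Definition is_trivial_rep (F : fieldType) (n : nat) (C : fieldType)
  (V : lmodType C) (act : 'M[F]_n -> V -> V) : Prop :=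
  exists f : V -> C^o, [/\ lin_map f, bijective f &
                           forall g x, GL g -> f (act g x) = f x].

Definition smooth_dual (F : fieldType) (v : F -> int) (n : nat) (C : fieldType)
  (V : lmodType C) (act : 'M[F]_n -> V -> V) (l : V -> C) : Prop :=
  (forall (a : C) (x y : V), l (a *: x + y) = a * l x + l y) /\
  exists N : int, 0 < N /\ forall k x, congr_sub v N k -> l (act k x) = l x.

Definition dual_act (F : fieldType) (n : nat) (C : fieldType) (V : lmodType C)
  (act : 'M[F]_n -> V -> V) (g : 'M[F]_n) (l : V -> C) : V -> C :=
  fun x => l (act (invmx g) x).

(* locally constant compactly supported functions on M_{n x m}(F):
   supported in p^{-K} M_{n x m}(O) and invariant under p^N M_{n x m}(O) *)
Definition schwartz (F : fieldType) (v : F -> int) (n m : nat) (C : fieldType)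
  (f : 'M[F]_(n, m) -> C) : Prop :=
  exists K N : int,
    (forall M : 'M[F]_(n, m), ~ (forall i j, vge v (- K) (M i j)) -> f M = 0) /\
    (forall M X : 'M[F]_(n, m), (forall i j, vge v N (X i j)) -> f (M + X) = f M).

Definition weil_act (C : numClosedFieldType) (F : fieldType) (v : F -> int) (q : nat)
  (n m : nat) (g1 : 'M[F]_n) (g2 : 'M[F]_m) (f : 'M[F]_(n, m) -> C)
  : 'M[F]_(n, m) -> C :=
  fun M => abs_halfpow C v q (- (m%:Z)) (\det g1) * abs_halfpow C v q (n%:Z) (\det g2)
           * f (invmx g1 *m M *m g2).

(* The full theta lift Theta_{n,m}(pi) = (omega_{n,m} (x) pi^vee)_{GL_n(F)}, *)
(* as a representation of GL_m(F), given by its universal property:      *)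
(* beta : S(M_{n x m}(F)) x pi^vee -> Theta is the universal GL_n(F)-     *)
(* invariant bilinear map (phi, l) |-> class of phi (x) l, and tact is the *)
(* induced (linear) action of GL_m(F).                                   *)

Section ThetaDefs.
Variables (C : numClosedFieldType) (F : fieldType) (v : F -> int) (q : nat) (n m : nat).
Variables (V : lmodType C) (act : 'M[F]_n -> V -> V).

Definition sch_lin (a : C) (f1 f2 : 'M[F]_(n, m) -> C) : 'M[F]_(n, m) -> C :=
  fun M => a * f1 M + f2 M.
Definition dual_lin (a : C) (l1 l2 : V -> C) : V -> C :=
  fun x => a * l1 x + l2 x.

Definition inv_bilinear (U : lmodType C)
  (b : ('M[F]_(n, m) -> C) -> (V -> C) -> U) : Prop :=
  [/\ (forall a f1 f2 l, schwartz v f1 -> schwartz v f2 -> smooth_dual v act l ->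
         b (sch_lin a f1 f2) l = a *: b f1 l + b f2 l),
      (forall a f l1 l2, schwartz v f -> smooth_dual v act l1 -> smooth_dual v act l2 ->
         b f (dual_lin a l1 l2) = a *: b f l1 + b f l2) &
      (forall g f l, GL g -> schwartz v f -> smooth_dual v act l ->
         b (weil_act v q g 1%:M f) (dual_act act g l) = b f l)].

Definition is_full_theta_lift (Th : lmodType C) (tact : 'M[F]_m -> Th -> Th)
  (beta : ('M[F]_(n, m) -> C) -> (V -> C) -> Th) : Prop :=
  [/\ inv_bilinear beta,
      (forall h, GL h -> lin_map (tact h)),
      (forall h f l, GL h -> schwartz v f -> smooth_dual v act l ->
         tact h (beta f l) = beta (weil_act v q 1%:M h f) l) &
      (forall (U : lmodType C) (b : ('M[F]_(n, m) -> C) -> (V -> C) -> U),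
         inv_bilinear b ->
         exists t : Th -> U,
           [/\ lin_map t,
               (forall f l, schwartz v f -> smooth_dual v act l -> t (beta f l) = b f l) &
               (forall t' : Th -> U, lin_map t' ->
                  (forall f l, schwartz v f -> smooth_dual v act l -> t' (beta f l) = b f l) ->
                  forall y, t' y = t y)])].

End ThetaDefs.

(* Main.v *)
(* Let E be the smooth dual of V, an irreducible representation, and B(f, l) the class of f (x) l in the theta lift.

   If the values B(f, l) with f supported in GL_2 already span the lift, it is irreducible: given a stable W, the
   set of l with B(f, l) in W for all such f is stable, so it is 0 or E. In the first case any w in W is B(f, l)
   for f the indicator function of a small congruence subgroup fixing l, and then l lies in that set, so w = 0.

   A function near a singular matrix of rank one is a translate of f_n, the indicator function of E_11 + p^n M_2(O),
   and modulo functions supported in GL_2 the functional B(f_n, _) is eventually invariant under the mirabolic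
   subgroup Q of matrices (1 b; 0 d). So these contribute nothing as soon as E has no Q-coinvariants, and the
   neighbourhood of the zero matrix contributes nothing as soon as E is not the character |det|. The Fourier
   transform exchanges f(g1^-1 M g2) with the action of the inverse transposes, so one may replace Q by
   the subgroup Q2 of matrices (c b; 0 1) and |det| by its inverse. If E has both nonzero Q-coinvariants and nonzero
   Q2-coinvariants, then an explicit averaging produces a vector fixed by GL_2, so that V is trivial.

   The lift is nonzero because the zeta integrals Z(f, l, x) = sum_k t^k int_{v(det M) = k} f(M) l(M x) are rational
   functions of t with a common denominator; the leading coefficient at the relevant point, taken over all f and l,
   is a nonzero invariant form. *)

Require Import Defs.
From HB Require Import structures.
From mathcomp Require Import all_boot all_order all_algebra.
From mathcomp Require Import boolp classical_sets functions.
From mathcomp Require Import reals complex.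
From mathcomp Require Import zify ring lra.
Set Implicit Arguments.
Unset Strict Implicit.
Unset Printing Implicit Defensive.
Import Order.TTheory GRing.Theory Num.Theory.
Local Open Scope ring_scope.

(** * Valuations *)

(** The lift sees $\pi$ only through E. Admissibility makes E nonzero and irreducible, and makes the
    vectors of E fixed by a congruence subgroup a finite-dimensional space.

    One identity drives both halves: f_n minus q^-1 times the sum of its q translates by the
    matrices (1 0; z pi), z in p^n / p^(n+1), is supported on v(det) = n. Tested on a vector fixed
    by K_n, it says that diag(1, pi) acts trivially on B(f_n, _) modulo functions supported in GL_2;
    conjugation by powers of diag(1, pi) then passes from integral unipotents to all of them, whence
    Q. Inserted into the zeta integrals, it says that for large k the shift k -> k + 1 acts on fixed
    vectors through a Hecke operator. The characteristic polynomial of that operator is the common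
    denominator, used once for the rank one matrices and once, rescaled by q, for the zero matrix.

    The relevant point is t = 1, because acting by g multiplies the zeta integral by t^v(det g). All
    values at t = 1 may vanish once denominators are cleared; then derivatives take over, in the
    form of moments. *)

Record lfield := LField {
  lfF :> fieldType;
  lfv : lfF -> int;
  lfq : nat;
  lfpi : lfF;
  lfs : seq lfF;
  lf_char0 : [pchar lfF] =i pred0;
  lf_vM : forall x y : lfF, x != 0 -> y != 0 -> lfv (x * y) = lfv x + lfv y;
  lf_vD : forall x y : lfF, x != 0 -> y != 0 -> x + y != 0 ->
          Num.min (lfv x) (lfv y) <= lfv (x + y);
  lf_pi0 : lfpi != 0;
  lf_vpi : lfv lfpi = 1;
  lf_ssz : size lfs = lfq;
  lf_sO : forall i, (i < lfq)%N -> vge lfv 0 lfs`_i;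
  lf_sinj : forall i j, (i < lfq)%N -> (j < lfq)%N -> i != j -> ~~ vge lfv 1 (lfs`_i - lfs`_j);
  lf_ssurj : forall x, vge lfv 0 x -> exists2 i, (i < lfq)%N & vge lfv 1 (x - lfs`_i)
}.

Section Valuation.
Variable K : lfield.
Local Notation v := (@lfv K).
Local Notation pi := (lfpi K).
Local Notation q := (lfq K).
Implicit Types (x y z : K) (N a b c : int).

Lemma v1 : v 1 = 0.
Proof.
have := @lf_vM K 1 1 (oner_neq0 _) (oner_neq0 _); rewrite mulr1 => h.
by apply: (addrI (v 1)); rewrite addr0 -h.
Qed.

Lemma vV x : x != 0 -> v x^-1 = - v x.
Proof.
move=> x0; apply/eqP; rewrite -addr_eq0 addrC -lf_vM ?invr_eq0 // divff //.
by rewrite v1.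
Qed.

Lemma vX x (k : int) : x != 0 -> v (x ^ k) = k * v x.
Proof.
move=> x0.
have H (n : nat) : v (x ^+ n) = n%:Z * v x.
  elim: n => [|n IH]; first by rewrite expr0 v1 mul0r.
  by rewrite exprS lf_vM ?expf_neq0 // IH; lia.
case: k => n; first by rewrite -exprnP H.
by rewrite NegzE -exprnN vV ?expf_neq0 // H; lia.
Qed.

Lemma vpiX (k : int) : v (pi ^ k) = k.
Proof. by rewrite vX ?lf_pi0 // lf_vpi mulr1. Qed.

Lemma piX_neq0 (k : int) : pi ^ k != 0.
Proof. by rewrite expfz_neq0 // lf_pi0. Qed.

Lemma vN1 : v (-1) = 0.
Proof.
have n0 : (-1 : K) != 0 by rewrite oppr_eq0 oner_neq0.
by have := lf_vM n0 n0; rewrite mulrNN mulr1 v1; lia.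
Qed.

Lemma vN x : v (- x) = v x.
Proof.
have [->|x0] := eqVneq x 0; first by rewrite oppr0.
by rewrite -mulN1r lf_vM ?oppr_eq0 ?oner_neq0 // vN1 add0r.
Qed.

Lemma vge0 N : vge v N 0.
Proof. by rewrite /vge eqxx. Qed.

Lemma vgeE N x : x != 0 -> vge v N x = (N <= v x).
Proof. by rewrite /vge => /negPf ->. Qed.

Lemma vge_le a b x : a <= b -> vge v b x -> vge v a x.
Proof. by rewrite /vge => ab /orP[->//|h]; rewrite (le_trans ab h) orbT. Qed.

Lemma vgeD N x y : vge v N x -> vge v N y -> vge v N (x + y).
Proof.
have [->|x0] := eqVneq x 0; first by rewrite add0r.
have [->|y0] := eqVneq y 0; first by rewrite addr0.
have [->|xy0] := eqVneq (x + y) 0; first by rewrite vge0.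
rewrite !vgeE // => hx hy; apply: le_trans (lf_vD x0 y0 xy0).
by rewrite le_min hx.
Qed.

Lemma vgeN N x : vge v N (- x) = vge v N x.
Proof. by rewrite /vge oppr_eq0 vN. Qed.

Lemma vgeB N x y : vge v N x -> vge v N y -> vge v N (x - y).
Proof. by move=> hx hy; apply: vgeD => //; rewrite vgeN. Qed.

Lemma vgeM a b x y : vge v a x -> vge v b y -> vge v (a + b) (x * y).
Proof.
have [->|x0] := eqVneq x 0; first by move=> _ _; rewrite mul0r vge0.
have [->|y0] := eqVneq y 0; first by move=> _ _; rewrite mulr0 vge0.
by rewrite !vgeE ?mulf_neq0 // lf_vM // => hx hy; lia.
Qed.

Lemma vgeM_le c a b x y : c <= a + b -> vge v a x -> vge v b y -> vge v c (x * y).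
Proof. by move=> h hx hy; apply: vge_le h (vgeM hx hy). Qed.

Lemma vge_mull N x y : y != 0 -> vge v N (y * x) = vge v (N - v y) x.
Proof.
move=> y0; have [->|x0] := eqVneq x 0; first by rewrite mulr0 !vge0.
by rewrite !vgeE ?mulf_neq0 // lf_vM //; apply/idP/idP => h; lia.
Qed.

Lemma vge_pi N k x : vge v N (pi ^ k * x) = vge v (N - k) x.
Proof. by rewrite vge_mull ?piX_neq0 // vpiX. Qed.

Lemma vge1 : vge v 0 1.
Proof. by rewrite vgeE ?oner_neq0 // v1. Qed.

Lemma vge_sum N (I : finType) (f : I -> K) :
  (forall i, vge v N (f i)) -> vge v N (\sum_i f i).
Proof.
by move=> h; elim/big_ind: _ => [|x y|i _]; [exact: vge0|exact: vgeD|exact: h].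
Qed.

Lemma v_add_small x y : x != 0 -> vge v (v x + 1) y -> x + y != 0 /\ v (x + y) = v x.
Proof.
move=> x0 hy; have xy0 : x + y != 0.
  apply/eqP => h; have : vge v (v x + 1) x.
    by rewrite -vgeN (_ : - x = y) //; apply/eqP; rewrite eq_sym -addr_eq0 addrC h.
  by rewrite vgeE //; lia.
split=> //; apply/eqP; rewrite eq_le; apply/andP; split; last first.
  have : vge v (v x) (x + y).
    by apply: vgeD; [rewrite vgeE|apply: vge_le hy; lia].
  by rewrite vgeE.
rewrite leNgt; apply/negP => h.
have : vge v (v x + 1) (x + y - y) by apply: vgeB => //; rewrite vgeE //; lia.
by rewrite addrK vgeE //; lia.
Qed.

Lemma vge_ex x : exists N : int, vge v N x.
Proof.
have [->|x0] := eqVneq x 0; first by exists 0; exact: vge0.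
by exists (v x); rewrite vgeE.
Qed.

Lemma q_gt1 : (1 < q)%N.
Proof.
have [i hi Hi] := lf_ssurj (vge0 0).
have [j hj Hj] := lf_ssurj vge1.
have : i != j.
  apply/eqP => ij; move: Hj; rewrite -ij => Hj.
  have := vgeB Hj Hi; rewrite opprB addrA subrK subr0 vgeE ?oner_neq0 // v1; lia.
by move: hi hj; lia.
Qed.

(** Indices of the expansions $s_0 + \pi s_1 + \dots$ with $j$ digits, which represent $O/p^j$. The
    recursion lets a sum over [digI j.+1] split into a first digit and the rest by [pair_bigA]. *)
Fixpoint digI (j : nat) : finType :=
  if j is j'.+1 then ('I_q * digI j')%type : finType else (unit : finType).

Fixpoint dig (j : nat) : digI j -> K :=
  if j is j'.+1 return digI j -> K
  then fun u => (lfs K)`_(u.1) + pi * dig u.2 else fun=> 0.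

Lemma card_digI j : #|digI j| = (q ^ j)%N.
Proof. by elim: j => [|j IH] /=; rewrite ?card_unit // card_prod card_ord IH expnS. Qed.

Lemma digO j (u : digI j) : vge v 0 (dig u).
Proof.
elim: j u => [|j IH] /= u; first exact: vge0.
apply: vgeD; first exact: lf_sO.
by apply: (@vgeM_le _ 1 0) => //; rewrite vgeE ?lf_pi0 // lf_vpi.
Qed.

Lemma vge_dpi N x : vge v N (pi * x) = vge v (N - 1) x.
Proof. by rewrite vge_mull ?lf_pi0 // lf_vpi. Qed.

Lemma dig_inj j (u w : digI j) : vge v j%:Z (dig u - dig w) -> u = w.
Proof.
elim: j u w => [|j IH] /=; first by move=> [] [].
move=> [i u] [k w] /= h.
have hd : vge v 1 (pi * (dig u - dig w)).
  by rewrite vge_dpi subrr; apply: vgeB; exact: digO.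
have e : (lfs K)`_i + pi * dig u - ((lfs K)`_k + pi * dig w)
   = (lfs K)`_i - (lfs K)`_k + pi * (dig u - dig w) by ring.
have ik : i = k.
  apply/val_inj/eqP; case: (boolP (val i == val k)) => // nik.
  have := lf_sinj (ltn_ord i) (ltn_ord k) nik.
  rewrite -(addrK (pi * (dig u - dig w)) ((lfs K)`_i - (lfs K)`_k)) -e vgeB //.
  by apply: vge_le h; lia.
congr pair => //; apply: IH; move: h; rewrite e ik subrr add0r vge_dpi.
by apply: vge_le; lia.
Qed.

Lemma dig_surj j x : vge v 0 x -> exists u : digI j, vge v j%:Z (x - dig u).
Proof.
elim: j x => [|j IH] x hx /=; first by exists tt; rewrite subr0.
have [i hi Hi] := lf_ssurj hx.
have [|u Hu] := IH (pi^-1 * (x - (lfs K)`_i)).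
  by rewrite vge_mull ?invr_eq0 ?lf_pi0 // vV ?lf_pi0 // lf_vpi.
exists (Ordinal hi, u) => /=.
rewrite opprD addrA (_ : _ - _ = pi * (pi^-1 * (x - (lfs K)`_i) - dig u)).
  by rewrite vge_dpi; apply: vge_le Hu; lia.
by rewrite mulrBr mulrA divff ?lf_pi0 // mul1r.
Qed.

Lemma residue_torsion : vge v 1 (q%:R : K).
Proof.
(* translation by 1 permutes the residue classes, so q * 1 is a sum of differences *)
pose s := (lfs K).
have /choice[h Hh] (i : 'I_q) : exists k : 'I_q, vge v 1 (s`_i + 1 - s`_k).
  have [k hk Hk] := lf_ssurj (vgeD (lf_sO (ltn_ord i)) vge1).
  by exists (Ordinal hk).
have hinj : injective h.
  move=> i k e; apply/val_inj/eqP; case: (boolP (val i == val k)) => // nik.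
  have := lf_sinj (ltn_ord i) (ltn_ord k) nik.
  have := vgeB (Hh i) (Hh k); rewrite e.
  by rewrite (_ : _ - _ - _ = s`_i - s`_k); [move=> ->|ring].
have := vge_sum (fun i => Hh i).
rewrite sumrB big_split /=.
rewrite (_ : \sum_(i < q) s`_(h i) = \sum_(i < q) s`_i).
  by rewrite addrAC subrr add0r sumr_const card_ord.
by rewrite [RHS](reindex h) //; exact/onW_bij/injF_bij.
Qed.

End Valuation.

(** * Two by two matrices *)

Section Matrices.
Variable K : lfield.
Local Notation v := (@lfv K).
Local Notation pi := (lfpi K).
Local Notation q := (lfq K).
Local Notation M2 := 'M[lfF K]_2.
Implicit Types (a b N : int) (M X Y g h k : M2).

Definition mge N M : bool := [forall i, forall j, vge v N (M i j)].

Lemma mgeP N M : reflect (forall i j, vge v N (M i j)) (mge N M).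
Proof.
apply: (iffP forallP) => h i; first by move=> j; exact: (forallP (h i)).
by apply/forallP => j; exact: h.
Qed.

Lemma mge0 N : mge N 0.
Proof. by apply/mgeP => i j; rewrite mxE vge0. Qed.

Lemma mge_le a b M : a <= b -> mge b M -> mge a M.
Proof. by move=> ab /mgeP h; apply/mgeP => i j; exact: vge_le ab (h i j). Qed.

Lemma mgeD N X Y : mge N X -> mge N Y -> mge N (X + Y).
Proof. by move=> /mgeP hx /mgeP hy; apply/mgeP => i j; rewrite mxE vgeD. Qed.

Lemma mgeN N X : mge N (- X) = mge N X.
Proof. by apply/mgeP/mgeP => h i j; have := h i j; rewrite mxE vgeN. Qed.

Lemma mgeB N X Y : mge N X -> mge N Y -> mge N (X - Y).
Proof. by move=> hx hy; rewrite mgeD ?mgeN. Qed.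

Lemma mge_subC N X Y : mge N (X - Y) = mge N (Y - X).
Proof. by rewrite -mgeN opprB. Qed.

Lemma mgeM c a b X Y : c <= a + b -> mge a X -> mge b Y -> mge c (X *m Y).
Proof.
move=> hc /mgeP hx /mgeP hy; apply/mgeP => i j; rewrite mxE.
by apply: vge_sum => u; exact: vgeM_le hc (hx i u) (hy u j).
Qed.

Lemma mgeZ N (c : K) X : c != 0 -> mge N (c *: X) = mge (N - v c) X.
Proof.
by move=> c0; apply/mgeP/mgeP => h i j; have := h i j; rewrite mxE vge_mull.
Qed.

Lemma mge_ex X : exists N : int, mge N X.
Proof.
have /choice[f Hf] (p : 'I_2 * 'I_2) : exists n : nat, vge v (- n%:Z) (X p.1 p.2).
  have [a ha] := vge_ex (X p.1 p.2); exists `|a|%N.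
  by apply: vge_le ha; lia.
exists (- (\max_p f p)%:Z); apply/mgeP => i j; apply: vge_le (Hf (i, j)).
by have := leq_bigmax (F := f) (i, j); lia.
Qed.

Lemma mge1 : mge 0 1%:M.
Proof. by apply/mgeP => i j; rewrite mxE; case: eqP => _; rewrite ?vge1 ?vge0. Qed.

Definition mx2 (a b c d : K) : M2 :=
  \matrix_(i, j) if i == 0 then (if j == 0 then a else b) else (if j == 0 then c else d).

Lemma ord2P (i : 'I_2) : i = 0 \/ i = 1.
Proof. by case: i => [[|[|//]] h]; [left|right]; apply: val_inj. Qed.

Lemma mx2P M : M = mx2 (M 0 0) (M 0 1) (M 1 0) (M 1 1).
Proof. by apply/matrixP => i j; rewrite mxE; case: (ord2P i) => ->; case: (ord2P j) => ->. Qed.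

Lemma mx2_eqP M (a b c d : K) :
  M 0 0 = a -> M 0 1 = b -> M 1 0 = c -> M 1 1 = d -> M = mx2 a b c d.
Proof. by move=> <- <- <- <-; exact: mx2P. Qed.

Lemma mx2_mul (a b c d a' b' c' d' : K) : mx2 a b c d *m mx2 a' b' c' d' =
  mx2 (a * a' + b * c') (a * b' + b * d') (c * a' + d * c') (c * b' + d * d').
Proof. by apply: mx2_eqP; rewrite !mxE !big_ord_recl big_ord0 /= !mxE /= addr0. Qed.

Lemma mx2_1 : 1%:M = mx2 1 0 0 1.
Proof. by apply: mx2_eqP; rewrite !mxE. Qed.

Lemma mx2_sub (a b c d a' b' c' d' : K) : mx2 a b c d - mx2 a' b' c' d' =
  mx2 (a - a') (b - b') (c - c') (d - d').
Proof. by apply: mx2_eqP; rewrite !mxE. Qed.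

Lemma mx2_tr (a b c d : K) : (mx2 a b c d)^T = mx2 a c b d.
Proof. by apply: mx2_eqP; rewrite !mxE. Qed.

Definition dt M : K := \det M.
Definition vd M : int := v (dt M).

Lemma det2E M : dt M = M 0 0 * M 1 1 - M 0 1 * M 1 0.
Proof.
rewrite /dt (expand_det_row _ 0) !big_ord_recl big_ord0 /cofactor !det_mx11 !mxE /= addr0.
rewrite /= !addn0 expr0 mul1r expr1 mulN1r.
by rewrite mulrN; congr (_ * M _ _ - M _ _ * M _ _); exact: val_inj.
Qed.

Lemma mx2_det (a b c d : K) : dt (mx2 a b c d) = a * d - b * c.
Proof. by rewrite det2E !mxE. Qed.

Lemma mx2_unit (a b c d : K) : (mx2 a b c d \in unitmx) = (a * d - b * c != 0).
Proof. by rewrite unitmxE unitfE -[\det _]/(dt _) mx2_det. Qed.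

Lemma invmx_uniq g h : g *m h = 1%:M -> invmx g = h.
Proof.
move=> e; have [gu _] := mulmx1_unit e.
by rewrite -[LHS]mulmx1 -e mulKmx.
Qed.

Lemma mge_mx2 N (a b c d : K) :
  mge N (mx2 a b c d) = [&& vge v N a, vge v N b, vge v N c & vge v N d].
Proof.
apply/mgeP/and4P => [h|[ha hb hc hd] i j].
  by split; [have := h 0 0|have := h 0 1|have := h 1 0|have := h 1 1]; rewrite mxE.
by rewrite mxE; case: ifP => _; case: ifP => _.
Qed.

Lemma GL1 : GL (1%:M : M2). Proof. exact: unitmx1. Qed.
Lemma GLM g h : GL g -> GL h -> GL (g *m h).
Proof. by rewrite /GL unitmx_mul => -> ->. Qed.
Lemma GLV g : GL g -> GL (invmx g).
Proof. by rewrite /GL unitmx_inv. Qed.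
Lemma GLT g : GL g -> GL (g^T).
Proof. by rewrite /GL unitmx_tr. Qed.
Lemma GL_det g : GL g -> dt g != 0.
Proof. by rewrite /GL unitmxE unitfE. Qed.
Lemma det_GL g : dt g != 0 -> GL g.
Proof. by rewrite /GL unitmxE unitfE. Qed.
Lemma GLtr g : GL g -> GL (invmx g)^T.
Proof. by move=> h; exact/GLT/GLV. Qed.

Lemma dtM g h : dt (g *m h) = dt g * dt h.
Proof. exact: det_mulmx. Qed.

Lemma dtV g : dt (invmx g) = (dt g)^-1.
Proof. exact: det_inv. Qed.

Lemma dt_tr g : dt g^T = dt g.
Proof. exact: det_tr. Qed.

Lemma invmxM g h : GL g -> GL h -> invmx (g *m h) = invmx h *m invmx g.
Proof.
by move=> hg hh; apply: invmx_uniq; rewrite mulmxA mulmxK // mulmxV.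
Qed.

Lemma invmxT g : (invmx g)^T = invmx g^T.
Proof. exact: trmx_inv. Qed.

Lemma mge_tr N g : mge N g^T = mge N g.
Proof. by apply/mgeP/mgeP => h i j; have := h j i; rewrite mxE. Qed.

Lemma vdetM g h : GL g -> GL h -> vd (g *m h) = vd g + vd h.
Proof. by move=> hg hh; rewrite /vd dtM lf_vM ?GL_det. Qed.

Lemma vdetV g : GL g -> vd (invmx g) = - vd g.
Proof. by move=> hg; rewrite /vd dtV vV ?GL_det. Qed.

Lemma vge_det a M : mge a M -> vge v (a + a) (dt M).
Proof.
move=> /mgeP h; rewrite det2E; apply: vgeB; exact: vgeM.
Qed.

Lemma invmx2 g : GL g -> invmx g = (dt g)^-1 *: mx2 (g 1 1) (- g 0 1) (- g 1 0) (g 0 0).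
Proof.
move=> hg; apply: invmx_uniq; rewrite -scalemxAr [X in _ *: (X *m _)](mx2P g) mx2_mul.
have := GL_det hg; rewrite det2E => h0.
rewrite mx2_1; apply: mx2_eqP; rewrite !mxE /=; by field.
Qed.

Lemma mge_inv a g : GL g -> mge a g -> mge (a - vd g) (invmx g).
Proof.
move=> hg /mgeP h; rewrite invmx2 // mgeZ ?invr_eq0 ?GL_det // vV ?GL_det // -/(vd g).
by rewrite opprK subrK mge_mx2 !vgeN !h.
Qed.

(** The maximal compact subgroup $GL_2(O)$; it preserves each $p^a M_2(O)$ and normalizes each
    congruence subgroup. *)
Definition Kz g : Prop := [/\ GL g, mge 0 g & mge 0 (invmx g)].

Lemma KzV g : Kz g -> Kz (invmx g).
Proof. by case=> h1 h2 h3; split; rewrite ?invmxK //; exact: GLV. Qed.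

Lemma KzM g h : Kz g -> Kz h -> Kz (g *m h).
Proof.
move=> [g1 g2 g3] [h1 h2 h3]; split; first exact: GLM.
  exact: mgeM g2 h2.
by rewrite invmxM //; exact: mgeM h3 g3.
Qed.

Lemma Kz_vdet g : Kz g -> vd g = 0.
Proof.
move=> [g1 g2 g3]; have := vge_det g2; have := vge_det g3.
rewrite vgeE ?(GL_det (GLV g1)) // -/(vd _) vdetV // vgeE ?GL_det // -/(vd g).
by move=> ? ?; lia.
Qed.

Lemma Kz_mge0 g : GL g -> mge 0 g -> vd g = 0 -> Kz g.
Proof. by move=> h1 h2 h3; split=> //; have := mge_inv h1 h2; rewrite h3. Qed.

Lemma Kz_mgeL a k M : Kz k -> mge a (k *m M) = mge a M.
Proof.
move=> [k1 k2 k3]; apply/idP/idP => h.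
  by rewrite -(mulKmx k1 M); apply: mgeM k3 h; lia.
by apply: mgeM k2 h; lia.
Qed.

Lemma Kz_mgeR a k M : Kz k -> mge a (M *m k) = mge a M.
Proof.
move=> [k1 k2 k3]; apply/idP/idP => h.
  by rewrite -(mulmxK k1 M); apply: mgeM h k3; lia.
by apply: mgeM h k2; lia.
Qed.

(** Modulo p the matrix is the identity, so its determinant is a unit. *)
Lemma mge_congr N k : 0 < N -> mge N (k - 1%:M) -> Kz k.
Proof.
move=> N0 h; have k0 : mge 0 k.
  rewrite -(subrK 1%:M k) mgeD ?mge1 //; apply: mge_le h; lia.
have [d0 dv] : dt k != 0 /\ vd k = 0.
  rewrite /vd.
  have e : dt k = 1 + (dt k - 1) by rewrite addrC subrK.
  rewrite e -(v1 K); apply: v_add_small; first exact: oner_neq0.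
  rewrite v1 det2E.
  have /mgeP hh := h; have /mgeP kk := k0.
  rewrite (_ : _ - 1 = (k - 1%:M) 0 0 * k 1 1 + (k - 1%:M) 1 1 - (k - 1%:M) 0 1 * k 1 0).
    apply: vgeB; last by apply: vgeM_le (hh _ _) (kk _ _); lia.
    apply: vgeD; last by apply: vge_le (hh _ _); lia.
    by apply: vgeM_le (hh _ _) (kk _ _); lia.
  by rewrite !mxE /=; ring.
by apply: Kz_mge0 => //; exact: det_GL.
Qed.

Lemma congrP N k : 0 < N -> congr_sub v N k <-> mge N (k - 1%:M).
Proof.
move=> N0; split => [[_ h]|h]; first exact/mgeP.
by split; [case: (mge_congr N0 h)|exact/mgeP].
Qed.

Lemma congr_Kz N k : 0 < N -> congr_sub v N k -> Kz k.
Proof. by move=> N0 /congrP h; apply: mge_congr (h N0). Qed.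

Lemma congr_le N N' k : N' <= N -> congr_sub v N k -> congr_sub v N' k.
Proof. by move=> h [h1 h2]; split=> // i j; exact: vge_le h (h2 i j). Qed.

Lemma congrM N g h : 0 < N -> congr_sub v N g -> congr_sub v N h -> congr_sub v N (g *m h).
Proof.
move=> N0 hg hh; apply/congrP => //.
rewrite (_ : _ - _ = (g - 1%:M) *m h + (h - 1%:M)); last by rewrite mulmxBl mul1mx addrA subrK.
apply: mgeD; last exact/congrP.
by rewrite Kz_mgeR; [exact/congrP|exact: congr_Kz hh].
Qed.

Lemma congr_conj N k g : 0 < N -> Kz g -> congr_sub v N k -> congr_sub v N (invmx g *m k *m g).
Proof.
move=> N0 hg /congrP hk; apply/congrP => //.
have gu : GL g by case: hg.
rewrite (_ : _ - _ = invmx g *m (k - 1%:M) *m g).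
  by rewrite Kz_mgeR // Kz_mgeL; [exact: hk|exact: KzV].
by rewrite mulmxBr mulmx1 mulmxBl mulVmx.
Qed.

Lemma congrV N k : 0 < N -> congr_sub v N k -> congr_sub v N (invmx k).
Proof.
move=> N0 hk; apply/congrP => //; have kz := congr_Kz N0 hk.
rewrite -(Kz_mgeL _ _ kz) mulmxBr mulmx1 mulmxV; last by case: kz.
by rewrite mge_subC; apply/congrP.
Qed.

Lemma congr_quot N g h : 0 < N -> Kz g -> mge N (h - g) ->
  congr_sub v N (invmx g *m h) /\ congr_sub v N (h *m invmx g).
Proof.
move=> N0 hg e; have gu : GL g by case: hg.
split; apply/congrP => //.
  by rewrite -(mulVmx gu) -mulmxBr (Kz_mgeL _ _ (KzV hg)).
by rewrite -(mulmxV gu) -mulmxBl (Kz_mgeR _ _ (KzV hg)).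
Qed.

(** Index set for the representatives [mrep] of $p^a M_2(O)/p^{a+j} M_2(O)$. *)
Definition mI (j : nat) := {ffun 'I_2 * 'I_2 -> digI K j}.
Definition mrep a j (u : mI j) : M2 := \matrix_(i, k) (pi ^ a * dig (u (i, k))).

Lemma card_mI j : #|mI j| = ((q ^ j) ^ 4)%N.
Proof. by rewrite card_ffun card_digI card_prod card_ord. Qed.

Lemma mrep_in a j (u : mI j) : mge a (mrep a u).
Proof. by apply/mgeP => i k; rewrite mxE vge_pi subrr digO. Qed.

Lemma mrep_inj a j (u w : mI j) : mge (a + j%:Z) (mrep a u - mrep a w) -> u = w.
Proof.
move=> /mgeP h; apply/ffunP => -[i k]; have := h i k.
rewrite !mxE -mulrBr vge_pi (_ : a + j%:Z - a = j%:Z); last by lia.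
exact: dig_inj.
Qed.

Lemma mrep_surj a j M : mge a M -> exists u : mI j, mge (a + j%:Z) (M - mrep a u).
Proof.
move=> /mgeP h.
have /choice[f Hf] (p : 'I_2 * 'I_2) : exists u : digI K j,
    vge v j%:Z (pi ^ (- a) * M p.1 p.2 - dig u).
  by apply: dig_surj; rewrite vge_pi opprK add0r.
exists [ffun p => f p]; apply/mgeP => i k; rewrite !mxE ffunE.
have e : M i k = pi ^ a * (pi ^ (- a) * M i k).
  by rewrite mulrA -expfzDr ?lf_pi0 // subrr expr0z mul1r.
rewrite e -mulrBr vge_pi (_ : a + j%:Z - a = j%:Z); last by lia.
exact: (Hf (i, k)).
Qed.

End Matrices.

(** * Schwartz functions *)

Section Schwartz.
Variables (C : numClosedFieldType) (K : lfield).
Local Notation v := (@lfv K).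
Local Notation q := (lfq K).
Local Notation M2 := 'M[lfF K]_2.
Local Notation fn := (M2 -> C).
Implicit Types (a b N : int) (M X Y g h k : M2) (f : fn).

(** With this sign [qp (vd g)] is $|\det g|^{-1}$. *)
Definition qp (k : int) : C := (q%:R : C) ^ k.

Lemma q_neq0 : (q%:R : C) != 0.
Proof. by rewrite pnatr_eq0; have := q_gt1 K; lia. Qed.

Lemma qp_neq0 (k : int) : qp k != 0.
Proof. by rewrite expfz_neq0 // q_neq0. Qed.

Lemma qp_gt0 (k : int) : 0 < qp k.
Proof. by rewrite exprz_gt0 // ltr0n; have := q_gt1 K; lia. Qed.

Lemma qpD (k l : int) : qp (k + l) = qp k * qp l.
Proof. by rewrite /qp expfzDr // q_neq0. Qed.

Lemma qp0 : qp 0 = 1. Proof. exact: expr0z. Qed.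

Lemma qpN (k : int) : qp (- k) = (qp k)^-1.
Proof. by rewrite /qp invr_expz. Qed.

Lemma qp_nat (n : nat) : qp n%:Z = q%:R ^+ n.
Proof. by []. Qed.

Lemma qp1 : qp 1 = q%:R. Proof. exact: expr1z. Qed.

(** For $n = m = 2$ the exponents $m/2$ and $n/2$ are integers, so the square root of q
    disappears. *)
Lemma weilE (g1 g2 : M2) f M :
  @weil_act C K v q 2 2 g1 g2 f M
  = qp (vd g1 - vd g2) * f (invmx g1 *m M *m g2).
Proof.
rewrite /weil_act /abs_halfpow qpD qpN; congr (_ * _ * _).
  rewrite (_ : - (- 2%:Z * vd g1) = 2%:Z * vd g1); last by lia.
  by rewrite -exprz_exp -exprnP sqrtCK.
by rewrite -invr_expz -exprz_exp -exprnP sqrtCK.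
Qed.

Definition sch a b f : Prop :=
  (forall M, ~~ mge a M -> f M = 0) /\ (forall M X, mge b X -> f (M + X) = f M).

Lemma schwartzP f : @schwartz K v 2 2 C f <-> exists a b, sch a b f.
Proof.
split=> [[a [b [h1 h2]]]|[a [b [h1 h2]]]].
  exists (- a), b; split=> [M /negP hM|M X /mgeP]; last exact: h2.
  by apply: h1 => h; apply: hM; exact/mgeP.
exists (- a), b; split=> [M hM|M X hX]; last by apply: h2; exact/mgeP.
by apply: h1; apply/negP => /mgeP; rewrite -(opprK a).
Qed.

Lemma sch_le a b a' b' f : a' <= a -> b <= b' -> sch a b f -> sch a' b' f.
Proof.
move=> ha hb [h1 h2]; split=> [M hM|M X hX]; last by apply: h2; exact: mge_le hX.
by apply: h1; apply: contra hM; exact: mge_le.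
Qed.

Lemma sch_common f1 f2 a b a' b' : sch a b f1 -> sch a' b' f2 ->
  exists a2 j, sch a2 (a2 + Posz j) f1 /\ sch a2 (a2 + Posz j) f2.
Proof.
move=> h1 h2; exists (Num.min a a'), `|Num.max b b' - Num.min a a'|%N.
by split; [apply: sch_le h1|apply: sch_le h2]; lia.
Qed.

Lemma sch_norm f a b : sch a b f -> exists j : nat, sch a (a + Posz j) f.
Proof. by move=> h; exists `|b - a|%N; apply: sch_le h; lia. Qed.

Definition SW f := @schwartz K v 2 2 C f.

Lemma SW_lin c f1 f2 : SW f1 -> SW f2 -> SW (sch_lin c f1 f2).
Proof.
move=> /schwartzP[a [b h1]] /schwartzP[a' [b' h2]].
have [a2 [j [[h1a h1b] [h2a h2b]]]] := sch_common h1 h2.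
apply/schwartzP; exists a2, (a2 + Posz j); split=> M.
  by move=> hM; rewrite /sch_lin h1a // h2a // mulr0 addr0.
by move=> X hX; rewrite /sch_lin h1b // h2b.
Qed.

Definition fn0 : fn := fun=> 0.

Lemma SW_0 : SW fn0.
Proof. by apply/schwartzP; exists 0, 0; split. Qed.

Definition box X N : fn := fun M => (mge N (M - X))%:R.

Lemma box_eq X Y N : mge N (X - Y) -> box X N = box Y N.
Proof.
move=> h; apply/funext => M; rewrite /box; congr (_%:R); congr nat_of_bool.
apply/idP/idP => h'.
  have -> : M - Y = (M - X) + (X - Y) by rewrite addrA subrK.
  exact: mgeD.
have -> : M - X = (M - Y) - (X - Y) by rewrite opprB addrA subrK.
exact: mgeB.
Qed.

Lemma box_inv X N M Y : mge N Y -> box X N (M + Y) = box X N M.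
Proof.
move=> h; rewrite /box; congr (_%:R); congr nat_of_bool.
rewrite addrAC; apply/idP/idP => h'; last by rewrite mgeD.
by rewrite -(addrK Y (M - X)) mgeB.
Qed.

Lemma sch_box a X N : a <= N -> mge a X -> sch a N (box X N).
Proof.
move=> aN aX; split=> [M hM|M Y]; last exact: box_inv.
rewrite /box; case: (boolP (mge N (M - X))) => // h; case/negP: hM.
by rewrite -(subrK X M) mgeD //; exact: mge_le h.
Qed.

Lemma SW_box X N : SW (box X N).
Proof.
have [a ha] := mge_ex X; apply/schwartzP; exists (Num.min a N), N.
by apply: sch_box; [lia|apply: mge_le ha; lia].
Qed.

Lemma sch_decomp a j f : sch a (a + Posz j) f ->
  f = fun M => \sum_(u : mI K j) f (mrep a u) * box (mrep a u) (a + Posz j) M.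
Proof.
move=> [h1 h2]; apply/funext => M.
case: (boolP (mge a M)) => hM; last first.
  rewrite h1 // big1 // => u _; rewrite /box.
  case: (boolP (mge _ _)) => h; last by rewrite mulr0.
  case/negP: hM; rewrite -(subrK (mrep a u) M) mgeD ?mrep_in //.
  by apply: mge_le h; lia.
have [u hu] := mrep_surj j hM.
rewrite (bigD1 u) //= [in X in _ = X + _]/box hu mulr1 big1 ?addr0 => [|w wu].
  by rewrite -[in LHS](subrK (mrep a u) M) addrC h2.
rewrite /box; case: (boolP (mge _ _)) => h; last by rewrite mulr0.
case/eqP: wu; apply: (@mrep_inj K a j).
have -> : mrep a w - mrep a u = (M - mrep a u) - (M - mrep a w).
  by rewrite opprB [RHS]addrC addrA addrNK.
exact: mgeB.
Qed.

Lemma SW_sum (I : Type) (s : seq I) (c : I -> C) (F : I -> fn) :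
  (forall i, SW (F i)) -> SW (fun M => \sum_(i <- s) c i * F i M).
Proof.
move=> h; elim: s => [|i s IH].
  by rewrite (_ : (fun _ => _) = fn0); [exact: SW_0|apply/funext => M; rewrite big_nil].
rewrite (_ : (fun _ => _) = sch_lin (c i) (F i) (fun M => \sum_(i <- s) c i * F i M)).
  exact: SW_lin.
by apply/funext => M; rewrite big_cons.
Qed.

Lemma lin_closed_sum (P : fn -> Prop) (I : Type) (s : seq I) (c : I -> C) (F : I -> fn) :
  P fn0 -> (forall c f f2, SW f -> SW f2 -> P f -> P f2 -> P (sch_lin c f f2)) ->
  (forall i, SW (F i)) -> (forall i, c i != 0 -> P (F i)) ->
  P (fun M => \sum_(i <- s) c i * F i M).
Proof.
move=> P0 Pl hF hP; elim: s => [|i s IH].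
  by rewrite (_ : (fun _ => _) = fn0) //; apply/funext => M; rewrite big_nil.
have [c0|c0] := eqVneq (c i) 0.
  rewrite (_ : (fun _ => _) = (fun M => \sum_(i <- s) c i * F i M)) //.
  by apply/funext => M; rewrite big_cons c0 mul0r add0r.
rewrite (_ : (fun _ => _) = sch_lin (c i) (F i) (fun M => \sum_(i <- s) c i * F i M)).
  by apply: Pl => //; [exact: SW_sum|exact: hP].
by apply/funext => M; rewrite big_cons.
Qed.

(** The clause [f X != 0] keeps the centres away from where f vanishes; this is how balls around the
    zero matrix are avoided later. *)
Lemma sch_ind (P : fn -> Prop) a j f :
  P fn0 -> (forall c f f2, SW f -> SW f2 -> P f -> P f2 -> P (sch_lin c f f2)) ->
  sch a (a + Posz j) f ->
  (forall X, mge a X -> f X != 0 -> P (box X (a + Posz j))) -> P f.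
Proof.
move=> P0 Pl hf hP; rewrite (sch_decomp hf).
apply: lin_closed_sum => // [u|u fu]; first exact: SW_box.
by apply: hP => //; exact: mrep_in.
Qed.

(* The Schwartz functions supported in a compact subset of [GL 2]. *)
Definition SG f : Prop := SW f /\ exists D : int, forall M, f M != 0 -> dt M != 0 /\ vd M <= D.

Lemma SG_0 : SG fn0.
Proof. by split; [exact: SW_0|exists 0 => M; rewrite eqxx]. Qed.

Lemma SG_lin c f1 f2 : SG f1 -> SG f2 -> SG (sch_lin c f1 f2).
Proof.
move=> [h1 [D1 H1]] [h2 [D2 H2]]; split; first exact: SW_lin.
exists (Num.max D1 D2) => M; rewrite /sch_lin => h.
have [e|e] := eqVneq (f1 M) 0.
  by case: (H2 M); [move: h; rewrite e mulr0 add0r|split => //; lia].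
by case: (H1 M e); split=> //; lia.
Qed.

Lemma SW_weil f g1 g2 : GL g1 -> GL g2 -> SW f -> SW (@weil_act C K v q 2 2 g1 g2 f).
Proof.
move=> G1 G2 /schwartzP[c [d [h1 h2]]].
have [n1 H1] := mge_ex g1; have [n1' H1'] := mge_ex (invmx g1).
have [n2 H2] := mge_ex g2; have [n2' H2'] := mge_ex (invmx g2).
apply/schwartzP; exists (n1 + c + n2'), (d - n1' - n2); split=> M.
  move=> hM; rewrite weilE h1 ?mulr0 //; apply: contra hM => hM.
  rewrite (_ : M = g1 *m (invmx g1 *m M *m g2) *m invmx g2).
    by apply: mgeM H2'; [|apply: mgeM H1 hM; exact: lexx]; lia.
  by rewrite !mulmxA mulmxK // mulmxV // mul1mx.
move=> X hX; rewrite !weilE mulmxDr mulmxDl h2 //.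
by apply: mgeM H2; [|apply: mgeM H1' hX; exact: lexx]; lia.
Qed.
Lemma SG_weil f g1 g2 : GL g1 -> GL g2 -> SG f -> SG (@weil_act C K v q 2 2 g1 g2 f).
Proof.
move=> G1 G2 [h [D H]]; split; first exact: SW_weil.
exists (vd g1 - vd g2 + D) => M.
rewrite weilE mulf_eq0 negb_or => /andP[_ /H]; rewrite /vd !dtM !dtV.
case=> d0 dD; have M0 : dt M != 0.
  by apply: contraNneq d0 => ->; rewrite mulr0 mul0r.
have i0 : (dt g1)^-1 != 0 by rewrite invr_eq0 GL_det.
have d1 := GL_det G1; have d2 := GL_det G2.
split=> //; move: dD; rewrite lf_vM ?mulf_neq0 // lf_vM // vV // => dD; lia.
Qed.

Lemma weilM g1 g2 h1 h2 f : GL g1 -> GL g2 -> GL h1 -> GL h2 ->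
  @weil_act C K v q 2 2 g1 g2 (@weil_act C K v q 2 2 h1 h2 f) =
  @weil_act C K v q 2 2 (g1 *m h1) (g2 *m h2) f.
Proof.
move=> G1 G2 H1 H2; apply/funext => M; rewrite !weilE mulrA -qpD !vdetM //.
by congr (qp _ * f _); [lia|rewrite invmxM // !mulmxA].
Qed.

Lemma weil11 f : @weil_act C K v q 2 2 1%:M 1%:M f = f.
Proof.
apply/funext => M; rewrite weilE subrr qp0 mul1r.
by rewrite (invmx_uniq (mul1mx 1%:M)) mul1mx mulmx1.
Qed.

Lemma SW_tr f : SW f -> SW (fun M => f M^T).
Proof.
move=> /schwartzP[a [b [h1 h2]]]; apply/schwartzP; exists a, b; split=> M.
  by move=> h; rewrite h1 // mge_tr.
by move=> X hX; rewrite linearD /= h2 // mge_tr.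
Qed.

(** For bounded M the difference $Mk - M = M(k-1)$ is small, so additive invariance becomes
    invariance under a congruence subgroup. *)
Lemma sch_congrR a b N k f M : sch a b f -> 0 < N -> b <= N + a -> congr_sub v N k ->
  f (M *m k) = f M.
Proof.
move=> [h1 h2] N0 hN hk; have kz := congr_Kz N0 hk.
case: (boolP (mge a M)) => hM; last by rewrite !h1 // Kz_mgeR.
rewrite -(addrNK M (M *m k)) addrC h2 //.
rewrite -{2}(mulmx1 M) -mulmxBr; have /congrP hk' := hk.
by apply: (@mgeM _ _ a N _ _ _ hM); [rewrite addrC|exact: hk'].
Qed.

End Schwartz.
Arguments box {C K} X N.
Arguments fn0 {C K}.
Arguments qp C K k : clear implicits.

(** * Haar integral *)

Section Integral.
Variables (C : numClosedFieldType) (K : lfield).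
Local Notation v := (@lfv K).
Local Notation q := (lfq K).
Local Notation M2 := 'M[lfF K]_2.
Local Notation fn := (M2 -> C).
Local Notation qp := (@qp C K).
Local Notation SW := (@SW C K).
Implicit Types (a b N : int) (M X Y g h k : M2) (f : fn).

(** Representatives of $p^a M_2(O)/p^b M_2(O)$ in the abstract. Translates, $GL_2(O)$-multiples and
    refinements of a system are again systems, and [sum_repsys] compares sums over any two;
    invariance of integrals and of averages rests on this. *)
Definition repsys a b (I : finType) (r : I -> M2) : Prop :=
  [/\ forall i, mge a (r i), forall i j, mge b (r i - r j) -> i = j &
      forall X, mge a X -> exists i, mge b (X - r i)].

Lemma repsys_mrep a (j : nat) : repsys a (a + j%:Z) (@mrep K a j).
Proof. by split; [exact: mrep_in|exact: mrep_inj|exact: mrep_surj]. Qed.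

Lemma sum_repsys (A : nmodType) a b (I J : finType) (r : I -> M2) (r' : J -> M2)
    (phi : M2 -> A) : repsys a b r -> repsys a b r' ->
  (forall X Y, mge a X -> mge a Y -> mge b (X - Y) -> phi X = phi Y) ->
  \sum_i phi (r i) = \sum_j phi (r' j).
Proof.
move=> [r1 r2 r3] [s1 s2 s3] hphi.
have /choice[h Hh] (j : J) : exists i : I, mge b (r' j - r i) by exact: r3.
have /choice[h' Hh'] (i : I) : exists j : J, mge b (r i - r' j) by exact: s3.
rewrite (reindex h) /=; last first.
  exists h' => [j _|i _].
    by apply: s2; rewrite mge_subC -(subrKA (r (h j))) mgeD.
  by apply: r2; rewrite mge_subC -(subrKA (r' (h' i))) mgeD.
by apply: eq_bigr => j _; apply: hphi => //; rewrite mge_subC.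
Qed.

Lemma repsys_addr a b (I : finType) (r : I -> M2) Y : mge a Y -> repsys a b r ->
  repsys a b (fun i => r i + Y).
Proof.
move=> hY [r1 r2 r3]; split=> [i|i j|X hX]; first exact: mgeD.
  by rewrite opprD addrACA subrr addr0; exact: r2.
have [i hi] := r3 (X - Y) (mgeB hX hY); exists i.
by rewrite opprD addrA addrAC.
Qed.

Lemma repsys_mulKz a b (I : finType) (r : I -> M2) k : Kz k -> repsys a b r ->
  repsys a b (fun i => k *m r i).
Proof.
move=> hk [r1 r2 r3]; split=> [i|i j|X hX]; first by rewrite Kz_mgeL.
  by rewrite -mulmxBr Kz_mgeL //; exact: r2.
have [|i hi] := r3 (invmx k *m X); first by rewrite Kz_mgeL //; exact: KzV.
by exists i; rewrite -(Kz_mgeL _ _ (KzV hk)) mulmxBr mulKmx //; case: hk.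
Qed.

Lemma repsys_mulrKz a b (I : finType) (r : I -> M2) k : Kz k -> repsys a b r ->
  repsys a b (fun i => r i *m k).
Proof.
move=> hk [r1 r2 r3]; split=> [i|i j|X hX]; first by rewrite Kz_mgeR.
  by rewrite -mulmxBl Kz_mgeR //; exact: r2.
have [|i hi] := r3 (X *m invmx k); first by rewrite Kz_mgeR //; exact: KzV.
by exists i; rewrite -(Kz_mgeR _ _ (KzV hk)) mulmxBl mulmxK //; case: hk.
Qed.

Lemma repsys_prod a (j i : nat) : repsys a (a + (j + i)%N%:Z)
  (fun p : mI K j * mI K i => mrep a p.1 + mrep (a + j%:Z) p.2).
Proof.
split=> [[u w]|[u w] [u' w']|X hX] /=.
- by rewrite mgeD ?mrep_in //; apply: mge_le (mrep_in _ w); lia.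
- move=> h; have uu : u = u'.
    apply: (@mrep_inj K a j).
    have -> : mrep a u - mrep a u' = (mrep a u + mrep (a + j%:Z) w - (mrep a u' + mrep (a + j%:Z) w'))
        + (mrep (a + j%:Z) w' - mrep (a + j%:Z) w).
      by apply/matrixP => x y; rewrite !mxE; ring.
    by apply: mgeD; [apply: mge_le h; lia|rewrite mgeB ?mrep_in].
  rewrite uu; congr pair; apply: (@mrep_inj K (a + j%:Z) i); move: h.
  rewrite uu opprD addrACA subrr add0r; apply: mge_le; lia.
- have [u hu] := mrep_surj j hX; have [w hw] := mrep_surj i hu.
  by exists (u, w); rewrite opprD addrA /=; apply: mge_le hw; lia.
Qed.

Definition Tsum a (j : nat) f : C := \sum_(u : mI K j) f (mrep a u).

Lemma sch_resp a b f : sch a b f -> forall X Y, mge a X -> mge a Y -> mge b (X - Y) -> f X = f Y.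
Proof. by move=> [_ h] X Y _ _ hXY; rewrite -(subrK Y X) addrC h. Qed.

Lemma Tsum_refine a (j i : nat) f : sch a (a + j%:Z) f ->
  Tsum a (j + i) f = (q%:R ^+ (4 * i)) * Tsum a j f.
Proof.
move=> hf; rewrite /Tsum.
rewrite (@sum_repsys _ _ _ _ _ _ _ f (repsys_mrep a (j + i)) (repsys_prod a j i)); last first.
  by apply: sch_resp; apply: sch_le hf; lia.
rewrite -(pair_bigA _ (fun u w => f (mrep a u + mrep (a + j%:Z) w))) /= mulr_sumr.
apply: eq_bigr => u _.
rewrite (eq_bigr (fun=> f (mrep a u))) => [|w _]; last first.
  by case: hf => _ ->//; exact: mrep_in.
by rewrite sumr_const card_mI -expnM mulnC -natrX mulr_natl.
Qed.

Lemma Tsum_extend a (j i : nat) f : sch a (a + j%:Z) f ->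
  Tsum (a - i%:Z) (i + j) f = Tsum a j f.
Proof.
move=> hf; rewrite /Tsum.
have e : a - i%:Z + i%:Z = a by rewrite subrK.
rewrite (@sum_repsys _ _ _ _ _ _ _ f (repsys_mrep _ (i + j)) (repsys_prod _ i j)); last first.
  by apply: sch_resp; apply: sch_le hf; lia.
rewrite -(pair_bigA _ (fun u w => f (mrep (a - i%:Z) u + mrep (a - i%:Z + i%:Z) w))) /= e.
have [u0 h0] := mrep_surj (a := a - i%:Z) i (mge0 K _); rewrite e in h0.
rewrite (bigD1 u0) //= [X in _ + X]big1 ?addr0 => [|u uu0]; last first.
  apply: big1 => w _; case: hf => -> //; apply: contraNN uu0 => h; apply/eqP.
  apply: (@mrep_inj K (a - i%:Z) i); rewrite e.
  have -> : mrep (a - i%:Z) u - mrep (a - i%:Z) u0 = (mrep (a - i%:Z) u + mrep a w) - mrep a w + (0 - mrep (a - i%:Z) u0).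
    by rewrite addrK sub0r.
  by rewrite mgeD // mgeB // mrep_in.
have h1 : mge a (mrep (a - i%:Z) u0) by rewrite -mgeN -sub0r.
under eq_bigr do rewrite addrC.
exact: (sum_repsys (repsys_addr h1 (repsys_mrep a j)) (repsys_mrep a j) (sch_resp hf)).
Qed.

(** Both sides are compared with a third sum over a larger lattice modulo a finer one. *)
Lemma Tsum_indep a (j : nat) a' (j' : nat) f : sch a (a + j%:Z) f -> sch a' (a' + j'%:Z) f ->
  qp (- (4 * (a + j%:Z))) * Tsum a j f = qp (- (4 * (a' + j'%:Z))) * Tsum a' j' f.
Proof.
have main a1 (j1 : nat) a2 (j2 : nat) : sch a1 (a1 + j1%:Z) f -> a2 <= a1 -> a1 + j1%:Z <= a2 + j2%:Z ->
    qp (- (4 * (a1 + j1%:Z))) * Tsum a1 j1 f = qp (- (4 * (a2 + j2%:Z))) * Tsum a2 j2 f.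
  move=> h1 ha hb.
  have [i ei] : exists i : nat, a1 - i%:Z = a2 by exists `|a1 - a2|%N; lia.
  have [l el] : exists l : nat, (i + (j1 + l))%N = j2 by exists (j2 - i - j1)%N; lia.
  rewrite -ei -el Tsum_extend; last by apply: sch_le h1; lia.
  rewrite Tsum_refine // mulrA (_ : qp (- (4 * (a1 - i%:Z + (i + (j1 + l))%N%:Z))) =
     qp (- (4 * (a1 + j1%:Z))) * qp (- (4 * l)%N%:Z)); last by rewrite -qpD; congr qp; lia.
  by rewrite (qpN _ _ (4 * l)%N%:Z) qp_nat -!mulrA mulKf // expf_neq0 ?q_neq0.
move=> h1 h2; have [a3 [j3 [_ _]]] := sch_common h1 h2.
pose a4 := Num.min a a'; pose j4 := absz (Num.max (a + j%:Z) (a' + j'%:Z) - a4)%R.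
by rewrite (main _ _ a4 j4 h1) ?(main _ _ a4 j4 h2) //; rewrite /j4 /a4; lia.
Qed.

(** Haar integral giving $M_2(O)$ volume 1: the factor [qp (- (4 * (a + j)))] is the volume of one
    class modulo $p^{a+j} M_2(O)$. [Tsum_indep] makes the chosen pair immaterial; 0 is a default for
    functions that are not Schwartz. *)
Definition Int f : C :=
  if pselect (exists p : int * nat, sch p.1 (p.1 + p.2%:Z) f) is left h
  then let p := sval (cid h) in qp (- (4 * (p.1 + p.2%:Z))) * Tsum p.1 p.2 f else 0.

Lemma IntE a (j : nat) f : sch a (a + j%:Z) f ->
  Int f = qp (- (4 * (a + j%:Z))) * Tsum a j f.
Proof.
move=> h; rewrite /Int; case: pselect => [h'|]; last by case; exists (a, j).
by apply: Tsum_indep => //; exact: (svalP (cid h')).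
Qed.

Lemma Int_lin c f1 f2 : SW f1 -> SW f2 -> Int (sch_lin c f1 f2) = c * Int f1 + Int f2.
Proof.
move=> /schwartzP[a [b h1]] /schwartzP[a' [b' h2]].
have [a2 [j [H1 H2]]] := sch_common h1 h2.
have H3 : sch a2 (a2 + j%:Z) (sch_lin c f1 f2).
  split=> [M hM|M X hX]; first by rewrite /sch_lin H1.1 // H2.1 // mulr0 addr0.
  by rewrite /sch_lin H1.2 // H2.2.
rewrite (IntE H1) (IntE H2) (IntE H3) /Tsum /sch_lin big_split /= -mulr_sumr.
by ring.
Qed.

Lemma Int_0 : Int fn0 = 0.
Proof.
have h : sch 0 (0 + 0%N%:Z) (@fn0 C K) by split.
by rewrite (IntE h) /Tsum big1 ?mulr0.
Qed.

Lemma Int_transl f Y : SW f -> Int (fun M => f (M + Y)) = Int f.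
Proof.
move=> /schwartzP[a [b h1]]; have [c hc] := mge_ex Y.
have [j h] : exists j : nat, sch (Num.min a c) (Num.min a c + j%:Z) f.
  by apply: (@sch_norm _ _ _ _ b); apply: sch_le h1; lia.
have hY : mge (Num.min a c) Y by apply: mge_le hc; lia.
have h' : sch (Num.min a c) (Num.min a c + j%:Z) (fun M => f (M + Y)).
  split=> [M hM|M X hX]; last by rewrite /= addrAC (h.2 (M + Y)).
  by apply: h.1; apply: contra hM => hM; rewrite -(addrK Y M) mgeB.
rewrite (IntE h) (IntE h'); congr (_ * _).
exact: (sum_repsys (repsys_addr hY (repsys_mrep _ j)) (repsys_mrep _ j) (sch_resp h)).
Qed.

Lemma Int_box0 N : Int (box 0 N) = qp (- (4 * N)).
Proof.
have h : sch N (N + 0%N%:Z) (@box C K 0 N) by rewrite addr0; apply: sch_box; [exact: lexx|exact: mge0].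
rewrite (IntE h) addr0 /Tsum (eq_bigr (fun=> 1)) => [|u _].
  by rewrite sumr_const card_mI expn0 exp1n mulr1.
by rewrite /box subr0 mrep_in.
Qed.

Lemma Int_ge0 f : SW f -> (forall M, 0 <= f M) -> 0 <= Int f.
Proof.
move=> /schwartzP[a [b h1]] hf; have [j h] := sch_norm h1.
by rewrite (IntE h) mulr_ge0 ?(ltW (qp_gt0 _ _ _)) // sumr_ge0.
Qed.

(** Uniqueness of Haar measure. An invariant functional is determined by its values on the balls
    around 0, and a large ball is a finite union of translates of a small one. *)
Lemma Int_uniq (J : fn -> C) :
  (forall c f f2, SW f -> SW f2 -> J (sch_lin c f f2) = c * J f + J f2) ->
  (forall f Y, SW f -> J (fun M => f (M + Y)) = J f) ->
  forall f, SW f -> J f = J (box 0 0) * Int f.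
Proof.
move=> Jl Jt.
have J0 : J fn0 = 0.
  have := Jl (-1) _ _ (SW_0 C K) (SW_0 C K).
  rewrite (_ : sch_lin _ _ _ = fn0); first by rewrite mulN1r addNr.
  by apply/funext => M; rewrite /sch_lin /fn0 mulr0 addr0.
have Jbox X N : J (box X N) = J (box 0 N).
  rewrite -(Jt _ X (SW_box _ X N)); congr J; apply/funext => M.
  by rewrite /box addrK subr0.
have Jsum a (j : nat) f : sch a (a + j%:Z) f -> J f = Tsum a j f * J (box 0 (a + j%:Z)).
  move=> h; rewrite {1}(sch_decomp h) /Tsum mulr_suml.
  elim: (index_enum _) => [|u s IH].
    rewrite big_nil -J0; congr J; apply/funext => M; by rewrite big_nil.
  rewrite big_cons -IH -(Jbox (mrep a u)) -Jl; [|exact: SW_box|by apply: SW_sum => w; exact: SW_box].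
  by congr J; apply/funext => M; rewrite /sch_lin big_cons.
move=> f /schwartzP[a [b h1]]; pose c := Num.min a 0.
have [j h] : exists j : nat, sch c (c + j%:Z) f.
  by apply: (@sch_norm _ _ _ _ b); apply: sch_le h1 => //; rewrite /c; lia.
pose m := absz (Num.max (c + j%:Z) 0)%R.
have h0 : sch c (c + `|m%:Z - c|%N%:Z) f by apply: sch_le h; lia.
have hb : sch 0 (0 + m%:Z) (@box C K 0 0) by apply: (@sch_le _ _ 0 0); [lia|lia|exact: sch_box (mge0 _ _)].
rewrite (Jsum _ _ _ h0) (Jsum _ _ _ hb) (IntE h0).
have e : c + `|m%:Z - c|%N%:Z = m%:Z by lia.
rewrite e add0r.
have e2 : Tsum 0 m (@box C K 0 0) = qp (4 * m%:Z).
  have := Int_box0 0; rewrite (IntE hb) add0r => e3.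
  have -> : 4 * m%:Z = - (- (4 * m%:Z)) by rewrite opprK.
  by rewrite qpN; apply: (mulfI (qp_neq0 C K (- (4 * m%:Z)))); rewrite e3 divff ?qp_neq0 // mulr0 oppr0 qp0.
by rewrite e2 mulrACA -qpD subrr qp0 mul1r mulrC.
Qed.

Lemma Int_tr f : SW f -> Int (fun M => f M^T) = Int f.
Proof.
move=> hf; rewrite (Int_uniq (J := fun f => Int (fun M => f M^T))) //.
- rewrite (_ : (fun M => box 0 0 M^T) = box 0 0) ?Int_box0 ?mulr0 ?oppr0 ?qp0 ?mul1r //.
  by apply/funext => M; rewrite /box !subr0 mge_tr.
- by move=> c f1 f2 h1 h2; rewrite -Int_lin //; exact: SW_tr.
- move=> f1 Y h1; rewrite -[RHS](Int_transl Y^T); last exact: SW_tr.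
  by congr Int; apply/funext => M; rewrite linearD /= trmxK.
Qed.

Lemma SW_mull f g : GL g -> SW f -> SW (fun M => f (g *m M)).
Proof.
move=> hg hf; have := SW_weil (GLV hg) (@GL1 K) hf.
set f' := weil_act _ _ _ _ _ => hf'.
have := SW_lin (qp (- vd (invmx g)))  hf' (SW_0 C K).
congr SW; apply/funext => M; rewrite /sch_lin /f' weilE invmxK mulmx1 /fn0 addr0.
rewrite (_ : vd (1%:M : M2) = 0) ?subr0 ?mulrA -?qpD ?addNr ?qp0 ?mul1r //.
by rewrite /vd /dt det1 v1.
Qed.

Lemma SW_mulr f g : GL g -> SW f -> SW (fun M => f (M *m g)).
Proof.
move=> hg hf; have := SW_tr (SW_mull (GLT hg) (SW_tr hf)).
by congr SW; apply/funext => M; rewrite trmx_mul !trmxK.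
Qed.

(** The module of left multiplication by [g], measured on $M_2(O)$. *)
Definition modc g : C := Int (fun M => box 0 0 (g *m M)).

Lemma modcE g f : GL g -> SW f -> Int (fun M => f (g *m M)) = modc g * Int f.
Proof.
move=> hg hf; rewrite (Int_uniq (J := fun f => Int (fun M => f (g *m M)))) //.
  by move=> c f1 f2 h1 h2; rewrite -Int_lin //; exact: SW_mull.
move=> f1 Y h1; rewrite -[RHS](Int_transl (invmx g *m Y)); last exact: SW_mull.
by congr Int; apply/funext => M; rewrite mulmxDr mulKVmx.
Qed.

Lemma modcM g h : GL g -> GL h -> modc (g *m h) = modc g * modc h.
Proof.
move=> hg hh; rewrite mulrC -[modc g]/(Int _) -(modcE hh); last by apply: SW_mull => //; exact: SW_box.
by congr Int; apply/funext => M; rewrite mulmxA.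
Qed.

Lemma modc1 : modc 1%:M = 1.
Proof.
by rewrite /modc; under [fun _ => _]funext do rewrite mul1mx; rewrite Int_box0 mulr0 oppr0 qp0.
Qed.

Lemma modc_ge0 g : GL g -> 0 <= modc g.
Proof.
move=> hg; apply: Int_ge0 => [|M]; last by rewrite ler0n.
by apply: SW_mull => //; exact: SW_box.
Qed.

Lemma modc_Kz g : Kz g -> modc g = 1.
Proof.
move=> hg; rewrite -[RHS]modc1; congr Int; apply/funext => M.
by rewrite mul1mx /box !subr0 Kz_mgeL.
Qed.

Lemma modc_scalar (a : K) : a != 0 -> modc a%:M = qp (4 * v a).
Proof.
move=> a0; rewrite (_ : 4 * v a = - (4 * - v a)) -?Int_box0; last by lia.
congr Int; apply/funext => M; rewrite /box !subr0 mul_scalar_mx mgeZ //.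
by rewrite sub0r.
Qed.

End Integral.

(** * Generators of $GL_2$ *)

Section GL2.
Variable K : lfield.
Local Notation v := (@lfv K).
Local Notation M2 := 'M[lfF K]_2.
Implicit Types (g h k : M2) (x y a d : K).

Definition nu x : M2 := mx2 1 x 0 1.
Definition nl x : M2 := mx2 1 0 x 1.
Definition dg a d : M2 := mx2 a 0 0 d.
Definition ww : M2 := mx2 0 1 1 0.

Lemma GL_nu x : GL (nu x).
Proof. by rewrite /GL mx2_unit mulr1 mulr0 subr0 oner_neq0. Qed.
Lemma GL_nl x : GL (nl x).
Proof. by rewrite /GL mx2_unit mulr1 mul0r subr0 oner_neq0. Qed.
Lemma GL_dg a d : a != 0 -> d != 0 -> GL (dg a d).
Proof. by move=> a0 d0; rewrite /GL mx2_unit mul0r subr0 mulf_neq0. Qed.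
Lemma GL_ww : GL ww.
Proof. by rewrite /GL mx2_unit mul0r sub0r mulr1 oppr_eq0 oner_neq0. Qed.

Lemma nuD x y : nu x *m nu y = nu (x + y).
Proof. by rewrite /nu mx2_mul; congr mx2; ring. Qed.
Lemma nlD x y : nl x *m nl y = nl (x + y).
Proof. by rewrite /nl mx2_mul; congr mx2; ring. Qed.
Lemma nu0 : nu 0 = 1%:M. Proof. by rewrite mx2_1. Qed.
Lemma nl0 : nl 0 = 1%:M. Proof. by rewrite mx2_1. Qed.
Lemma nuV x : invmx (nu x) = nu (- x).
Proof. by apply: invmx_uniq; rewrite nuD subrr nu0. Qed.
Lemma nlV x : invmx (nl x) = nl (- x).
Proof. by apply: invmx_uniq; rewrite nlD subrr nl0. Qed.
Lemma dgV a d : a != 0 -> d != 0 -> invmx (dg a d) = dg a^-1 d^-1.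
Proof.
by move=> a0 d0; apply: invmx_uniq; rewrite /dg mx2_mul mx2_1 !mulfV //; congr mx2; ring.
Qed.
Lemma wwK : ww *m ww = 1%:M.
Proof. by rewrite /ww mx2_mul mx2_1; congr mx2; ring. Qed.
Lemma mge_int a b c d : [&& vge v 0 a, vge v 0 b, vge v 0 c & vge v 0 d] ->
  a * d - b * c != 0 -> v (a * d - b * c) = 0 -> Kz (mx2 a b c d).
Proof.
move=> h d0 vd0; apply: Kz_mge0; rewrite ?mge_mx2 //; first by rewrite /GL mx2_unit.
by rewrite /vd mx2_det.
Qed.

Lemma Kz_ww : Kz ww.
Proof.
apply: mge_int; rewrite ?vge0 ?vge1 // mul0r sub0r mulr1 ?oppr_eq0 ?oner_neq0 //.
exact: vN1.
Qed.

Lemma Kz_nu x : vge v 0 x -> Kz (nu x).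
Proof.
by move=> hx; apply: mge_int; rewrite ?hx ?vge0 ?vge1 // mulr1 mulr0 subr0 ?oner_neq0 ?v1.
Qed.

Lemma Kz_nl x : vge v 0 x -> Kz (nl x).
Proof.
by move=> hx; apply: mge_int; rewrite ?hx ?vge0 ?vge1 // mulr1 mul0r subr0 ?oner_neq0 ?v1.
Qed.

Lemma Kz_dg a d : a != 0 -> d != 0 -> v a = 0 -> v d = 0 -> Kz (dg a d).
Proof.
move=> a0 d0 va vd; apply: mge_int; rewrite ?mul0r ?subr0 ?mulf_neq0 ?lf_vM ?va ?vd //.
by rewrite !vge0 !vgeE // va vd.
Qed.

Lemma vd_dg a d : a != 0 -> d != 0 -> vd (dg a d) = v a + v d.
Proof. by move=> a0 d0; rewrite /vd mx2_det mul0r subr0 lf_vM. Qed.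
Lemma vd_nu x : vd (nu x) = 0.
Proof. by rewrite /vd mx2_det mulr0 mulr1 subr0 v1. Qed.
Lemma vd_nl x : vd (nl x) = 0.
Proof. by rewrite /vd mx2_det mul0r mulr1 subr0 v1. Qed.

(** Gaussian elimination: lower unipotent times diagonal times upper unipotent if the upper left
    entry is nonzero; otherwise the factor [nu (-1)] makes it nonzero first. *)
Lemma GL2_ind (P : M2 -> Prop) :
  (forall g h, GL g -> GL h -> P g -> P h -> P (g *m h)) ->
  (forall x, P (nu x)) -> (forall x, P (nl x)) ->
  (forall a, a != 0 -> P (dg a 1)) -> (forall a, a != 0 -> P (dg 1 a)) ->
  forall g, GL g -> P g.
Proof.
move=> PM Pu Pl Pa Pd.
have main a b c d : a != 0 -> GL (mx2 a b c d) -> P (mx2 a b c d).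
  move=> a0; rewrite /GL mx2_unit => D0.
  have d0 : d - c * b / a != 0.
    apply: contraNneq D0 => e; apply/eqP; rewrite (_ : a * d - b * c = a * (d - c * b / a)).
      by rewrite e mulr0.
    by field.
  have -> : mx2 a b c d = nl (c / a) *m (dg a 1 *m (dg 1 (d - c * b / a) *m nu (b / a))).
    by rewrite /nl /dg /nu !mx2_mul; congr mx2; field.
  have o0 := oner_neq0 (lfF K).
  have A := PM _ _ (GL_dg o0 d0) (GL_nu (b / a)) (Pd _ d0) (Pu (b / a)).
  have hA := GLM (GL_dg o0 d0) (GL_nu (b / a)).
  have B := PM _ _ (GL_dg a0 o0) hA (Pa _ a0) A.
  exact: (PM _ _ (GL_nl _) (GLM (GL_dg a0 o0) hA) (Pl _) B).
move=> g hg; rewrite (mx2P g).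
have [a0|a0] := eqVneq (g 0 0) 0; last by apply: main => //; rewrite -mx2P.
have c0 : g 1 0 != 0.
  by have := GL_det hg; rewrite det2E a0 mul0r sub0r oppr_eq0 mulf_eq0 negb_or => /andP[].
have e : mx2 (g 0 0) (g 0 1) (g 1 0) (g 1 1) = nu (-1) *m mx2 (g 1 0) (g 0 1 + g 1 1) (g 1 0) (g 1 1).
  by rewrite /nu mx2_mul a0; congr mx2; ring.
have h2 : GL (mx2 (g 1 0) (g 0 1 + g 1 1) (g 1 0) (g 1 1)).
  have := GL_det hg; rewrite /GL mx2_unit det2E a0 mul0r => h.
  rewrite (_ : _ - _ = 0 - g 0 1 * g 1 0) //; ring.
by rewrite e; apply: PM => //; [exact: GL_nu|exact: main].
Qed.

End GL2.

(** * Change of variables in the integral *)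

Section Module.
Variables (C : numClosedFieldType) (K : lfield).
Local Notation v := (@lfv K).
Local Notation M2 := 'M[lfF K]_2.
Local Notation qp := (@qp C K).
Implicit Types (g h : M2) (f : M2 -> C).

Lemma two_neq0 : (2%:R : K) != 0.
Proof.
apply/negP => h; have : 2%N \in [pchar K] by rewrite inE /= h.
by rewrite lf_char0.
Qed.

(* Elementary unipotent matrices are commutators because [2 != 0], so the module is trivial on them; on
   diagonal matrices it is read off its square. *)
Lemma modc_val g : GL g -> modc C g = qp (2 * vd g).
Proof.
have o0 := oner_neq0 (lfF K).
have comm (x y : M2) : GL x -> GL y -> modc C (x *m y *m invmx x *m invmx y) = 1.
  move=> hx hy; have hx' := GLV hx; have hy' := GLV hy.
  have cV (z : M2) : GL z -> modc C z * modc C (invmx z) = 1.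
    by move=> hz; rewrite -modcM ?mulmxV ?modc1 //; exact: GLV.
  rewrite (modcM _ (GLM (GLM hx hy) hx') hy') (modcM _ (GLM hx hy) hx') (modcM _ hx hy).
  by rewrite -mulrA mulrACA !cV // mulr1.
have diag (a : K) : a != 0 -> modc C (dg a 1) = qp (2 * v a) /\ modc C (dg 1 a) = qp (2 * v a).
  move=> a0.
  have e1 : modc C (dg a 1) = modc C (dg 1 a).
    have -> : dg a 1 = ww K *m dg 1 a *m ww K.
      by rewrite /dg /ww !mx2_mul; congr mx2; ring.
    have hd := GL_dg o0 a0; have hw := GL_ww K; have hk := Kz_ww K.
    by rewrite (modcM _ (GLM hw hd) hw) (modcM _ hw hd) (modc_Kz _ hk) mul1r mulr1.
  have e2 : modc C (dg a 1) ^+ 2 = qp (2 * v a) ^+ 2.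
    rewrite expr2 {2}e1 -modcM; [|exact: GL_dg|exact: GL_dg].
    have -> : dg a 1 *m dg 1 a = a%:M.
      by rewrite /dg mx2_mul -[a%:M]mulmx1 mul_scalar_mx mx2_1; apply/esym/mx2_eqP; rewrite !mxE /=; ring.
    by rewrite modc_scalar // expr2 -qpD; congr qp; lia.
  have e3 : modc C (dg a 1) = qp (2 * v a).
    apply/eqP; move/eqP: e2; rewrite eqf_sqr => /orP[//|/eqP e3].
    have := modc_ge0 C (GL_dg a0 o0); rewrite e3 oppr_ge0 => h.
    by have := lt_le_trans (qp_gt0 C K (2 * v a)) h; rewrite ltxx.
  by rewrite -e1 e3.
move: g; apply: GL2_ind.
- by move=> g h hg hh eg eh; rewrite modcM // eg eh -qpD vdetM // mulrDr.
- move=> x; rewrite vd_nu mulr0 qp0 -(comm (dg 2%:R 1) (nu x)); last exact: GL_nu.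
    congr modc; rewrite dgV ?two_neq0 // nuV /nu /dg !mx2_mul.
    have := two_neq0 => t0; by congr mx2; field; rewrite o0 t0.
  by apply: GL_dg => //; exact: two_neq0.
- move=> x; rewrite vd_nl mulr0 qp0 -(comm (dg 1 2%:R) (nl x)); last exact: GL_nl.
    congr modc; rewrite dgV ?two_neq0 // nlV /nl /dg !mx2_mul.
    have := two_neq0 => t0; by congr mx2; field; rewrite o0 t0.
  by apply: GL_dg => //; exact: two_neq0.
- by move=> a a0; rewrite vd_dg // v1 addr0; case: (diag a a0).
- by move=> a a0; rewrite vd_dg // v1 add0r; case: (diag a a0).
Qed.

Lemma Int_mull g f : GL g -> SW f -> Int (fun M => f (g *m M)) = qp (2 * vd g) * Int f.
Proof. by move=> hg hf; rewrite modcE // modc_val. Qed.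

Lemma Int_mulr g f : GL g -> SW f -> Int (fun M => f (M *m g)) = qp (2 * vd g) * Int f.
Proof.
move=> hg hf; have gt := GLT hg.
rewrite -(Int_tr hf) -(_ : vd g^T = vd g); last by rewrite /vd dt_tr.
rewrite -Int_mull //; last exact: SW_tr.
rewrite -(Int_tr (SW_mulr hg hf)).
by congr Int; apply/funext => M; rewrite trmx_mul trmxK.
Qed.

End Module.

(** * An additive character *)

Section Character.
Variables (C : numClosedFieldType) (K : lfield).
Local Notation v := (@lfv K).
Local Notation pi := (lfpi K).
Local Notation q := (lfq K).
Local Open Scope classical_set_scope.

(** Graphs of characters of subgroups of K, so that extension is inclusion and Zorn's lemma applies
    to sets. *)
Definition pchar_graph (G : set (K * C)) : Prop :=
  [/\ forall x c d, G (x, c) -> G (x, d) -> c = d,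
      forall x y c d, G (x, c) -> G (y, d) -> G (x + y, c * d),
      forall x c, G (x, c) -> G (- x, c^-1) &
      forall x c, G (x, c) -> c != 0].

Lemma pchar_graphM G x c (k : int) : pchar_graph G -> G (0, 1) -> G (x, c) -> G (x *~ k, c ^ k).
Proof.
move=> [h1 h2 h3 h4] G0 Gx.
have H (n : nat) : G (x *+ n, c ^+ n).
  by elim: n => [|n IH]; rewrite ?mulr0n // mulrS exprS; exact: h2.
case: k => n; first exact: H.
by rewrite NegzE mulrNz -exprnN -pmulrn; apply: h3; exact: H.
Qed.

(* [x] is torsion modulo the domain of [G]; its image is a root of the value at its first multiple in
   that domain, nontrivial if that value is [1]. *)
Lemma pchar_extend (G : set (K * C)) (x : K) : pchar_graph G ->
  (forall y, vge v 0 y -> G (y, 1)) -> (forall c, ~ G (x, c)) ->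
  exists G' z, [/\ pchar_graph G', G `<=` G', G' (x, z) &
    ((forall y c, G (y, c) -> c = 1) -> z != 1)].
Proof.
move=> hG GO Gx; have [h1 h2 h3 h4] := hG; have G0 : G (0, 1) by apply: GO; exact: vge0.
(* Since q lies in p, the multiple $q^{|N|} x$ of $x \in p^N$ is integral. *)
have tors : exists n : nat, `[<exists c, G (x *+ n.+1, c)>].
  have [N hN] := vge_ex x.
  have qk (k : nat) : vge v k%:Z ((q ^ k)%:R : K).
    elim: k => [|k IH]; first by rewrite expn0 vge1.
    rewrite expnS natrM; apply: vgeM_le (residue_torsion K) IH; lia.
  exists ((q ^ `|N|).-1)%N; apply/asboolP; exists 1; apply: GO.
  rewrite prednK ?expn_gt0 ?(ltnW (q_gt1 K)) // -mulr_natr.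
  by apply: vgeM_le hN (qk _); lia.
have [n /asboolP[c0 hc0] nmin] := ex_minnP tors.
pose m := n.+1.
have n0 : (0 < n)%N by case: (n) hc0 => // h; case: (Gx c0); rewrite mulr1n in h.
have [z zm z1] : exists2 z : C, z ^+ m = c0 & (c0 = 1 -> z != 1).
  have [e|e] := eqVneq c0 1; last first.
    by exists (m.-root c0); [rewrite rootCK|move=> e1; rewrite e1 eqxx in e].
  (* A root of $1 + X + \dots + X^{m-1}$ is an m-th root of unity; it is not 1, where the polynomial
     takes the value m. *)
  have [|z hz] := closed_rootP (\poly_(i < m) (1 : C)) _.
    by rewrite size_poly_eq ?oner_neq0 //; lia.
  move: hz; rewrite /root horner_poly => /eqP hz.
  exists z; rewrite ?e.
    by apply/eqP; rewrite -subr_eq0 subrX1; under eq_bigr do rewrite -[z ^+ _]mul1r; rewrite hz mulr0.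
  move=> _; apply: contra_eq_neq hz => ->.
  under eq_bigr do rewrite expr1n mulr1.
  by rewrite sumr_const card_ord pnatr_eq0.
have z0 : z != 0.
  by apply: contraTneq (h4 _ _ hc0) => e; rewrite -zm e expr0n /= eqxx.
(* Minimality of m forces m to divide d, so the powers of [z] agree with the values already
   prescribed by [G]. *)
have period (d : int) c : G (x *~ d, c) -> z ^ d = c.
  move=> hd; have ed := divz_eq d m%:Z; set t := (d %/ m)%Z in ed; set r := (d %% m)%Z in ed.
  have Gt : G (x *~ (t * m%:Z), c0 ^ t).
    by rewrite mulrC mulrzA -pmulrn; exact: pchar_graphM.
  have Gr : exists c', G (x *~ r, c').
    exists (c * (c0 ^ t)^-1); have -> : x *~ r = x *~ d - x *~ (t * m%:Z).
      by rewrite -mulrzBr {1}ed addrAC subrr add0r.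
    by apply: h2 => //; exact: h3.
  have r0 : r = 0.
    have rge : 0 <= r by apply: modz_ge0.
    have rlt : r < m%:Z by apply: ltz_pmod.
    case er: r rge rlt Gr => [[//|r']|//] _ rlt [c' Gr].
    have : (n <= r')%N by apply: nmin; apply/asboolP; exists c'; rewrite pmulrn.
    by rewrite /m in rlt; lia.
  rewrite r0 addr0 in ed; rewrite ed in hd *.
  rewrite (h1 _ _ _ hd Gt) mulrC -exprz_exp -exprnP zm //.
pose G' : set (K * C) := fun p => exists h c k, [/\ G (h, c), p.1 = h + x *~ k & p.2 = c * z ^ k].
exists G', z; split.
- split=> [y c d [a [a' [k [/= ga -> ->]]]] [b [b' [l [/= gb e ->]]]]
         |y y' c d [a [a' [k [/= ga -> ->]]]] [b [b' [l [/= gb -> ->]]]]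
         |y c [a [a' [k [/= ga -> ->]]]]|y c [a [a' [k [/= ga _ ->]]]]].
  + have Gd : G (x *~ (l - k), a' * b'^-1).
      have -> : x *~ (l - k) = a - b.
        by rewrite mulrzBr; apply/eqP; rewrite subr_eq addrAC -subr_eq opprK e addrC.
      by apply: h2 => //; exact: h3.
    have /eqP := period _ _ Gd; rewrite expfzDr // -invr_expz.
    rewrite eqr_div ?expfz_neq0 ?(h4 _ _ gb) // => /eqP e3.
    by rewrite -e3 mulrC.
  + exists (a + b), (a' * b'), (k + l); split; [exact: h2|rewrite mulrzDr addrACA //|].
    by rewrite /= expfzDr // mulrACA.
  + exists (- a), a'^-1, (- k); split; [exact: h3|by rewrite mulrNz opprD|].
    by rewrite /= -invr_expz invfM.
  + by rewrite mulf_neq0 ?expfz_neq0 ?(h4 _ _ ga).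
- by move=> [y c] gy; exists y, c, 0; rewrite mulr0z addr0 expr0z mulr1.
- by exists 0, 1, 1; rewrite mulr1z add0r expr1z mul1r.
- by move=> hall; apply: z1; exact: hall hc0.
Qed.

(** The trivial character of O is first extended to $\pi^{-1}$, where the value can be chosen
    different from 1. A maximal extension of the result is defined everywhere, by [pchar_extend]. *)
Lemma char_exists : exists psi : K -> C,
  [/\ forall x y, psi (x + y) = psi x * psi y,
      forall x, vge v 0 x -> psi x = 1 &
      exists2 e, vge v (-1) e & psi e != 1].
Proof.
pose G0 : set (K * C) := fun p => vge v 0 p.1 /\ p.2 = 1.
have hG0 : pchar_graph G0.
  split=> [x c d [_ /= ->] [_ /= ->]|x y c d [/= hx ->] [/= hy ->]|x c [/= hx ->]|x c [_ /= ->]] //.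
  - by split; rewrite /= ?mulr1 // vgeD.
  - by split; rewrite /= ?invr1 // vgeN.
  - exact: oner_neq0.
have [|c [/=]|G1 [z [hG1 G01 G1e /(_ _) z1]]] := @pchar_extend G0 pi^-1 hG0.
- by [].
- by rewrite vgeE ?invr_eq0 ?lf_pi0 // vV ?lf_pi0 // lf_vpi.
(* The alternative [G = set0] is there for the empty chain, whose union is empty. *)
pose P (G : set (K * C)) := pchar_graph G /\ (G = set0 \/ G1 `<=` G).
have [|A [[hA hA1] Amax]] := @Zorn_bigcup _ P.
  move=> F FP tot; split.
    have two p p' : (\bigcup_(X in F) X) p -> (\bigcup_(X in F) X) p' -> exists2 X, F X & X p /\ X p'.
      move=> [X FX Xp] [Y FY Yp]; case: (tot X Y FX FY) => h.
        by exists Y => //; split=> //; exact: h.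
      by exists X => //; split=> //; exact: h.
    split=> [x c d h h'|x y c d h h'|x c [X FX Xx]|x c [X FX Xx]].
    - by have [X FX [X1 X2]] := two _ _ h h'; have [[h1 _ _ _] _] := FP _ FX; exact: h1 X1 X2.
    - have [X FX [X1 X2]] := two _ _ h h'; have [[_ h2 _ _] _] := FP _ FX.
      by exists X => //; exact: h2.
    - by have [[_ _ h3 _] _] := FP _ FX; exists X => //; exact: h3.
    - by have [[_ _ _ h4] _] := FP _ FX; exact: h4 Xx.
  case: (pselect (exists2 X, F X & G1 `<=` X)) => [[X FX GX]|nex].
    by right=> p /GX Xp; exists X.
  left; rewrite -subset0 => p [X FX Xp].
  have [_ [e|h]] := FP _ FX; first by rewrite e in Xp.
  by case: nex; exists X.
have GA : G1 `<=` A.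
  case: hA1 => // A0; case: (Amax G1).
    by rewrite A0; split=> // h; exact: (h _ G1e).
  by split=> //; right.
have AO y : vge v 0 y -> A (y, 1) by move=> hy; apply: GA; apply: G01.
have tot x : exists c, A (x, c).
  apply: contrapT => nex; have [|c Ac|G' [z' [hG' AG' G'x _]]] := @pchar_extend A x hA.
  - exact: AO.
  - by apply: nex; exists c.
  case: (Amax G').
    by split=> // h; apply: nex; exists z'; exact: h.
  by split=> //; right=> p /GA /AG'.
have [psi hpsi] := choice tot; have [h1 h2 _ _] := hA.
exists psi; split=> [x y|x hx|].
- exact: h1 (hpsi _) (h2 _ _ _ _ (hpsi x) (hpsi y)).
- exact: h1 (hpsi _) (AO _ hx).
- exists pi^-1; first by rewrite vgeE ?invr_eq0 ?lf_pi0 // vV ?lf_pi0 // lf_vpi.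
  by rewrite (h1 _ _ _ (hpsi pi^-1) (GA _ G1e)); apply: z1 => y c [].
Qed.

End Character.

(** * Fourier transform *)

Section Fourier.
Variables (C : numClosedFieldType) (K : lfield).
Local Notation v := (@lfv K).
Local Notation q := (lfq K).
Local Notation M2 := 'M[lfF K]_2.
Local Notation fn := (M2 -> C).
Local Notation qp := (@qp C K).
Local Notation SW := (@SW C K).
Local Notation weil g1 g2 f := (@weil_act C K v q 2 2 g1 g2 f).
Implicit Types (a b N : int) (M X Y g h : M2) (f : fn).

Definition pairing Y M : K := \tr (Y^T *m M).

Lemma pairingDr Y M X : pairing Y (M + X) = pairing Y M + pairing Y X.
Proof. by rewrite /pairing mulmxDr mxtraceD. Qed.

Lemma pairingDl Y X M : pairing (Y + X) M = pairing Y M + pairing X M.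
Proof. by rewrite /pairing linearD /= mulmxDl mxtraceD. Qed.

Lemma pairing_mul Y g M h : pairing Y (g *m M *m h) = pairing (g^T *m Y *m h^T) M.
Proof.
rewrite /pairing !trmx_mul !trmxK -mulmxA mxtrace_mulC.
by rewrite [in RHS]mxtrace_mulC !mulmxA -[RHS]mxtrace_mulC !mulmxA.
Qed.

Lemma pairing_vge a b Y M : mge a Y -> mge b M -> vge v (a + b) (pairing Y M).
Proof.
move=> hY hM; have /mgeP h : mge (a + b) (Y^T *m M).
  by apply: (@mgeM _ _ a b) => //; rewrite mge_tr.
by apply: vge_sum => i; exact: h.
Qed.

Variable psi : K -> C.
Hypothesis psiD : forall x y, psi (x + y) = psi x * psi y.
Hypothesis psiO : forall x, vge v 0 x -> psi x = 1.
Hypothesis psi_nt : exists2 e, vge v (-1) e & psi e != 1.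

Definition twist Y f : fn := fun M => f M * psi (pairing Y M).
Definition FT f : fn := fun Y => Int (twist Y f).

Lemma SW_twist Y f : SW f -> SW (twist Y f).
Proof.
move=> /schwartzP[a [b [h1 h2]]]; have [c hc] := mge_ex Y.
apply/schwartzP; exists a, (Num.max b (- c)); split=> [M hM|M X hX].
  by rewrite /twist h1 // mul0r.
rewrite /twist pairingDr psiD (psiO (x := pairing Y X)) ?mulr1 ?h2 //.
  by apply: mge_le hX; lia.
by apply: vge_le (pairing_vge hc hX); lia.
Qed.

Lemma FT_lin c f1 f2 : SW f1 -> SW f2 -> FT (sch_lin c f1 f2) = sch_lin c (FT f1) (FT f2).
Proof.
move=> h1 h2; apply/funext => Y; rewrite /FT /sch_lin -Int_lin; try exact: SW_twist.
by congr Int; apply/funext => M; rewrite /twist /sch_lin mulrDl mulrA.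
Qed.

(** A multiple of the elementary matrix at an entry where Y is too large pairs with Y to exactly
    [e]. *)
Lemma twist_nontriv N Y : ~~ mge (- N) Y -> exists2 X, mge N X & psi (pairing Y X) != 1.
Proof.
move=> /forallPn[i /forallPn[j hij]].
have Y0 : Y i j != 0 by apply: contraNneq hij => ->; exact: vge0.
have [e he pe] := psi_nt.
exists ((e / Y i j) *: delta_mx i j).
  apply/mgeP => i' j'; rewrite !mxE; case: andP => _; rewrite ?mulr0 ?vge0 //.
  rewrite mulr1 mulrC vge_mull ?invr_eq0 // vV // opprK.
  by apply: vge_le he; move: hij; rewrite vgeE // -ltNge; lia.
rewrite (_ : pairing _ _ = e) // /pairing -scalemxAr mxtraceZ.
rewrite /mxtrace (bigD1 j) //= big1 ?addr0 => [|k kj]; last first.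
  by rewrite mxE big1 // => l _; rewrite !mxE (negPf kj) andbF mulr0.
rewrite mxE (bigD1 i) //= big1 ?addr0 => [|k ki]; last first.
  by rewrite !mxE (negPf ki) mulr0.
by rewrite !mxE !eqxx mulr1 divfK.
Qed.

(** Translation by a suitable X multiplies the integral by a value of [psi] other than 1. *)
Lemma Int_twist0 N Y f : SW f -> (forall M X, mge N X -> f (M + X) = f M) ->
  ~~ mge (- N) Y -> FT f Y = 0.
Proof.
move=> hf hinv /twist_nontriv[X hX hp].
have := Int_transl X (SW_twist Y hf).
rewrite (_ : (fun M => _) = sch_lin (psi (pairing Y X)) (twist Y f) fn0); last first.
  by apply/funext => M; rewrite /twist /sch_lin /fn0 pairingDr psiD hinv //; ring.
rewrite Int_lin ?Int_0 ?addr0; [|exact: SW_twist|exact: SW_0].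
move/eqP; rewrite -subr_eq0 -[X in _ - X]mul1r -mulrBl mulf_eq0 subr_eq0 (negPf hp) /=.
by move/eqP.
Qed.

Lemma FT_SW f : SW f -> SW (FT f).
Proof.
move=> hf; have /schwartzP[a [b [h1 h2]]] := hf.
apply/schwartzP; exists (- b), (- a); split=> [Y hY|Y X hX].
  exact: Int_twist0 h2 hY.
rewrite /FT; congr Int; apply/funext => M; rewrite /twist.
case: (boolP (mge a M)) => hM; last by rewrite h1 // !mul0r.
rewrite pairingDl psiD (psiO (x := pairing X M)) ?mulr1 //.
by apply: vge_le (pairing_vge hX hM); lia.
Qed.

(** The Jacobian $|\det g_1|^2 |\det g_2|^{-2}$ turns the normalizing factor of the Weil
    representation into its inverse, which is the factor attached to the inverse transposes. *)
Lemma FT_weil g1 g2 f : GL g1 -> GL g2 -> SW f ->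
  FT (weil g1 g2 f) = weil (invmx g1)^T (invmx g2)^T (FT f).
Proof.
move=> G1 G2 hf; apply/funext => Y; rewrite weilE.
have vdi g : GL g -> vd (invmx g)^T = - vd g by move=> hg; rewrite -vdetV // /vd dt_tr.
rewrite !vdi // -invmxT invmxK.
pose Y' := g1^T *m Y *m (invmx g2)^T.
pose F0 := twist Y' f; have hF0 : SW F0 by exact: SW_twist.
have -> : FT (weil g1 g2 f) Y =
   Int (sch_lin (qp (vd g1 - vd g2)) (fun M => F0 (invmx g1 *m (M *m g2))) fn0).
  congr Int; apply/funext => M; rewrite /sch_lin /fn0 addr0 /twist weilE -mulrA mulmxA.
  congr (_ * (_ * psi _)).
  rewrite /Y' -pairing_mul; congr pairing.
  by rewrite !mulmxA mulmxV // mul1mx mulmxK.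
have hF1 := SW_mull (GLV G1) hF0.
rewrite Int_lin ?Int_0 ?addr0; [|exact: (SW_mulr G2 hF1)|exact: SW_0].
rewrite (Int_mulr G2 hF1) (Int_mull (GLV G1) hF0) !mulrA -!qpD vdetV //.
by congr (qp _ * Int (twist _ _)); lia.
Qed.

(** A ball around X is, up to a constant, the transform of a ball around 0 twisted by $-X$, so no
    inversion formula is involved. *)
Lemma FT_surj f : SW f -> exists2 f', SW f' & FT f' = f.
Proof.
move=> /schwartzP[a [b h]]; have [j hj] := sch_norm h.
apply: (sch_ind (P := fun f => exists2 f', SW f' & FT f' = f) _ _ hj).
- exists fn0; first exact: SW_0.
  apply/funext => Y; rewrite /FT (_ : twist Y _ = fn0) ?Int_0 //.
  by apply/funext => M; rewrite /twist /fn0 mul0r.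
- move=> c f1 f2 _ _ [f1' h1 <-] [f2' h2 <-]; exists (sch_lin c f1' f2'); first exact: SW_lin.
  exact: FT_lin.
move=> X _ _; set N := a + _.
have hb := SW_box C (0 : M2) (- N).
have ht := SW_twist (- X) hb.
exists (sch_lin (qp (4 * - N)) (twist (- X) (box 0 (- N))) fn0); first exact: SW_lin (SW_0 _ _).
rewrite FT_lin //; last exact: SW_0.
apply/funext => Y; rewrite /sch_lin.
have -> : FT fn0 Y = 0.
  rewrite /FT (_ : twist Y _ = fn0) ?Int_0 //.
  by apply/funext => M; rewrite /twist /fn0 mul0r.
have -> : FT (twist (- X) (box 0 (- N))) Y = FT (box 0 (- N)) (Y - X).
  by congr Int; apply/funext => M; rewrite /twist pairingDl psiD; ring.
rewrite addr0 /box; case: (boolP (mge N (Y - X))) => hYX; last first.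
  rewrite (@Int_twist0 (- N)) ?mulr0 ?opprK // => M Z hZ.
  exact: (box_inv C 0 M hZ).
have -> : FT (box 0 (- N)) (Y - X) = @Int C K (box 0 (- N)).
  congr Int; apply/funext => M; rewrite /twist /box.
  case: (boolP (mge _ _)) => hM; rewrite ?mul0r //.
  rewrite subr0 in hM.
  by rewrite psiO ?mulr1 //; apply: vge_le (pairing_vge hYX hM); lia.
by rewrite Int_box0 -qpD subrr qp0.
Qed.

End Fourier.

(** * Smooth representations and their duals *)

(** A matrix of maximal rank with rows in S. It makes rank arguments available for subspaces given
    as predicates. *)
Lemma rowspanP (C : fieldType) (r : nat) (S : 'rV[C]_r -> Prop) : subspace S ->
  exists A : 'M[C]_r, forall c, S c <-> (c <= A)%MS.
Proof.
move=> [S0 SD SZ].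
pose P (k : nat) := `[<exists A : 'M[C]_r, (forall i, S (row i A)) /\ \rank A = k>].
have Pex : exists k, P k.
  by exists 0%N; apply/asboolP; exists 0; split=> [i|]; rewrite ?row0 ?mxrank0.
have Pub k : P k -> (k <= r)%N by move=> /asboolP[A [_ <-]]; exact: rank_leq_row.
have [k /asboolP[A [hA rk]] kmax] := ex_maxnP Pex Pub.
have Sl (m : nat) (B : 'M[C]_(m, r)) (c : 'rV_r) : (forall i, S (row i B)) -> (c <= B)%MS -> S c.
  move=> hB /submxP[D ->]; rewrite mulmx_sum_row.
  by elim/big_ind: _ => // i _; exact: SZ.
exists A => c; split=> [Sc|]; last exact: Sl.
apply/negPn/negP => cA.
have : (\rank (A + c)%MS <= k)%N.
  apply: kmax; apply/asboolP; exists (A + c)%MS; split=> // i.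
  have /sub_addsmxP[[u1 u2] /= ->] : (row i (A + c)%MS <= A + c)%MS by exact: row_sub.
  apply: SD; first by apply: (Sl _ A) => //; exact: submxMl.
  apply: (Sl _ c); last exact: submxMl.
  by move=> i0; rewrite (_ : row i0 c = c) //; apply/rowP => j; rewrite mxE (ord1 i0).
rewrite -rk leqNgt => /negP; apply.
have := mxrank_leqif_sup (addsmxSl A c); case=> h1 h2.
rewrite ltn_neqAle h1 andbT h2; apply: contra cA => h.
exact: submx_trans (addsmxSr A c) h.
Qed.

(** Some column of the cokernel matrix of A does not kill c. *)
Lemma separating_col (C : fieldType) (r : nat) (A : 'M[C]_r) (c : 'rV[C]_r) :
  ~~ (c <= A)%MS -> exists e : 'cV[C]_r,
    (forall d : 'rV_r, (d <= A)%MS -> d *m e = 0) /\ (c *m e) 0 0 != 0.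
Proof.
rewrite submxE => h.
have [j hj] : exists j, (c *m cokermx A) 0 j != 0.
  apply/existsP; apply: contraR h; rewrite negb_exists => /forallP h.
  by apply/eqP/rowP => j; rewrite [RHS]mxE; apply/eqP/negPn.
have cm (d : 'rV_r) : d *m col j (cokermx A) = col j (d *m cokermx A).
  by rewrite !colE mulmxA.
exists (col j (cokermx A)); split=> [d|]; last by rewrite cm mxE.
by rewrite submxE => /eqP hd; rewrite cm hd col0.
Qed.

Section SmoothRep.
Variables (C : numClosedFieldType) (K : lfield).
Local Notation v := (@lfv K).
Local Notation M2 := 'M[lfF K]_2.
Variables (E : lmodType C) (rho : M2 -> E -> E).
Hypothesis rhoR : is_rep rho.
Hypothesis rhoS : smooth_rep v rho.
Implicit Types (g h k : M2) (x y : E) (N n : int).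

Lemma rhoL g a x y : GL g -> rho g (a *: x + y) = a *: rho g x + rho g y.
Proof. by case: rhoR => h _ _ /h. Qed.

Lemma rho1 x : rho 1%:M x = x.
Proof. by case: rhoR => _ h _; exact: h. Qed.

Lemma rhoM g h x : GL g -> GL h -> rho (g *m h) x = rho g (rho h x).
Proof. by case: rhoR => _ _ H; exact: H. Qed.

Lemma rhoD g x y : GL g -> rho g (x + y) = rho g x + rho g y.
Proof. by move=> hg; rewrite -[x]scale1r rhoL // !scale1r. Qed.

Lemma rho0 g : GL g -> rho g 0 = 0.
Proof. by move=> hg; apply: (addrI (rho g 0)); rewrite -rhoD // !addr0. Qed.

Lemma rhoZ g a x : GL g -> rho g (a *: x) = a *: rho g x.
Proof. by move=> hg; rewrite -[a *: x]addr0 rhoL // rho0 // addr0. Qed.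

Lemma rhoN g x : GL g -> rho g (- x) = - rho g x.
Proof. by move=> hg; rewrite -scaleN1r rhoZ // scaleN1r. Qed.

Lemma rhoB g x y : GL g -> rho g (x - y) = rho g x - rho g y.
Proof. by move=> hg; rewrite rhoD // rhoN. Qed.

Lemma rho_sum g (I : Type) (s : seq I) (F : I -> E) : GL g ->
  rho g (\sum_(i <- s) F i) = \sum_(i <- s) rho g (F i).
Proof.
by move=> hg; elim: s => [|i s IH]; rewrite ?big_nil ?rho0 // !big_cons rhoD // IH.
Qed.

Lemma rhoK g x : GL g -> rho (invmx g) (rho g x) = x.
Proof. by move=> hg; rewrite -rhoM ?mulVmx ?rho1 //; exact: GLV. Qed.

Lemma rhoVK g x : GL g -> rho g (rho (invmx g) x) = x.
Proof. by move=> hg; rewrite -rhoM ?mulmxV ?rho1 //; exact: GLV. Qed.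

Definition fixed N x : Prop := forall k, congr_sub v N k -> rho k x = x.

Lemma fixed_le N n x : N <= n -> fixed N x -> fixed n x.
Proof. by move=> h hx k hk; apply: hx; exact: congr_le hk. Qed.

Lemma fixed0 N : fixed N 0.
Proof. by move=> k [hk _]; rewrite rho0. Qed.

Lemma fixed_lin N a x y : fixed N x -> fixed N y -> fixed N (a *: x + y).
Proof. by move=> hx hy k hk; rewrite rhoL ?hx ?hy //; case: hk. Qed.

Lemma fixedD N x y : fixed N x -> fixed N y -> fixed N (x + y).
Proof. by move=> hx hy; rewrite -[x]scale1r; exact: fixed_lin. Qed.

Lemma fixedZ N a x : fixed N x -> fixed N (a *: x).
Proof. by move=> hx; rewrite -[a *: x]addr0; apply: fixed_lin => //; exact: fixed0. Qed.

Lemma fixed_sum N (I : Type) (s : seq I) (F : I -> E) : (forall i, fixed N (F i)) ->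
  fixed N (\sum_(i <- s) F i).
Proof.
by move=> h; elim: s => [|i s IH]; rewrite ?big_nil ?big_cons; [exact: fixed0|exact: fixedD].
Qed.

Lemma fixed_Kz N g x : 0 < N -> Kz g -> fixed N x -> fixed N (rho g x).
Proof.
move=> N0 hg hx k hk; have hgu : GL g by case: hg.
have hku : GL k by case: hk.
have hc := congr_conj N0 hg hk; have hcu : GL (invmx g *m k *m g) by case: hc.
rewrite -{2}(hx _ hc) -!rhoM // ?GLM //.
by rewrite !mulmxA mulmxV // mul1mx.
Qed.

Lemma fixed_ex x n : exists j : nat, 0 < n + j%:Z /\ fixed (n + j%:Z) x.
Proof.
have [N [N0 hN]] := rhoS x; exists `|N - n|%N.
by split; [lia|apply: fixed_le hN; lia].
Qed.

Lemma fixed_eq N g h x : 0 < N -> Kz g -> mge N (h - g) -> fixed N x -> rho h x = rho g x.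
Proof.
move=> N0 hg hgh hx; have [hc _] := congr_quot N0 hg hgh.
have gu : GL g by case: hg.
rewrite -{2}(hx _ hc) -rhoM //; last by case: hc.
by rewrite mulKVmx.
Qed.

(** For $n > 0$ and x fixed at level $n + j$ this is the mean over $K_n/K_{n+j}$, with $K_n = 1 +
    p^n M_2(O)$. *)
Definition avgj n (j : nat) x : E :=
  (#|mI K j|%:R)^-1 *: \sum_(u : mI K j) rho (1%:M + mrep n u) x.

Lemma card_mI_neq0 j : (#|mI K j|%:R : C) != 0.
Proof. by rewrite pnatr_eq0 card_mI -lt0n !expn_gt0 (ltnW (q_gt1 K)). Qed.

Lemma Kz_1D n X : 0 < n -> mge n X -> congr_sub v n (1%:M + X).
Proof. by move=> n0 hX; apply/congrP => //; rewrite addrAC subrr add0r. Qed.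

Lemma avgj_lin n j a x y : 0 < n -> avgj n j (a *: x + y) = a *: avgj n j x + avgj n j y.
Proof.
move=> n0; rewrite /avgj scalerA mulrC -scalerA -scalerDr; congr (_ *: _).
rewrite scaler_sumr -big_split /=; apply: eq_bigr => u _.
by rewrite rhoL //; case: (Kz_1D n0 (mrep_in n u)).
Qed.

Lemma avgj_resp n (j : nat) x : 0 < n -> fixed (n + j%:Z) x ->
  forall X Y, mge n X -> mge n Y -> mge (n + j%:Z) (X - Y) ->
  rho (1%:M + X) x = rho (1%:M + Y) x.
Proof.
move=> n0 hx X Y hX hY hXY; apply: (fixed_eq (N := n + j%:Z)) => //; first lia.
  exact: (congr_Kz n0 (Kz_1D n0 hY)).
by rewrite opprD addrACA subrr add0r.
Qed.

Lemma avgj_fixed n (j : nat) x : 0 < n -> fixed (n + j%:Z) x -> fixed n (avgj n j x).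
Proof.
move=> n0 hx k hk; have ku : GL k by case: hk.
have k1 : mge n (k - 1%:M) by exact/(congrP k n0).
rewrite /avgj rhoZ // rho_sum //; congr (_ *: _).
rewrite -(sum_repsys (repsys_addr k1 (repsys_mulKz (congr_Kz n0 hk) (repsys_mrep K n j)))
  (repsys_mrep K n j) (avgj_resp n0 hx)).
apply: eq_bigr => u _; rewrite -rhoM //; last by case: (Kz_1D n0 (mrep_in n u)).
by congr rho; rewrite mulmxDr mulmx1 addrCA [1%:M + (k - _)]addrC subrK addrC.
Qed.

Lemma avgj_act n (j : nat) x k : 0 < n -> fixed (n + j%:Z) x -> congr_sub v n k ->
  avgj n j (rho k x) = avgj n j x.
Proof.
move=> n0 hx hk; have ku : GL k by case: hk.
have k1 : mge n (k - 1%:M) by exact/(congrP k n0).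
rewrite /avgj; congr (_ *: _).
rewrite -(sum_repsys (repsys_addr k1 (repsys_mulrKz (congr_Kz n0 hk) (repsys_mrep K n j)))
  (repsys_mrep K n j) (avgj_resp n0 hx)).
apply: eq_bigr => u _; rewrite -rhoM //; last by case: (Kz_1D n0 (mrep_in n u)).
by congr rho; rewrite mulmxDl mul1mx addrCA [1%:M + (k - _)]addrC subrK addrC.
Qed.

Lemma avgj_id n (j : nat) x : 0 < n -> fixed n x -> avgj n j x = x.
Proof.
move=> n0 hx; rewrite /avgj (eq_bigr (fun=> x)) => [|u _]; last first.
  by apply: hx; exact: (Kz_1D n0 (mrep_in n u)).
by rewrite sumr_const -scaler_nat scalerA mulVf ?scale1r // card_mI_neq0.
Qed.

Lemma avgj_stable (W : E -> Prop) n j x : 0 < n -> subspace W ->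
  (forall g x, GL g -> W x -> W (rho g x)) -> W x -> W (avgj n j x).
Proof.
move=> n0 [W0 WD WZ] Wst Wx; apply: WZ; elim/big_ind: _ => // u _.
by apply: Wst => //; case: (Kz_1D n0 (mrep_in n u)).
Qed.

(** The second average applied to the first leaves it unchanged, since it is already fixed; computed
    term by term it gives the second average of x, which absorbs $K_n$. *)
Lemma avgj_indep n (j j' : nat) x : 0 < n -> fixed (n + j%:Z) x -> fixed (n + j'%:Z) x ->
  avgj n j x = avgj n j' x.
Proof.
move=> n0 hj hj'.
rewrite -(avgj_id j' n0 (avgj_fixed n0 hj)) {2}/avgj.
have avZ a y : avgj n j' (a *: y) = a *: avgj n j' y.
  rewrite -[a *: y]addr0 avgj_lin // [avgj n j' 0]avgj_id ?addr0 //; exact: fixed0.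
have avS (s : seq (mI K j)) : avgj n j' (\sum_(u <- s) rho (1%:M + mrep n u) x)
    = \sum_(u <- s) avgj n j' x.
  elim: s => [|u s IH]; first by rewrite !big_nil avgj_id //; exact: fixed0.
  rewrite !big_cons -[rho _ _]scale1r avgj_lin // scale1r IH avgj_act //.
  exact: (Kz_1D n0 (mrep_in n u)).
rewrite avZ avS sumr_const -scaler_nat scalerA mulVf ?scale1r //.
exact: card_mI_neq0.
Qed.

(** The projector onto the $K_n$-fixed vectors, at an arbitrarily chosen level that fixes x. *)
Definition Avg n x : E := avgj n (sval (cid (fixed_ex x n))) x.

Lemma AvgE n (j : nat) x : 0 < n -> fixed (n + j%:Z) x -> Avg n x = avgj n j x.
Proof.
by move=> n0 hx; apply: avgj_indep => //; case: (svalP (cid (fixed_ex x n))).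
Qed.

Lemma Avg_common n (s : seq E) : exists j : nat, forall x, x \in s -> fixed (n + j%:Z) x.
Proof.
elim: s => [|x s [j hj]]; first by exists 0%N.
have [i [_ hi]] := fixed_ex x n; exists (i + j)%N => y.
rewrite inE => /orP[/eqP ->|/hj]; first by apply: fixed_le hi; lia.
by apply: fixed_le; lia.
Qed.

Lemma Avg_lin n a x y : 0 < n -> Avg n (a *: x + y) = a *: Avg n x + Avg n y.
Proof.
move=> n0; have [j hj] := Avg_common n [:: x; y].
have hx : fixed (n + j%:Z) x by apply: hj; rewrite !inE eqxx.
have hy : fixed (n + j%:Z) y by apply: hj; rewrite !inE eqxx orbT.
rewrite (AvgE n0 hx) (AvgE n0 hy) (AvgE n0 (fixed_lin _ hx hy)).
exact: avgj_lin.
Qed.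

Lemma Avg_fixed n x : 0 < n -> fixed n (Avg n x).
Proof. by move=> n0; apply: avgj_fixed => //; case: (svalP (cid (fixed_ex x n))). Qed.

Lemma Avg_id n x : 0 < n -> fixed n x -> Avg n x = x.
Proof. by move=> n0 hx; apply: avgj_id. Qed.

Lemma Avg_act n k x : 0 < n -> congr_sub v n k -> Avg n (rho k x) = Avg n x.
Proof.
move=> n0 hk; have [j hj] := Avg_common n [:: x; rho k x].
have hx : fixed (n + j%:Z) x by apply: hj; rewrite !inE eqxx.
have hy : fixed (n + j%:Z) (rho k x) by apply: hj; rewrite !inE eqxx orbT.
by rewrite (AvgE n0 hx) (AvgE n0 hy) avgj_act.
Qed.

Lemma Avg_stable (W : E -> Prop) n x : 0 < n -> subspace W ->
  (forall g x, GL g -> W x -> W (rho g x)) -> W x -> W (Avg n x).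
Proof. exact: avgj_stable. Qed.

Lemma Avg_inv (A : lmodType C) (B : E -> A) n x : 0 < n ->
  (forall a x y, B (a *: x + y) = a *: B x + B y) ->
  (forall k x, congr_sub v n k -> B (rho k x) = B x) -> B (Avg n x) = B x.
Proof.
move=> n0 Bl Bi; have B0 : B 0 = 0.
  by have := Bl (-1) 0 0; rewrite scaler0 add0r scaleN1r addNr.
have BZ a y : B (a *: y) = a *: B y by rewrite -[a *: y]addr0 Bl B0 addr0.
rewrite /Avg /avgj BZ; set j := sval _.
have -> : B (\sum_(u : mI K j) rho (1%:M + mrep n u) x) = \sum_(u : mI K j) B x.
  apply: (big_ind2 (fun y z => B y = z)) => //.
    by move=> x1 x2 y1 y2 <- <-; rewrite -[x1]scale1r Bl !scale1r.
  by move=> u _; apply: Bi; exact: (Kz_1D n0 (mrep_in n u)).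
by rewrite sumr_const -scaler_nat scalerA mulVf ?scale1r // card_mI_neq0.
Qed.

End SmoothRep.

Section Conj.
Variable K : lfield.
Local Notation v := (@lfv K).

Lemma congr_conj_ex (g : 'M[lfF K]_2) (N : int) : GL g -> exists M : int,
  0 < M /\ forall k, congr_sub v M k -> congr_sub v N (invmx g *m k *m g).
Proof.
move=> hg; have [a ha] := mge_ex g; have [b hb] := mge_ex (invmx g).
exists (Num.max 1 (Num.max 1 N - a - b)); split=> [|k hk]; first lia.
apply: (@congr_le _ (Num.max 1 N)); first lia.
have hM : mge (Num.max 1 (Num.max 1 N - a - b)) (k - 1%:M) by apply/congrP; [lia|].
apply/congrP; first lia.
rewrite (_ : _ - _ = invmx g *m (k - 1%:M) *m g); last first.
  by rewrite mulmxBr mulmx1 mulmxBl mulVmx.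
apply: mgeM ha; [|apply: mgeM hb hM; exact: lexx]; lia.
Qed.
End Conj.

(** * The smooth dual as a vector space and as a representation *)

Section Dual.
Variables (C : numClosedFieldType) (K : lfield).
Local Notation v := (@lfv K).
Local Notation M2 := 'M[lfF K]_2.
Variables (V : lmodType C) (act : M2 -> V -> V).

Definition sdual_pred : {pred (V -> C^o)} := fun l => `[<smooth_dual v act l>].

Lemma sdual_closed : GRing.submod_closed sdual_pred.
Proof.
split=> [|a l l' /asboolP[h1 [N [N0 h2]]] /asboolP[h1' [N' [N0' h2']]]]; apply/asboolP.
  split=> [a x y|].
    by change (0 = a * 0 + 0 :> C); rewrite mulr0 addr0.
  by exists 1.
split=> [b x y|].
  change (a * l (b *: x + y) + l' (b *: x + y) = b * (a * l x + l' x) + (a * l y + l' y)).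
  by rewrite h1 h1'; ring.
exists (Num.max N N'); split=> [|k x hk]; first lia.
change (a * l (act k x) + l' (act k x) = a * l x + l' x).
by rewrite h2 ?h2' //; apply: congr_le hk; lia.
Qed.

HB.instance Definition _ := GRing.isSubmodClosed.Build C (V -> C^o) sdual_pred sdual_closed.

Record sdual := SDual { sdual_val : V -> C^o; _ : sdual_val \in sdual_pred }.
HB.instance Definition _ := [isSub for sdual_val].
HB.instance Definition _ := [Choice of sdual by <:].
HB.instance Definition _ := [SubChoice_isSubLmodule of sdual by <:].

End Dual.

Section DualRep.
Variables (C : numClosedFieldType) (K : lfield).
Local Notation v := (@lfv K).
Local Notation M2 := 'M[lfF K]_2.
Variables (V : lmodType C) (act : M2 -> V -> V).
Local Notation E := (sdual act).
Implicit Types (g h k : M2) (x y : V) (l : E) (N n : int).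

Definition ev l x : C := sdual_val l x.

Lemma ev_smooth l : smooth_dual v act (ev l).
Proof. by case: l => f h; exact: (elimT (asboolP _) h). Qed.

Definition mk_sdual (f : V -> C) (h : smooth_dual v act f) : E :=
  @SDual _ _ _ act (f : V -> C^o) (introT (asboolP _) h).

Lemma evD l l' x : ev (l + l') x = ev l x + ev l' x. Proof. by []. Qed.
Lemma evZ a l x : ev (a *: l) x = a * ev l x. Proof. by []. Qed.
Lemma ev0 x : ev 0 x = 0. Proof. by []. Qed.
Lemma ev_lin l a x y : ev l (a *: x + y) = a * ev l x + ev l y.
Proof. by case: (ev_smooth l). Qed.
Lemma evr0 l : ev l 0 = 0.
Proof. by have := ev_lin l (-1) 0 0; rewrite scaler0 addr0 mulN1r addNr. Qed.
Lemma evrZ l a x : ev l (a *: x) = a * ev l x.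
Proof. by rewrite -[a *: x]addr0 ev_lin evr0 addr0. Qed.
Lemma evrD l x y : ev l (x + y) = ev l x + ev l y.
Proof. by rewrite -[x]scale1r ev_lin mul1r scale1r. Qed.
Lemma evr_sum l (I : Type) (s : seq I) (F : I -> V) :
  ev l (\sum_(i <- s) F i) = \sum_(i <- s) ev l (F i).
Proof. by elim: s => [|i s IH]; rewrite ?big_nil ?evr0 // !big_cons evrD IH. Qed.
Lemma ev_suml x (I : Type) (s : seq I) (F : I -> E) :
  ev (\sum_(i <- s) F i) x = \sum_(i <- s) ev (F i) x.
Proof. by elim: s => [|i s IH]; rewrite ?big_nil ?ev0 // !big_cons evD IH. Qed.

Lemma ev_inj l l' : (forall x, ev l x = ev l' x) -> l = l'.
Proof. by move=> h; apply: val_inj; apply/funext => x; exact: h. Qed.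

Hypothesis actR : is_rep act.
Hypothesis actS : smooth_rep v act.

Lemma dual_act_smooth g l : GL g -> smooth_dual v act (dual_act act g (ev l)).
Proof.
move=> hg; have [h1 [N [N0 h2]]] := ev_smooth l; split=> [a x y|].
  by rewrite /dual_act (rhoL actR) ?h1 //; exact: GLV.
have [M [M0 hM]] := congr_conj_ex N hg.
have hgV := GLV hg.
exists M; split=> // k x hk; rewrite /dual_act; have ku : GL k by case: hk.
have hcu : GL (invmx g *m k *m g) by apply: GLM => //; exact: GLM.
by rewrite -(h2 _ (act (invmx g) x) (hM _ hk)) -!(rhoM actR) // mulmxK.
Qed.

(** Singular matrices get the identity as a default value, since [dual_act] is known to preserve
    smoothness only on $GL_2$. *)
Definition drho g l : E :=
  if pselect (GL g) is left h then mk_sdual (dual_act_smooth l h) else l.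

Lemma drhoE g l x : GL g -> ev (drho g l) x = ev l (act (invmx g) x).
Proof. by move=> hg; rewrite /drho; case: pselect. Qed.

Lemma drho_val g l : GL g -> ev (drho g l) = dual_act act g (ev l).
Proof. by move=> hg; apply/funext => x; rewrite drhoE. Qed.

Lemma drho_pair g l x : GL g -> ev (drho g l) (act g x) = ev l x.
Proof. by move=> hg; rewrite drhoE // (rhoK actR). Qed.

Lemma drhoR : is_rep drho.
Proof.
split=> [g hg a l l'|l|g h l hg hh]; apply: ev_inj => x.
- by rewrite drhoE // !evD !evZ !drhoE.
- by rewrite drhoE ?(rho1 actR) ?(invmx_uniq (mul1mx 1%:M)) ?(rho1 actR) //; exact: GL1.
- have hgh := GLM hg hh; have hg' := GLV hg; have hh' := GLV hh.
  by rewrite !drhoE // invmxM // (rhoM actR).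
Qed.

Lemma drhoS : smooth_rep v drho.
Proof.
move=> l; have [_ [N [N0 h2]]] := ev_smooth l; exists N; split=> // k hk.
apply: ev_inj => x; have hk' := congrV N0 hk.
by rewrite drhoE ?h2 //; case: hk.
Qed.

Lemma fixed_dual N l : 0 < N -> fixed drho N l <-> forall k x, congr_sub v N k -> ev l (act k x) = ev l x.
Proof.
move=> N0; split=> [h k x hk|h k hk].
  by rewrite -{1}(h k hk) drho_pair //; case: hk.
apply: ev_inj => x; rewrite drhoE; last by case: hk.
by rewrite h //; exact: congrV.
Qed.

Lemma ev_Avg N l x : 0 < N -> fixed drho N l -> ev l (Avg actS N x) = ev l x.
Proof.
move=> N0 hl; apply: (@Avg_inv C K V act actS C^o (ev l)) => //.
  by move=> a y z; exact: ev_lin.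
by move=> k y hk; exact: (fixed_dual l N0).1.
Qed.

Lemma ev_dAvg N l x : 0 < N -> fixed act N x -> ev (Avg drhoS N l) x = ev l x.
Proof.
move=> N0 hx; apply: (@Avg_inv C K E drho drhoS C^o (fun l => ev l x)) => //.
move=> k l' hk; rewrite drhoE; last by case: hk.
by rewrite hx //; exact: congrV.
Qed.

Hypothesis actA : admissible_rep v act.

(** Admissibility gives spanning vectors that need not be fixed themselves; averaging them repairs
    this and changes no fixed combination. *)
Lemma fixed_span N : 0 < N -> exists r (t : 'I_r -> V), (forall i, fixed act N (t i)) /\
  forall x, fixed act N x -> exists c : 'rV[C]_r, x = \sum_i c 0 i *: t i.
Proof.
move=> N0; have [s hs] := actA N0.
exists (size s), (fun i => Avg actS N s`_i); split=> [i|x hx]; first exact: Avg_fixed.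
have [c hc] := hs x hx; exists (\row_i c i).
rewrite -[LHS](Avg_id actS N0 hx) {1}hc.
have A0 : Avg actS N 0 = 0 by rewrite (Avg_id actS) //; exact: fixed0.
elim: (index_enum _) => [|i s' IH]; first by rewrite !big_nil.
by rewrite !big_cons (Avg_lin actR) // IH mxE.
Qed.

Hypothesis actI : irreducible_rep act.

(** A functional on the finite-dimensional space of fixed vectors, nonzero at x, is composed with
    the projector [Avg]. *)
Lemma dual_neq0 : exists l : E, l != 0.
Proof.
have [[x x0] _] := actI; have [N [N0 hx]] := actS x.
have [r [t [ht span]]] := fixed_span N0.
(* The generators may be dependent: a column vanishing on the relations S, but not on the
   coordinates of x, defines a functional. *)
pose S (c : 'rV[C]_r) := \sum_i c 0 i *: t i = 0.
have comb a (c d : 'rV[C]_r) : \sum_i (a *: c + d) 0 i *: t i =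
    a *: (\sum_i c 0 i *: t i) + \sum_i d 0 i *: t i.
  rewrite scaler_sumr -big_split; apply: eq_bigr => i _.
  by rewrite !mxE scalerDl scalerA.
have S0 : S 0 by rewrite /S big1 // => i _; rewrite mxE scale0r.
have [A hA] : exists A : 'M[C]_r, forall c, S c <-> (c <= A)%MS.
  apply: rowspanP; split=> // [c d hc hd|a c hc].
    by rewrite /S -[c]scale1r comb hc hd scaler0 addr0.
  by rewrite /S -[a *: c]addr0 comb hc (S0 : _ = _) scaler0 addr0.
have [cx ex] := span x hx.
have [|e [e0 ex0]] := @separating_col C r A cx.
  by apply: contraNN x0 => /hA; rewrite /S -ex => ->.
have /choice[cc hcc] y : exists c : 'rV[C]_r, Avg actS N y = \sum_i c 0 i *: t i.
  by apply: span; exact: Avg_fixed.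
pose f y : C := (cc y *m e) 0 0.
have wd y (c : 'rV[C]_r) : Avg actS N y = \sum_i c 0 i *: t i -> f y = (c *m e) 0 0.
  move=> h; apply/eqP; rewrite -subr_eq0; apply/eqP.
  have : S (- 1 *: c + cc y) by rewrite /S comb -h -hcc scaleN1r addNr.
  move=> /hA/e0/matrixP/(_ 0 0); rewrite mulmxDl scaleN1r mulNmx [LHS]mxE [X in X + _]mxE.
  by rewrite [RHS]mxE /f addrC.
have fl a y z : f (a *: y + z) = a * f y + f z.
  rewrite (wd _ (a *: cc y + cc z)); first by rewrite mulmxDl -scalemxAl [LHS]mxE [X in X + _]mxE.
  by rewrite (Avg_lin actR) // !hcc comb.
have fs : smooth_dual v act f.
  split=> //; exists N; split=> // k y hk.
  by apply: wd; rewrite (Avg_act actR).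
exists (mk_sdual fs); apply: contraNneq ex0 => e1.
have -> : (cx *m e) 0 0 = ev (mk_sdual fs) x.
  by rewrite /ev /= (wd _ cx) // (Avg_id actS).
by rewrite e1.
Qed.

Lemma fixed_dual_inj N r (t : 'I_r -> V) : 0 < N ->
  (forall x, fixed act N x -> exists c : 'rV[C]_r, x = \sum_i c 0 i *: t i) ->
  forall l1 l2, fixed drho N l1 -> fixed drho N l2 ->
  (\row_i ev l1 (t i) = \row_i ev l2 (t i)) -> l1 = l2.
Proof.
move=> N0 span l1 l2 h1 h2 e; apply: ev_inj => x.
rewrite -(ev_Avg x N0 h1) -(ev_Avg x N0 h2).
have [c ->] := span _ (Avg_fixed actR actS x N0).
rewrite !evr_sum; apply: eq_bigr => i _; rewrite !evrZ.
by move/rowP/(_ i): e; rewrite !mxE => ->.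
Qed.

(** The common kernel of a nonzero stable W is stable in V, hence 0. If a fixed [l] were outside W,
    linear algebra on the fixed vectors of V would produce a nonzero vector killed by W. *)
Lemma dual_irr : irreducible_rep drho.
Proof.
split; first exact: dual_neq0.
move=> W Wsub Wst; have [W0 WD WZ] := Wsub; have [_ irr] := actI.
case: (pselect (forall l, W l -> l = 0)); first by left.
move=> nW; right.
have ann0 x : (forall l, W l -> ev l x = 0) -> x = 0.
  case: (irr (fun x => forall l, W l -> ev l x = 0)) => [|g y hg hy l Wl|h|h]; last first.
  - by case: nW => l Wl; apply: ev_inj => y; rewrite ev0 h.
  - exact: h.
  - by rewrite -{1}(invmxK g) -drhoE ?hy //; [apply: Wst => //|]; exact: GLV.
  split=> [l _|y z hy hz l Wl|a y hy l Wl].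
  - exact: evr0.
  - by rewrite evrD hy // hz // addr0.
  - by rewrite evrZ hy // mulr0.
move=> l; have [N [N0 hl]] := drhoS l.
have [r [t [ht span]]] := fixed_span N0.
pose R (l : E) : 'rV[C]_r := \row_i ev l (t i).
have Rlin a l1 l2 : R (a *: l1 + l2) = a *: R l1 + R l2.
  by apply/rowP => i; rewrite !mxE.
have Rinj := fixed_dual_inj N0 span.
pose S (c : 'rV[C]_r) := exists w, [/\ W w, fixed drho N w & R w = c].
have [A hA] : exists A : 'M[C]_r, forall c, S c <-> (c <= A)%MS.
  apply: rowspanP; split=> [|c d [w [h1 h2 h3]] [w' [h1' h2' h3']]|a c [w [h1 h2 h3]]].
  - exists 0; split=> //; first by apply: fixed0; exact: drhoR.
    by apply/rowP => i; rewrite !mxE.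
  - exists (w + w'); split; [exact: WD|by apply: (fixedD drhoR)|].
    by rewrite -[w]scale1r Rlin h3 h3' scale1r.
  - exists (a *: w); split; [exact: WZ|by apply: (fixedZ drhoR)|].
    by rewrite -h3; apply/rowP => i; rewrite !mxE.
case: (boolP (R l <= A)%MS) => [/hA[w [Ww hw e]]|/separating_col[e [e0 e1]]].
  by rewrite -(Rinj _ _ hw hl e).
exfalso; pose x := \sum_i e i 0 *: t i.
have evx (l' : E) : ev l' x = (R l' *m e) 0 0.
  by rewrite /x evr_sum mxE; apply: eq_bigr => i _; rewrite evrZ mxE mulrC.
have fx : fixed act N x by apply: (fixed_sum actR) => i; apply: (fixedZ actR).
case/eqP: e1; rewrite -evx (ann0 x) ?evr0 // => w Ww.
(* On the fixed vector [x], an element of W may be replaced by its average, which is again in W and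
   is fixed. *)
rewrite -(ev_dAvg w N0 fx) evx e0 ?mxE //.
apply/hA; exists (Avg drhoS N w); split=> //.
  by apply: (Avg_stable drhoS N0).
exact: (Avg_fixed drhoR).
Qed.

(** Evaluation at generators of the fixed vectors of V embeds the fixed functionals into $C^r$. *)
Lemma dual_fixed_span N : 0 < N -> exists r (t : 'I_r -> E), (forall i, fixed drho N (t i)) /\
  forall l, fixed drho N l -> exists c : 'rV[C]_r, l = \sum_i c 0 i *: t i.
Proof.
move=> N0; have [r [t [ht span]]] := fixed_span N0.
pose R (l : E) : 'rV[C]_r := \row_i ev l (t i).
have Rinj := fixed_dual_inj N0 span.
pose S (c : 'rV[C]_r) := exists2 w, fixed drho N w & R w = c.
have [A hA] : exists A : 'M[C]_r, forall c, S c <-> (c <= A)%MS.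
  apply: rowspanP; split=> [|c d [w h2 h3] [w' h2' h3']|a c [w h2 h3]].
  - exists 0; first by apply: fixed0; exact: drhoR.
    by apply/rowP => i; rewrite !mxE.
  - exists (w + w'); first by apply: (fixedD drhoR).
    by rewrite -h3 -h3'; apply/rowP => i; rewrite !mxE.
  - exists (a *: w); first by apply: (fixedZ drhoR).
    by rewrite -h3; apply/rowP => i; rewrite !mxE.
have /choice[w hw] (i : 'I_r) : exists w, fixed drho N w /\ R w = row i A.
  by have [|w h1 h2] := (hA (row i A)).2; [exact: row_sub|exists w].
exists r, w; split=> [i|l hl]; first by case: (hw i).
have /submxP[D hD] : (R l <= A)%MS by apply/hA; exists l.
exists D; apply: Rinj => //.
  by apply: (fixed_sum drhoR) => i; apply: (fixedZ drhoR); case: (hw i).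
rewrite -/(R l) hD mulmx_sum_row; apply/rowP => j; rewrite !mxE ev_suml summxE.
by apply: eq_bigr => i _; case: (hw i) => _ <-; rewrite evZ !mxE.
Qed.

End DualRep.

(** * Schwartz functions near singular matrices *)

Section LocalStructure.
Variables (C : numClosedFieldType) (K : lfield).
Local Notation v := (@lfv K).
Local Notation pi := (lfpi K).
Local Notation q := (lfq K).
Local Notation M2 := 'M[lfF K]_2.
Local Notation fn := (M2 -> C).
Local Notation qp := (@qp C K).
Local Notation SW := (@SW C K).
Local Notation SG := (@SG C K).
Local Notation weil g1 g2 f := (@weil_act C K v q 2 2 g1 g2 f).
Local Notation nu := (@nu K).
Local Notation nl := (@nl K).
Local Notation dg := (@dg K).
Local Notation ww := (@ww K).
Implicit Types (a b c n N j : int) (M X Y g h k : M2) (f : fn).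

Definition E11 : M2 := mx2 1 0 0 0.
Definition fE n : fn := box E11 n.
Definition tt : M2 := dg 1 pi.

Lemma GL_tt : GL tt.
Proof. by apply: GL_dg; rewrite ?oner_neq0 ?lf_pi0. Qed.

Lemma vd_tt : vd tt = 1.
Proof. by rewrite vd_dg ?oner_neq0 ?lf_pi0 // v1 lf_vpi. Qed.

Lemma vd1 : vd (1%:M : M2) = 0.
Proof. by rewrite /vd /dt det1 v1. Qed.

Lemma SW_fE n : SW (fE n). Proof. exact: SW_box. Qed.

Lemma fE_mx2 n (a b c d : K) : fE n (mx2 a b c d) =
  [&& vge v n (a - 1), vge v n b, vge v n c & vge v n d]%:R.
Proof. by rewrite /fE /box /E11 mx2_sub mge_mx2 !subr0. Qed.

(** Representatives of $p^n/p^{n+1}$; the matrices [gz n u] are (1 0; z pi) with z among them. *)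
Definition zr n (u : digI K 1) : K := pi ^ n * dig u.
Definition gz n (u : digI K 1) : M2 := nl (zr n u) *m tt.

Lemma GL_gz n u : GL (gz n u).
Proof. by apply: GLM; [exact: GL_nl|exact: GL_tt]. Qed.

Lemma vd_gz n u : vd (gz n u) = 1.
Proof. by rewrite vdetM ?vd_nl ?vd_tt //; [exact: GL_nl|exact: GL_tt]. Qed.

Lemma zr_vge n u : vge v n (zr n u).
Proof. by rewrite /zr vge_pi subrr digO. Qed.

Lemma weil_gz n u (a b c d : K) :
  weil (gz n u) 1%:M (fE n) (mx2 a b c d) = q%:R *
  [&& vge v n (a - 1), vge v n b, vge v (n + 1) (c - zr n u * a) &
      vge v (n + 1) (d - zr n u * b)]%:R.
Proof.
have p0 := lf_pi0 K; have o0 := oner_neq0 (lfF K).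
rewrite weilE vd_gz vd1 subr0 qp1 mulmx1; congr (_ * _).
rewrite invmxM; [|exact: GL_nl|exact: GL_tt].
rewrite nlV dgV // /nl /dg -mulmxA !mx2_mul fE_mx2.
have e x y : 0 * x + pi^-1 * y = pi^-1 * y by ring.
have vp x : vge v n (pi^-1 * x) = vge v (n + 1) x.
  by rewrite vge_mull ?invr_eq0 // vV // lf_vpi opprK.
rewrite !e !vp invr1; congr (_%:R); congr nat_of_bool.
by rewrite !mul1r !mul0r !addr0 !mulNr ![- _ + _]addrC.
Qed.

Definition sE n : fn := fun M => fE n M - \sum_u q%:R^-1 * weil (gz n u) 1%:M (fE n) M.

(* The sum in [sE] is the indicator function of the [M] in the ball around [E11] with [dt M] in [p ^ (n + 1)]. *)
Lemma sE_SG n : 0 < n -> SG (sE n).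
Proof.
move=> n0; split.
  have h : SW (fun M => \sum_u q%:R^-1 * weil (gz n u) 1%:M (fE n) M).
    apply: SW_sum => u; apply: SW_weil; [exact: GL_gz|exact: GL1|exact: SW_fE].
  have := SW_lin (-1) h (SW_fE n); congr SW.
  by apply/funext => M; rewrite /sch_lin /sE mulN1r addrC.
exists n => M; rewrite (mx2P M).
move: (M 0 0) (M 0 1) (M 1 0) (M 1 1) => a b c d {M}; rewrite /sE.
under eq_bigr do rewrite weil_gz mulrA mulVf ?q_neq0 // mul1r.
rewrite fE_mx2.
case: (boolP [&& vge v n (a - 1), vge v n b, vge v n c & vge v n d]); last first.
  move=> hA; rewrite big1 ?subr0 ?eqxx // => u _.
  case: (boolP [&& _, _, _ & _]) => // /and4P[h1 h2 h3 h4]; case/negP: hA.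
  have za := zr_vge n u.
  have aO : vge v 0 a.
    by rewrite -(subrK 1 a) vgeD ?vge1 //; apply: vge_le h1; lia.
  rewrite h1 h2 /=; apply/andP; split.
    rewrite -(subrK (zr n u * a) c) vgeD //; first by apply: vge_le h3; lia.
    by apply: vgeM_le za aO; lia.
  rewrite -(subrK (zr n u * b) d) vgeD //; first by apply: vge_le h4; lia.
  by apply: vgeM_le za h2; lia.
case/and4P=> h1 h2 h3 h4.
have a1 : a != 0 /\ v a = 0.
  have -> : a = 1 + (a - 1) by rewrite addrC subrK.
  rewrite -(v1 K); apply: v_add_small; first exact: oner_neq0.
  by rewrite v1; apply: vge_le h1; lia.
have [a0 va] := a1.
(* If $v(d) = n$, the product $ad$ dominates $bc$, which lies in $p^{2n}$, so the determinant has
   valuation exactly n. *)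
case: (boolP (vge v (n + 1) d)) => hd; last first.
  move=> _; have d0 : d != 0 by apply: contraNneq hd => ->; exact: vge0.
  have vdn : v d = n.
    by move: hd h4; rewrite !vgeE // => ? ?; lia.
  rewrite /vd mx2_det; have : a * d - b * c != 0 /\ v (a * d - b * c) = v (a * d).
    apply: v_add_small; first exact: mulf_neq0.
    by rewrite vgeN lf_vM // va vdn; apply: vgeM_le h2 h3; lia.
  by case=> ne ->; split=> //; rewrite lf_vM // va vdn add0r.
(* Otherwise exactly one z in $p^n/p^{n+1}$ makes the second row congruent to z times the first
   modulo $p^{n+1}$, and the sum equals 1. *)
have [u0 hu0] : exists u : digI K 1, vge v (n + 1) (c - zr n u).
  have [|u hu] := @dig_surj K 1 (pi ^ (- n) * c); first by rewrite vge_pi opprK add0r.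
  exists u; rewrite (_ : c - zr n u = pi ^ n * (pi ^ (- n) * c - dig u)).
    by rewrite vge_pi; apply: vge_le hu; lia.
  by rewrite mulrBr mulrA -expfzDr ?lf_pi0 // subrr expr0z mul1r.
have key u : vge v (n + 1) (c - zr n u * a) = (u == u0).
  have za : vge v (n + 1) (zr n u * (a - 1)).
    by apply: vgeM_le (zr_vge n u) h1; lia.
  apply/idP/eqP => [h|->].
    apply: (@dig_inj K 1); have : vge v (n + 1) (pi ^ n * (dig u - dig u0)).
      rewrite (_ : _ * _ = (c - zr n u0) - (c - zr n u * a) - zr n u * (a - 1)).
        by rewrite vgeB // vgeB.
      by rewrite /zr; ring.
    by rewrite vge_pi; apply: vge_le; lia.
  rewrite (_ : _ - _ = (c - zr n u0) - zr n u0 * (a - 1)); last by ring.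
  by rewrite vgeB //; apply: vgeM_le (zr_vge n u0) h1; lia.
rewrite (bigD1 u0) //= big1 ?addr0 => [|u /negPf uu].
  rewrite h1 h2 key eqxx /=.
  have -> : vge v (n + 1) (d - zr n u0 * b).
    by rewrite vgeB //; apply: vgeM_le (zr_vge n u0) h2; lia.
  by rewrite subrr eqxx.
by rewrite key uu /= !andbF.
Qed.

Lemma fE_decomp n : fE n = sch_lin 1 (sE n)
  (fun M => \sum_u q%:R^-1 * weil (gz n u) 1%:M (fE n) M).
Proof. by apply/funext => M; rewrite /sch_lin /sE mul1r subrK. Qed.

Lemma fE_nu n (x : K) : vge v 0 x -> weil (nu x) 1%:M (fE n) = fE n.
Proof.
move=> hx; apply/funext => M; rewrite weilE vd_nu vd1 subr0 qp0 mul1r mulmx1 nuV.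
rewrite (mx2P M) /nu mx2_mul !fE_mx2; congr (_%:R); congr nat_of_bool.
move: (M 0 0) (M 0 1) (M 1 0) (M 1 1) => a b c d {M}.
have e y : vge v n y -> vge v n (x * y).
  by move=> hy; apply: vgeM_le hx hy; rewrite add0r.
have ec : (0 * a + 1 * c = c) by ring.
have ed : (0 * b + 1 * d = d) by ring.
rewrite ec ed; apply/and4P/and4P => -[h1 h2 h3 h4]; split=> //.
- by rewrite (_ : a - 1 = 1 * a + - x * c - 1 + x * c); [rewrite vgeD // e|ring].
- by rewrite (_ : b = 1 * b + - x * d + x * d); [rewrite vgeD // e|ring].
- by rewrite (_ : _ - 1 = a - 1 - x * c); [rewrite vgeB // e|ring].
- by rewrite (_ : _ + _ = b - x * d); [rewrite vgeB // e|ring].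
Qed.

Lemma fE_dg n (d : K) : d != 0 -> v d = 0 -> weil (dg 1 d) 1%:M (fE n) = fE n.
Proof.
move=> d0 vd0; have o0 := oner_neq0 (lfF K).
apply/funext => M; rewrite weilE vd_dg // v1 vd0 vd1 addr0 subr0 qp0 mul1r mulmx1 dgV //.
rewrite (mx2P M) /dg mx2_mul !fE_mx2; congr (_%:R); congr nat_of_bool.
have e x y : 0 * x + d^-1 * y = d^-1 * y by ring.
have e2 (x y : K) : 1^-1 * x + 0 * y = x by rewrite invr1; ring.
by rewrite !e !e2 !vge_mull ?invr_eq0 // vV // vd0 oppr0 subr0.
Qed.

(** An entry of least valuation is moved to the upper left corner by [ww] and used as a pivot. The
    value e = 0 covers matrices of rank one. *)
Lemma cartan X : X != 0 -> exists j k1 k2 (e : K),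
  [/\ Kz k1, Kz k2, vge v 0 e & X = pi ^ j *: (k1 *m dg 1 e *m k2)].
Proof.
have main (a b c d : K) : a != 0 -> mge (v a) (mx2 a b c d) -> exists j k1 k2 (e : K),
    [/\ Kz k1, Kz k2, vge v 0 e & mx2 a b c d = pi ^ j *: (k1 *m dg 1 e *m k2)].
  move=> a0; rewrite mge_mx2 => /and4P[_ hb hc hd].
  have hq x : vge v (v a) x -> vge v 0 (a^-1 * x).
    by move=> hx; rewrite vge_mull ?invr_eq0 // vV // opprK add0r.
  pose p := pi ^ v a; have p0 : p != 0 by exact: piX_neq0.
  have o0 := oner_neq0 (lfF K).
  have u0 : a / p != 0 by rewrite mulf_neq0 ?invr_eq0.
  have vu : v (a / p) = 0 by rewrite lf_vM ?invr_eq0 // vV // vpiX subrr.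
  have hp x : vge v (v a) x -> vge v 0 (p^-1 * x).
    by move=> hx; rewrite vge_mull ?invr_eq0 // vV // vpiX opprK add0r.
  exists (v a), (nl (a^-1 * c) *m dg (a / p) 1), (nu (a^-1 * b)), (p^-1 * (d - a^-1 * b * c)).
  split.
  - by apply: KzM; [apply: Kz_nl; exact: hq|apply: Kz_dg; rewrite ?v1].
  - by apply: Kz_nu; exact: hq.
  - by apply: hp; rewrite vgeB //; apply: vgeM_le (hq _ hb) hc; rewrite add0r.
  rewrite -/p /nl /dg /nu !mx2_mul; apply/esym/mx2_eqP; rewrite !mxE /=; field; rewrite ?a0 ?p0 //.
have perm X' : (exists j k1 k2 (e : K), [/\ Kz k1, Kz k2, vge v 0 e & ww *m X' = pi ^ j *: (k1 *m dg 1 e *m k2)]) ->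
   exists j k1 k2 (e : K), [/\ Kz k1, Kz k2, vge v 0 e & X' = pi ^ j *: (k1 *m dg 1 e *m k2)].
  move=> [j [k1 [k2 [e [h1 h2 h3 h4]]]]]; exists j, (ww *m k1), k2, e; split=> //.
    by apply: KzM => //; exact: Kz_ww.
  by rewrite -!mulmxA scalemxAr !mulmxA -[RHS]mulmxA -scalemxAr -h4 mulmxA wwK mul1mx
   || rewrite -[LHS]mul1mx -(wwK K) -mulmxA h4 -scalemxAr !mulmxA.
have perm2 X' : (exists j k1 k2 (e : K), [/\ Kz k1, Kz k2, vge v 0 e & X' *m ww = pi ^ j *: (k1 *m dg 1 e *m k2)]) ->
   exists j k1 k2 (e : K), [/\ Kz k1, Kz k2, vge v 0 e & X' = pi ^ j *: (k1 *m dg 1 e *m k2)].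
  move=> [j [k1 [k2 [e [h1 h2 h3 h4]]]]]; exists j, k1, (k2 *m ww), e; split=> //.
    by apply: KzM => //; exact: Kz_ww.
  by rewrite -[LHS]mulmx1 -(wwK K) mulmxA h4 -scalemxAl !mulmxA.
move=> X0; rewrite (mx2P X).
have : exists p : 'I_2 * 'I_2, X p.1 p.2 != 0 /\ mge (v (X p.1 p.2)) X.
  have ex : exists p : 'I_2 * 'I_2, X p.1 p.2 != 0.
    apply/existsP; apply: contraR X0; rewrite negb_exists => /forallP h.
    by apply/eqP/matrixP => i j; rewrite mxE; apply/eqP; have := h (i, j); rewrite negbK.
  have [p0 hp0] := ex.
  case: (@Order.TotalTheory.arg_minP _ _ _ p0 (fun p => X p.1 p.2 != 0) (fun p => v (X p.1 p.2)) hp0) => p hp pmin.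
  exists p; split=> //; apply/mgeP => i j.
  have [->|h] := eqVneq (X i j) 0; first exact: vge0.
  by rewrite vgeE //; exact: (pmin (i, j)).
move: (mx2P X); move: (X 0 0) (X 0 1) (X 1 0) (X 1 1) => a b c d eX.
rewrite eX => -[[i j]] /=; rewrite mxE.
have e1 (x y z t : K) : ww *m mx2 x y z t = mx2 z t x y by rewrite /ww mx2_mul; congr mx2; ring.
have e2 (x y z t : K) : mx2 x y z t *m ww = mx2 y x t z by rewrite /ww mx2_mul; congr mx2; ring.
case: (ord2P i) => ->; case: (ord2P j) => -> /= [h0 hm].
- exact: main.
- by apply: perm2; rewrite e2; apply: main => //; move: hm; rewrite !mge_mx2 => /and4P[-> -> -> ->].
- by apply: perm; rewrite e1; apply: main => //; move: hm; rewrite !mge_mx2 => /and4P[-> -> -> ->].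
- apply: perm; rewrite e1; apply: perm2; rewrite e2; apply: main => //.
  by move: hm; rewrite !mge_mx2 => /and4P[-> -> -> ->].
Qed.

Lemma GL_piK j k : Kz k -> GL (pi ^ j *: k).
Proof.
case=> hk _ _; rewrite -mul_scalar_mx; apply: GLM => //.
by rewrite /GL unitmxE det_scalar unitfE expf_neq0 // piX_neq0.
Qed.

Lemma weil_piK j k1 k2 f M : Kz k1 -> Kz k2 ->
  weil (pi ^ j *: k1) k2 f M = qp (2 * j) * f (pi ^ (- j) *: (invmx k1 *m M *m k2)).
Proof.
move=> h1 h2; rewrite weilE (Kz_vdet h2) subr0.
have hk : GL k1 by case: h1.
have sj (i : int) : GL ((pi ^ i)%:M : M2).
  by rewrite /GL unitmxE det_scalar unitfE expf_neq0 // piX_neq0.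
have -> : vd (pi ^ j *: k1) = 2 * j.
  rewrite -mul_scalar_mx vdetM // (Kz_vdet h1) addr0 /vd /dt det_scalar.
  by rewrite exprnP vX ?piX_neq0 // vpiX.
have -> : invmx (pi ^ j *: k1) = pi ^ (- j) *: invmx k1.
  apply: invmx_uniq; rewrite -scalemxAl -scalemxAr mulmxV // scalerA.
  by rewrite -expfzDr ?lf_pi0 // subrr expr0z scale1r.
by rewrite -!scalemxAl.
Qed.

(** Cartan coordinates carry the ball to one of radius [n - j] around [dg 1 e]. It is the ball
    around [E11] if e is that small; otherwise it avoids singular matrices. The condition
    [c + n0 <= n] guarantees [n0 <= n - j], and [qp (- (2 * j))] cancels the factor of the Weil
    action. *)
Lemma box_class X n a c n0 : X != 0 -> mge a X -> ~~ mge c X -> c + n0 <= n -> 0 < n0 ->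
  SG (box X n) \/ exists j k1 k2 n', [/\ Kz k1, Kz k2, a <= j < c, n0 <= n' &
    box X n = sch_lin (qp (- (2 * j))) (weil (pi ^ j *: k1) k2 (fE n')) fn0].
Proof.
move=> X0 aX cX hn n00; have [j [k1 [k2 [e [h1 h2 h3 h4]]]]] := cartan X0.
have p0 := piX_neq0 K j.
have mX N : mge N X = vge v (N - j) 1.
  rewrite h4 mgeZ // Kz_mgeR // Kz_mgeL // vpiX /dg mge_mx2 !vge0 /=.
  apply/andP/idP => [[]//|h]; split=> //; have := h; rewrite vgeE ?oner_neq0 // v1 => hN.
  by apply: vge_le h3; lia.
have jc : a <= j < c.
  move: aX cX; rewrite !mX !vgeE ?oner_neq0 // v1 => ? ?; lia.
have boxE M : box X n M = (mge (n - j) (pi ^ (- j) *: (invmx k1 *m M *m invmx k2) - dg 1 e))%:R.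
  rewrite /box; congr (_%:R); congr nat_of_bool.
  have k1V := KzV h1; have k2V := KzV h2.
  rewrite -(Kz_mgeL _ _ k1V) -(Kz_mgeR _ _ k2V).
  have -> : invmx k1 *m (M - X) *m invmx k2 = pi ^ j *:
      (pi ^ (- j) *: (invmx k1 *m M *m invmx k2) - dg 1 e).
    rewrite mulmxBr mulmxBl scalerBr scalerA -expfzDr ?lf_pi0 // subrr expr0z scale1r.
    congr (_ - _); rewrite h4 -scalemxAr -scalemxAl !mulmxA mulVmx ?mul1mx; last by case: h1.
    by rewrite mulmxK //; case: h2.
  by rewrite mgeZ // vpiX.
case: (boolP (vge v (n - j) e)) => he.
  right; exists j, k1, (invmx k2), (n - j); split=> //; [exact: KzV|lia|].
  apply/funext => M; rewrite /sch_lin /fn0 addr0 weil_piK //; last exact: KzV.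
  rewrite mulrA -qpD addNr qp0 mul1r boxE.
  rewrite -[fE _ _]/(box (E11) (n - j) _) (@box_eq C K _ (dg 1 e)) //.
  by rewrite mge_subC /E11 /dg mx2_sub mge_mx2 !subr0 subrr !vge0.
(* Now $v(e) < n - j$, so the determinant has constant valuation $2j + v(e)$ on the ball. *)
left; split; first exact: SW_box.
have e0 : e != 0 by apply: contraNneq he => ->; exact: vge0.
exists (2 * j + v e) => M; rewrite boxE pnatr_eq0 eqb0 negbK => hM.
set Y := pi ^ (- j) *: _ in hM.
have [d0 dv] : dt Y != 0 /\ vd Y = v e.
  have -> : dt Y != 0 /\ vd Y = v e <-> e + (dt Y - e) != 0 /\ v (e + (dt Y - e)) = v e.
    by rewrite addrC subrK.
  apply: v_add_small => //.
  move: hM; rewrite (mx2P Y) /dg mx2_sub mge_mx2 mx2_det.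
  move: (Y 0 0) (Y 0 1) (Y 1 0) (Y 1 1) => x y z t /and4P[q1 q2 q3 q4].
  move: he; rewrite vgeE // -ltNge => he; rewrite vgeE // in h3.
  rewrite subr0 in q2; rewrite subr0 in q3.
  rewrite (_ : _ - e = (x - 1) * (t - e) + ((t - e) + (x - 1) * e) - y * z); last by ring.
  apply: vgeB; last by apply: vgeM_le q2 q3; lia.
  apply: vgeD; first by apply: vgeM_le q1 q4; lia.
  apply: vgeD; first by apply: vge_le q4; lia.
  by apply: vgeM_le q1 (_ : vge v (v e) e); [lia|rewrite vgeE].
have k1u : GL k1 by case: h1.
have k2u : GL k2 by case: h2.
have YG := det_GL d0; have kj := GL_piK j h1.
have eM : M = (pi ^ j *: k1) *m Y *m k2.
  rewrite /Y -scalemxAl -scalemxAr scalerA -expfzDr ?lf_pi0 // subrr expr0z scale1r.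
  by rewrite !mulmxA mulmxV // mul1mx mulmxKV.
have gM : GL M by rewrite eM; apply: GLM => //; exact: GLM.
split; first exact: GL_det.
rewrite eM vdetM //; last exact: GLM.
rewrite vdetM // dv (Kz_vdet h2) addr0.
rewrite -mul_scalar_mx vdetM //; last first.
  by rewrite /GL unitmxE det_scalar unitfE expf_neq0.
by rewrite (Kz_vdet h1) addr0 /vd /dt det_scalar exprnP vX // vpiX.
Qed.

(* By the Cartan decomposition a small ball around a nonzero singular matrix is a translate of some [fE n]. *)
Lemma SW_ind_nz (P : fn -> Prop) a b c n0 f :
  (forall (x : C) f f2, SW f -> SW f2 -> P f -> P f2 -> P (sch_lin x f f2)) ->
  (forall f, SG f -> P f) -> 0 < n0 ->
  (forall j k1 k2 n, Kz k1 -> Kz k2 -> a <= j < c -> n0 <= n -> P (weil (pi ^ j *: k1) k2 (fE n))) ->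
  sch a b f -> (forall M, mge c M -> f M = 0) -> P f.
Proof.
move=> Pl PSG n00 PE hf fc.
have P0 : P fn0 by apply: PSG; exact: SG_0.
pose i := absz (Num.max (Num.max b a) (c + n0) - a)%R.
have hf' : sch a (a + i%:Z) f by apply: sch_le hf; rewrite /i; lia.
apply: (sch_ind P0 Pl hf') => X aX fX.
have cX : ~~ mge c X by apply: contra fX => /fc ->.
have X0 : X != 0 by apply: contraNneq cX => ->; exact: mge0.
have [||h|[j [k1 [k2 [n' [h1 h2 h3 h4 ->]]]]]] := @box_class X (a + i%:Z) a c n0 X0 aX cX; rewrite /i //; try lia.
  exact: PSG.
by apply: Pl => //; [apply: SW_weil; [exact: GL_piK|by case: h2|exact: SW_fE]|exact: SW_0|exact: PE].
Qed.

Definition fO : fn := box 0 0.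

(** The inverse of [tt] maps $p M_2(O)$ into $M_2(O)$. Near the zero matrix one translate suffices,
    in contrast to the q translates of [sE]. *)
Lemma fO_decomp M : mge 1 M -> fO M - q%:R^-1 * weil tt 1%:M fO M = 0.
Proof.
move=> hM; have p0 := lf_pi0 K; have o0 := oner_neq0 (lfF K).
rewrite weilE vd_tt vd1 subr0 qp1 mulmx1 mulrA mulVf ?q_neq0 // mul1r /fO /box !subr0.
rewrite (mge_le _ hM) //; have -> : mge 0 (invmx tt *m M); last by rewrite subrr.
apply: (@mgeM _ _ (-1) 1) => //.
by rewrite /tt dgV // mge_mx2 !vge0 !vgeE ?invr_eq0 // invr1 v1 vV // lf_vpi.
Qed.

End LocalStructure.

(** * Coinvariants of the mirabolic subgroups *)

Section DigitSums.
Variable K : lfield.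
Local Notation v := (@lfv K).
Local Notation pi := (lfpi K).

Lemma sum_dig_transl (A : nmodType) (phi : K -> A) (a : int) (j : nat) (z : K) :
  (forall x y, vge v (a + j%:Z) (x - y) -> phi x = phi y) -> vge v a z ->
  \sum_(u : digI K j) phi (pi ^ a * dig u + z) = \sum_(u : digI K j) phi (pi ^ a * dig u).
Proof.
move=> hphi hz.
have piK (x : K) : pi ^ a * (pi ^ (- a) * x) = x.
  by rewrite mulrA -expfzDr ?lf_pi0 // subrr expr0z mul1r.
have /choice[h Hh] (u : digI K j) : exists w : digI K j, vge v (a + j%:Z) (pi ^ a * dig u + z - pi ^ a * dig w).
  have [|w hw] := @dig_surj K j (dig u + pi ^ (- a) * z).
    by rewrite vgeD ?digO // vge_pi opprK add0r.
  exists w; rewrite (_ : _ - _ = pi ^ a * (dig u + pi ^ (- a) * z - dig w)).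
    by rewrite vge_pi; apply: vge_le hw; lia.
  by rewrite mulrBr mulrDr piK.
have hinj : injective h.
  move=> u w e; apply: (@dig_inj K j); have := vgeB (Hh u) (Hh w); rewrite e.
  rewrite (_ : _ - _ = pi ^ a * (dig u - dig w)); last by ring.
  by rewrite vge_pi; apply: vge_le; lia.
rewrite [RHS](reindex h) /=; last exact/onW_bij/injF_bij.
by apply: eq_bigr => u _; apply: hphi; exact: Hh.
Qed.

End DigitSums.

Section Coinvariants.
Variables (C : numClosedFieldType) (K : lfield).
Local Notation v := (@lfv K).
Local Notation pi := (lfpi K).
Local Notation q := (lfq K).
Local Notation M2 := 'M[lfF K]_2.
Local Notation nu := (@nu K).
Local Notation nl := (@nl K).
Local Notation dg := (@dg K).
Local Notation ww := (@ww K).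
Variables (E : lmodType C) (rho : M2 -> E -> E).
Hypothesis rhoR : is_rep rho.
Hypothesis rhoS : smooth_rep v rho.
Implicit Types (g h k : M2) (x y l : E).

Section Congruence.
Variable Y : E -> Prop.
Hypothesis Ysub : subspace Y.

Definition eqm x y := Y (x - y).

Lemma eqm_refl x : eqm x x.
Proof. by case: Ysub => h _ _; rewrite /eqm subrr. Qed.

Lemma subspaceN x : Y x -> Y (- x).
Proof. by case: Ysub => _ _ h hx; rewrite -scaleN1r; exact: h. Qed.

Lemma eqm_sym x y : eqm x y -> eqm y x.
Proof. by move=> h; rewrite /eqm -opprB; exact: subspaceN. Qed.

Lemma eqm_trans y x z : eqm x y -> eqm y z -> eqm x z.
Proof. by case: Ysub => _ h _ h1 h2; rewrite /eqm -(subrKA y); exact: h. Qed.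

Lemma eqmD x y x' y' : eqm x y -> eqm x' y' -> eqm (x + x') (y + y').
Proof. by case: Ysub => _ h _ h1 h2; rewrite /eqm opprD addrACA; exact: h. Qed.

Lemma eqmN x y : eqm x y -> eqm (- x) (- y).
Proof. by move=> h; rewrite /eqm -opprD; exact: subspaceN. Qed.

Lemma eqmB x y x' y' : eqm x y -> eqm x' y' -> eqm (x - x') (y - y').
Proof. by move=> h h'; apply: eqmD => //; exact: eqmN. Qed.

Lemma eqm_sum (I : finType) (F G : I -> E) : (forall i, eqm (F i) (G i)) ->
  eqm (\sum_i F i) (\sum_i G i).
Proof.
move=> h; apply: (big_ind2 (fun a b => eqm a b)) => // [|x x' y y' h1 h2]; first exact: eqm_refl.
exact: eqmD.
Qed.

End Congruence.

Lemma GL_up (a b d : K) : a != 0 -> d != 0 -> GL (mx2 a b 0 d).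
Proof. by move=> a0 d0; rewrite /GL mx2_unit mulr0 subr0 mulf_neq0. Qed.

(** Modulo Y, the translates of l by $b_0 w\, nu(x)$ form a locally constant function [phi] of x
    that equals l far out. The first sum in [y] amounts to summing [phi] over $p^{m-1}$, the second
    over $p^m$; the difference lives on the shell between them, where [phi] is l, and [c0] counts
    its classes. *)
Lemma fix_up_ex l : exists y (c0 : C), [/\ c0 != 0,
  (forall Y : E -> Prop, subspace Y ->
    (forall b d m, d != 0 -> Y (rho (mx2 1 b 0 d) m - m)) ->
    (forall a b d, a != 0 -> d != 0 -> Y (rho (mx2 a b 0 d) l - l)) ->
    forall g, GL g -> Y (rho g y - c0 *: l)) &
  forall Y : E -> Prop, subspace Y ->
    (forall b c m, c != 0 -> Y (rho (mx2 c b 0 1) m - m)) -> Y (y - c0 *: l)].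
Proof.
have [N0 [N00 hl0]] := rhoS l.
pose N : nat := `|N0|%N; have N1 : 0 < N%:Z by rewrite /N; lia.
have hl : fixed rho N%:Z l by rewrite (_ : N%:Z = N0) // /N; lia.
have o0 := oner_neq0 (lfF K); have p0 := lf_pi0 K.
pose t' := dg pi 1; have t'G : GL t' by apply: GL_dg.
(* The second sum thus runs over $p^{-N}/p^N$: [phi] has period $p^N$ and equals l modulo Y outside
   $p^{-N}$. *)
pose j := (N + N)%N; pose m : int := - N%:Z.
pose y := \sum_(u : digI K j.+1) rho (nu (pi ^ m * dig u)) (rho t' l)
   - \sum_(u : digI K j) rho (nu (pi ^ m * dig u)) l.
pose c0 : C := (q ^ j.+1)%:R - (q ^ j)%:R.
have c00 : c0 != 0.
  rewrite /c0 -natrB; last by rewrite leq_exp2l ?(q_gt1 K) //; lia.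
  by rewrite pnatr_eq0 subn_eq0 -ltnNge ltn_exp2l ?(q_gt1 K).
have suml : \sum_(u : digI K j.+1) l - \sum_(u : digI K j) l = c0 *: l.
  by rewrite !sumr_const !card_digI /c0 scalerBl !scaler_nat.
exists y, c0; split=> // [Y Ysub YQ Yl g hg|Y Ysub YQ]; last first.
  rewrite -/(eqm Y y (c0 *: l)) -suml; apply: eqmB => //; apply: eqm_sum => // u.
    apply: (@eqm_trans _ Ysub (rho t' l)).
      by apply: YQ.
    by rewrite /t' /dg; apply: YQ.
  exact: YQ.
have up a b d : a != 0 -> d != 0 -> eqm Y (rho (mx2 a b 0 d) l) l by move=> *; exact: Yl.
rewrite -/(eqm Y _ _).
have rgy : rho g y = \sum_(u : digI K j.+1) rho (g *m nu (pi ^ m * dig u) *m t') l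
   - \sum_(u : digI K j) rho (g *m nu (pi ^ m * dig u)) l.
  rewrite /y (rhoB rhoR) // !(rho_sum rhoR) //; congr (_ - _); apply: eq_bigr => u _.
    by rewrite -!(rhoM rhoR) //; try apply: GLM => //; exact: GL_nu.
  by rewrite -!(rhoM rhoR) //; exact: GL_nu.
rewrite rgy; have := hg; rewrite (mx2P g).
move: (g 0 0) (g 0 1) (g 1 0) (g 1 1) => a b c d {rgy}; rewrite /GL mx2_unit => D0.
(* For g upper triangular every term is l translated by an upper triangular matrix, hence l modulo
   Y. *)
have [c_0|c_0] := eqVneq c 0.
  rewrite c_0 mulr0 subr0 mulf_eq0 negb_or in D0; case/andP: D0 => a0 d0.
  rewrite -suml c_0; apply: eqmB => //; apply: eqm_sum => // u.
    rewrite /nu /t' /dg !mx2_mul (_ : (_ * pi + _) = a * pi); last by ring.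
    rewrite (_ : (0 * 1 + d * 0) * pi + (0 * _ + d * 1) * 0 = 0); last by ring.
    rewrite (_ : (0 * 1 + d * 0) * 0 + (0 * _ + d * 1) * 1 = d); last by ring.
    by apply: up => //; rewrite mulf_neq0.
  rewrite /nu !mx2_mul (_ : (_ * 1 + b * 0) = a); last by ring.
  rewrite (_ : 0 * 1 + d * 0 = 0); last by ring.
  rewrite (_ : 0 * _ + d * 1 = d); last by ring.
  exact: up.
(* Bruhat decomposition of g with unipotent part [nu z]. *)
pose z := d / c; pose al := b - a * d / c.
have al0 : al != 0.
  apply: contraNneq D0 => e; rewrite (_ : _ - _ = - (c * al)); last by rewrite /al; field.
  by rewrite e mulr0 oppr0.
pose b0 := mx2 al a 0 c; have b0G : GL b0 by apply: GL_up.
pose phi (x : K) := rho (b0 *m ww *m nu x) l.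
have wG := GL_ww K.
have bwG : GL (b0 *m ww) by apply: GLM.
have phi_per (x x' : K) : vge v N%:Z (x - x') -> phi x = phi x'.
  move=> hx; rewrite /phi (_ : nu x = nu x' *m nu (x - x')); last first.
    by rewrite nuD addrC subrK.
  rewrite mulmxA (rhoM rhoR _ (GLM bwG (GL_nu _)) (GL_nu _)); congr (rho _ _).
  apply: hl; apply/congrP => //; rewrite mx2_1 /nu mx2_sub mge_mx2 !subrr !subr0 !vge0 hx //.
have phi_far (x : K) : ~~ vge v m x -> eqm Y (phi x) l.
  move=> hx; have x0 : x != 0 by apply: contraNneq hx => ->; exact: vge0.
  rewrite /phi (_ : b0 *m ww *m nu x = mx2 (- al / x) (al + a * x) 0 (c * x) *m nl x^-1) ; last first.
    by rewrite /b0 /ww /nu /nl !mx2_mul; congr mx2; field.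
  rewrite (rhoM rhoR); [|apply: GL_up; rewrite ?mulf_neq0 ?oppr_eq0 ?invr_eq0 //|exact: GL_nl].
  rewrite (hl (nl x^-1)); first by apply: up; rewrite ?mulf_neq0 ?oppr_eq0 ?invr_eq0.
  apply/congrP => //; rewrite mx2_1 /nl mx2_sub mge_mx2 !subrr !subr0 !vge0 /= andbT.
  by rewrite vgeE ?invr_eq0 // vV //; move: hx; rewrite vgeE // /m -ltNge => hx; lia.
have gE (x : K) : mx2 a b c d *m nu x = b0 *m ww *m nu (z + x).
  by rewrite /b0 /ww /nu /z /al !mx2_mul; congr mx2; field.
(* Commuting [t'] to the left divides the argument by $\pi$ and leaves an element of Q, which is
   trivial modulo Y. *)
have t1 (x : K) : eqm Y (rho (mx2 a b c d *m nu x *m t') l) (phi (pi^-1 * (z + x))).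
  rewrite gE (_ : _ *m t' = mx2 1 ((pi - 1) * a / c) 0 pi *m (b0 *m ww *m nu (pi^-1 * (z + x)))); last first.
    by rewrite /b0 /ww /nu /t' /dg !mx2_mul; congr mx2; field; rewrite ?c_0 ?p0.
  rewrite (rhoM rhoR); [exact: YQ|exact: GL_up|by apply: GLM => //; exact: GL_nu].
apply: (@eqm_trans _ Ysub (\sum_(u : digI K j.+1) phi (pi^-1 * (z + pi ^ m * dig u))
    - \sum_(u : digI K j) phi (z + pi ^ m * dig u))).
  apply: eqmB => //; apply: eqm_sum => // u.
  by rewrite gE; exact: eqm_refl.
(* If z is outside $p^m$, all arguments are far out and every term is l. *)
rewrite -suml; case: (boolP (vge v m z)) => hz; last first.
  have far (x : K) : vge v m x -> ~~ vge v m (z + x).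
    by move=> hx; apply: contra hz => h; rewrite -(addrK x z) vgeB.
  have dm i (u : digI K i) : vge v m (pi ^ m * dig u) by rewrite vge_pi subrr digO.
  apply: eqmB => //; apply: eqm_sum => // u; apply: phi_far; last exact: far.
  apply: contra (far _ (dm _ u)); rewrite vge_mull ?invr_eq0 // vV // lf_vpi.
  by apply: vge_le; lia.
have transl (w : K) : vge v m w ->
    \sum_(u : digI K j) phi (pi ^ m * dig u + w) = \sum_(u : digI K j) phi (pi ^ m * dig u).
  apply: sum_dig_transl => x x' hx; apply: phi_per; apply: vge_le hx.
  by rewrite /m /j; lia.
have -> : \sum_(u : digI K j) phi (z + pi ^ m * dig u) = \sum_(u : digI K j) phi (pi ^ m * dig u).
  by rewrite -(transl z hz); apply: eq_bigr => u _; rewrite addrC.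
set S := \sum_(u : digI K j) phi _.
have pm (x : K) : vge v 0 (pi ^ (- m) * x) = vge v m x by rewrite vge_pi opprK add0r.
(* Exactly one first digit puts the argument back into $p^m$; its part of the first sum cancels the
   second sum [S], and all other digits are far out. *)
have [i0 hi0q hi0] := @lf_ssurj K (- (pi ^ (- m) * z)) ltac:(by rewrite vgeN pm).
pose w0 (i : 'I_q) := pi^-1 * (z + pi ^ m * (lfs K)`_i).
have piK (x : K) : pi ^ m * (pi ^ (- m) * x) = x.
  by rewrite mulrA -expfzDr ?lf_pi0 // subrr expr0z mul1r.
have w0E (i : 'I_q) : vge v m (w0 i) = (i == Ordinal hi0q).
  have -> : w0 i = pi^-1 * (pi ^ m * ((lfs K)`_i + pi ^ (- m) * z)).
    by rewrite /w0 [in RHS]mulrDr piK [in RHS]addrC.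
  rewrite vge_mull ?invr_eq0 // vge_pi vV // lf_vpi.
  rewrite (_ : m - - 1 - m = 1); last by lia.
  apply/idP/eqP => [h|->]; last by rewrite -vgeN opprD addrC.
  apply/val_inj/eqP; case: (boolP (val i == i0)) => // ne.
  have := lf_sinj (ltn_ord i) hi0q ne; have := vgeD h hi0.
  by rewrite addrA addrK => ->.
have split1 : \sum_(u : digI K j.+1) phi (pi^-1 * (z + pi ^ m * dig u)) =
    \sum_(i : 'I_q) \sum_(u : digI K j) phi (pi ^ m * dig u + w0 i).
  rewrite pair_bigA /=; apply: eq_bigr => -[i u] _ /=; congr phi.
  by rewrite /w0; field.
have split2 : \sum_(u : digI K j.+1) l = \sum_(i : 'I_q) \sum_(u : digI K j) l.
  by rewrite pair_bigA.
rewrite split1 split2 (bigD1 (Ordinal hi0q)) //= transl; last by rewrite w0E.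
rewrite -/S [X in eqm _ _ (X - _)](bigD1 (Ordinal hi0q)) //=.
rewrite addrAC subrr add0r [X in eqm _ _ X]addrAC subrr add0r.
apply: (big_ind2 (fun a b => eqm Y a b)) => [||i hi]; first exact: eqm_refl.
  by move=> ? ? ? ?; exact: eqmD.
apply: eqm_sum => // u; apply: phi_far; apply: contra hi => h.
rewrite -w0E -(addKr (pi ^ m * dig u) (w0 i)) addrC vgeB //.
by rewrite vge_pi subrr digO.
Qed.

Hypothesis rhoI : irreducible_rep rho.

(** Membership in the span of all $\rho(h)m - m$; if it holds for every x, the H-coinvariants
    vanish. *)
Definition coinv (H : M2 -> Prop) x : Prop := forall Y : E -> Prop, subspace Y ->
  (forall g m, H g -> Y (rho g m - m)) -> Y x.

Lemma coinv_sub H : subspace (coinv H).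
Proof.
split=> [Y [Y0 _ _] _|x y hx hy Y Ys YH|a x hx Y Ys YH]; first exact: Y0.
  by have [_ YD _] := Ys; apply: YD; [exact: hx|exact: hy].
by have [_ _ YZ] := Ys; apply: YZ; exact: hx.
Qed.

Lemma coinv_in H g m : H g -> coinv H (rho g m - m).
Proof. by move=> Hg Y _ YH; exact: YH. Qed.

Definition Qgrp g := exists b d, d != 0 /\ g = mx2 1 b 0 d.
Definition Q2grp g := exists c b, c != 0 /\ g = mx2 c b 0 1.

(** The largest stable subspace inside a proper subspace is 0 by irreducibility. *)
Lemma core_zero (Y : E -> Prop) x1 : subspace Y -> ~ Y x1 ->
  forall y, (forall g, GL g -> Y (rho g y)) -> y = 0.
Proof.
move=> Ysub nY; have [Y0 YD YZ] := Ysub.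
case: (rhoI.2 (fun y => forall g, GL g -> Y (rho g y))) => // [|h y hh hy g hg|h].
- split=> [g hg|x y hx hy g hg|a x hx g hg].
  + by rewrite (rho0 rhoR).
  + by rewrite (rhoD rhoR) //; apply: YD; [exact: hx|exact: hy].
  + by rewrite (rhoZ rhoR) //; apply: YZ; exact: hx.
- by rewrite -(rhoM rhoR) //; apply: hy; exact: GLM.
- by case: nY; rewrite -(rho1 rhoR x1); apply: h; exact: GL1.
Qed.

(* If [coinv Qgrp] is proper, [fix_up_ex] at a vector of it yields a vector whose [GL]-orbit stays in a proper
   subspace, hence zero, so [coinv Qgrp] is contained in [coinv Q2grp]; then the Borel subgroup acts trivially
   modulo [coinv Q2grp] and [fix_up_ex] yields a fixed vector. *)
Lemma coinv_fixed x1 x2 : ~ coinv Qgrp x1 -> ~ coinv Q2grp x2 ->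
  exists2 y, y != 0 & forall g, GL g -> rho g y = y.
Proof.
move=> n1 n2; have o0 := oner_neq0 (lfF K).
have YQ := coinv_sub Qgrp; have YQ2 := coinv_sub Q2grp.
have triv b d m : d != 0 -> coinv Qgrp (rho (mx2 1 b 0 d) m - m).
  by move=> d0; apply: coinv_in; exists b, d.
have triv2 b c m : c != 0 -> coinv Q2grp (rho (mx2 c b 0 1) m - m).
  by move=> c0; apply: coinv_in; exists c, b.
(* The Borel subgroup normalizes Q. *)
have stab a b d x : a != 0 -> d != 0 -> coinv Qgrp x -> coinv Qgrp (rho (mx2 a b 0 d) x).
  move=> a0 d0 hx; have gb : GL (mx2 a b 0 d) by exact: GL_up.
  apply: (hx (fun x => coinv Qgrp (rho (mx2 a b 0 d) x))) => [|g m [b' [d' [d'0 eg]]]].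
    have [Y0 YD YZ] := YQ; split=> [|x' y' hx' hy'|c x' hx'].
    - by rewrite (rho0 rhoR).
    - by rewrite (rhoD rhoR) //; exact: YD.
    - by rewrite (rhoZ rhoR) //; exact: YZ.
  have gg : GL g by rewrite eg; exact: GL_up.
  rewrite (rhoB rhoR) // -(rhoM rhoR) //.
  have -> : mx2 a b 0 d *m g = mx2 1 ((a * b' + b * d' - b) / d) 0 d' *m mx2 a b 0 d.
    by rewrite eg !mx2_mul; congr mx2; field.
  by rewrite (rhoM rhoR) //; [exact: triv|exact: GL_up].
have sub12 l : coinv Qgrp l -> coinv Q2grp l.
  move=> hl; have [y [c0 [c00 h1 h2]]] := fix_up_ex l.
  have y0 : y = 0.
    apply: (core_zero YQ n1) => g hg; rewrite -(subrK (c0 *: l) (rho g y)).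
    have [_ YD YZ] := YQ; apply: (YD); last exact: (YZ).
    apply: h1 => // a b d a0 d0; rewrite -scaleN1r; apply: (YD); last exact: (YZ).
    exact: stab.
  have := h2 _ YQ2 triv2; rewrite y0 sub0r => h.
  have [_ _ YZ] := YQ2; have := YZ (- c0^-1) _ h.
  by rewrite scalerN scaleNr opprK scalerA mulVf // scale1r.
have [y [c0 [c00 h1 _]]] := fix_up_ex x2.
have hy := h1 _ YQ2 (fun b d m d0 => sub12 _ (triv b d m d0)).
have {}hy : forall g, GL g -> coinv Q2grp (rho g y - c0 *: x2).
  apply: hy => a b d a0 d0; rewrite -/(eqm (coinv Q2grp) _ _).
  (* The first factor is in Q and the second in Q2, so both act trivially modulo [coinv Q2grp]. *)
  have -> : mx2 a b 0 d = mx2 1 b 0 d *m mx2 a 0 0 1 by rewrite mx2_mul; congr mx2; ring.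
  rewrite (rhoM rhoR); [|exact: GL_up|exact: GL_up].
  apply: (eqm_trans YQ2 (y := rho (mx2 a 0 0 1) x2)); last exact: triv2.
  by rewrite /eqm; apply: sub12; exact: triv.
exists y.
  apply: contra_notN n2 => /eqP y0; have := hy _ (GL1 K); rewrite y0 (rho0 rhoR) ?sub0r; last exact: GL1.
  have [_ _ YZ] := YQ2 => /(YZ (- c0^-1)).
  by rewrite scalerN scaleNr opprK scalerA mulVf // scale1r.
move=> h hh; apply/eqP; rewrite -subr_eq0; apply/eqP.
apply: (core_zero YQ2 n2) => g hg; rewrite (rhoB rhoR) // -(rhoM rhoR) //.
rewrite -(subrKA (c0 *: x2)) -[X in _ + X]opprB; have [_ YD _] := YQ2.
apply: YD; first by apply: hy; exact: GLM.
by apply: (subspaceN YQ2); exact: hy.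
Qed.

End Coinvariants.

(** * Invariant bilinear maps *)

Section GroupFunctions.
Variables (C : numClosedFieldType) (K : lfield).
Local Notation v := (@lfv K).
Local Notation q := (lfq K).
Local Notation M2 := 'M[lfF K]_2.
Local Notation fn := (M2 -> C).
Local Notation qp := (@qp C K).
Local Notation SW := (@SW C K).
Local Notation SG := (@SG C K).
Local Notation weil g1 g2 f := (@weil_act C K v q 2 2 g1 g2 f).
Implicit Types (N n : int) (M X Y g h k : M2) (f : fn).

Lemma SG_unit N : 0 < N -> SG (box 1%:M N).
Proof.
move=> N0; split; first exact: SW_box.
exists 0 => M; rewrite /box pnatr_eq0 eqb0 negbK => /(mge_congr N0) hM.
by rewrite (Kz_vdet hM); split=> //; apply: GL_det; case: hM.
Qed.

Lemma box1_congrR N M k : 0 < N -> congr_sub v N k -> box 1%:M N (M *m k) = box 1%:M N M :> C.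
Proof.
move=> N0 hk; have kz := congr_Kz N0 hk; have /congrP hk1 := hk.
have k1 := hk1 N0.
rewrite -[LHS](congr1 (fun f : fn => f (M *m k)) (@box_eq C K k 1%:M N k1)).
rewrite /box; congr (_%:R); congr nat_of_bool.
by rewrite -[RHS](Kz_mgeR _ _ kz) mulmxBl mul1mx.
Qed.

Lemma box1_weil N k : 0 < N -> congr_sub v N k -> weil k 1%:M (box 1%:M N) = box 1%:M N.
Proof.
move=> N0 hk; have kz := congr_Kz N0 hk; have /congrP hk1 := hk.
apply/funext => M; rewrite weilE (Kz_vdet kz) vd1 subr0 qp0 mul1r mulmx1.
rewrite -[RHS](congr1 (fun f : fn => f M) (@box_eq C K k 1%:M N (hk1 N0))).
rewrite /box; congr (_%:R); congr nat_of_bool.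
rewrite -(Kz_mgeL _ _ kz) mulmxBr mulmx1 mulKVmx //; by case: kz.
Qed.

(** The support is compact in $GL_2$, hence covered by finitely many cosets $X K_N$, which are
    subtracted one by one. Every large N is allowed, so that N can be chosen after a vector is
    given. *)
Lemma SG_indL (P : fn -> Prop) f : P fn0 ->
  (forall (x : C) f f2, SW f -> SW f2 -> P f -> P f2 -> P (sch_lin x f f2)) -> SG f ->
  exists N0 : int, 0 < N0 /\ forall N, N0 <= N ->
    (forall h, GL h -> P (weil h 1%:M (box 1%:M N))) -> P f.
Proof.
move=> P0 Pl [/schwartzP[a [b hf]] [D hD]].
exists (Num.max 1 (b - a)); split=> [|N hN PN]; first lia.
have N0 : 0 < N by lia.
(* Induction on a list of representatives of the cosets that meet the support; singular members are
   dropped. *)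
have cov (s : seq M2) : forall f, SG f ->
    (forall M k, congr_sub v N k -> f (M *m k) = f M) ->
    (forall M, f M != 0 -> exists X, [/\ X \in s, GL X & congr_sub v N (invmx X *m M)]) -> P f.
  elim: s => [|X s IH] {hf hD} {}f hf finv fs.
    rewrite (_ : f = fn0) //; apply/funext => M; apply/eqP/negPn/negP => /fs.
    by case=> X [].
  case: (pselect (GL X)) => hX; last first.
    apply: IH => // M /fs[Y []]; rewrite inE => /orP[/eqP ->|sY] hY hc; first by case: hX.
    by exists Y.
  pose g := weil X 1%:M (box 1%:M N).
  have gE M : g M = qp (vd X) * box 1%:M N (invmx X *m M).
    by rewrite /g weilE vd1 subr0 mulmx1.
  have gSG : SG g by apply: SG_weil => //; [exact: GL1|exact: SG_unit].
  pose c := f X * qp (- vd X).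
  pose f' := sch_lin (- c) g f.
  have f'SG : SG f' by exact: SG_lin.
  rewrite (_ : f = sch_lin c g f'); last first.
    by apply/funext => M; rewrite /f' /sch_lin mulNr addNKr.
  apply: Pl => //; [by case: gSG|by case: f'SG|exact: PN|].
  apply: IH => // [M k hk|M].
    by rewrite /f' /sch_lin !gE finv // mulmxA box1_congrR.
  rewrite /f' /sch_lin gE /box; case: (boolP (mge _ _)) => hM.
    rewrite mulr1 /c mulNr -mulrA -qpD addNr qp0 mulr1.
    have -> : f M = f X.
      by rewrite -{1}(mulKVmx hX M) finv //; exact/(congrP _ N0).
    by rewrite addNr eqxx.
  rewrite mulr0 mulr0 add0r => /fs[Y []]; rewrite inE => /orP[/eqP ->|sY] hY hc.
    by case/negP: hM; apply/(congrP _ N0).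
  by exists Y.
(* The inverse of X has entries in $p^{a-D}$, so a difference in $p^{N-a+D}$ gives $X^{-1}M \in
   K_N$. *)
pose j := absz (Num.max (N - a + D) (Num.max b a) - a)%R.
have hf' : sch a (a + j%:Z) f by apply: sch_le hf; rewrite /j; lia.
have fSG : SG f by split; [apply/schwartzP; exists a, b|exists D].
apply: (cov [seq mrep a u | u <- enum (mI K j)]) => // [M k hk|M fM].
  by apply: (sch_congrR M hf N0 _ hk); lia.
have aM : mge a M by apply: contraNT fM => h; rewrite hf.1.
have [u hu] := mrep_surj j aM; set X := mrep a u in hu *.
have fX : f X != 0.
  by rewrite -(hf'.2 X (M - X) hu) addrC subrK.
have [dX vX] := hD _ fX; have hX := det_GL dX.
exists X; split=> //; first by apply: map_f; rewrite mem_enum.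
apply/(congrP _ N0); rewrite -(mulVmx hX) -mulmxBr.
have hi := mge_inv hX (mrep_in a u).
by apply: mgeM hi hu; rewrite /j; lia.
Qed.

Lemma weil_tr h f : GL h ->
  (fun M => weil h 1%:M f M^T) = weil 1%:M (invmx h)^T (fun M => f M^T).
Proof.
move=> hh; apply/funext => M; rewrite !weilE vd1 subr0 sub0r mulmx1.
have -> : vd (invmx h)^T = - vd h by rewrite -vdetV // /vd dt_tr.
rewrite opprK (invmx_uniq (mul1mx 1%:M)) mul1mx trmx_mul trmxK //.
Qed.

Lemma SG_tr f : SG f -> SG (fun M => f M^T).
Proof.
move=> [h1 [D h2]]; split; first exact: SW_tr.
by exists D => M /h2; rewrite /vd dt_tr.
Qed.

Lemma SG_indR (P : fn -> Prop) f : P fn0 ->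
  (forall (x : C) f f2, SW f -> SW f2 -> P f -> P f2 -> P (sch_lin x f f2)) -> SG f ->
  exists N0 : int, 0 < N0 /\ forall N, N0 <= N ->
    (forall h, GL h -> P (weil 1%:M h (box 1%:M N))) -> P f.
Proof.
move=> P0 Pl hf.
have trK f1 : (fun M => (fun M' => f1 M'^T) M^T) = f1 :> fn.
  by apply/funext => M; rewrite trmxK.
have [|N0 [N00 hN]] := @SG_indL (fun f1 => P (fun M => f1 M^T)) (fun M => f M^T) P0 _ (SG_tr hf).
  by move=> x f1 f2 h1 h2 p1 p2; apply: Pl => //; exact: SW_tr.
exists N0; split=> // N hNN hP; rewrite -(trK f); apply: (hN N) => // h hh.
rewrite weil_tr // (_ : (fun M => box 1%:M N M^T) = box 1%:M N); first exact/hP/GLtr.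
by apply/funext => M; rewrite /box -mge_tr linearB /= trmxK trmx1.
Qed.

(** $K_n$ is a disjoint union of cosets of $K_{n+j}$. *)
Lemma box1_decomp n (j : nat) : 0 < n -> box 1%:M n =
  fun M => \sum_(u : mI K j) 1 * weil (1%:M + mrep n u) 1%:M (box 1%:M (n + j%:Z)) M.
Proof.
move=> n0; apply/funext => M.
have h : sch n (n + j%:Z) (@box C K 0 n).
  by apply: (@sch_le _ _ n n); [exact: lexx|lia|apply: sch_box (mge0 _ _)].
have -> : box 1%:M n M = @box C K 0 n (M - 1%:M) by rewrite /box subr0.
rewrite {1}(sch_decomp h); apply: eq_bigr => u _.
have hc := Kz_1D n0 (mrep_in n u); have kz := congr_Kz n0 hc.
rewrite weilE (Kz_vdet kz) vd1 subr0 qp0 !mul1r mulmx1 /box subr0 mrep_in mul1r.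
congr (_%:R); congr nat_of_bool; rewrite -[RHS](Kz_mgeL _ _ kz) mulmxBr mulmx1 mulKVmx; last by case: kz.
by rewrite opprD addrA.
Qed.

End GroupFunctions.

(** * Reduction to functions supported in $GL_2$ *)

Section Bilinear.
Variables (C : numClosedFieldType) (K : lfield).
Local Notation v := (@lfv K).
Local Notation pi := (lfpi K).
Local Notation q := (lfq K).
Local Notation M2 := 'M[lfF K]_2.
Local Notation fn := (M2 -> C).
Local Notation qp := (@qp C K).
Local Notation SW := (@SW C K).
Local Notation SG := (@SG C K).
Local Notation weil g1 g2 f := (@weil_act C K v q 2 2 g1 g2 f).
Local Notation nu := (@nu K).
Local Notation nl := (@nl K).
Local Notation dg := (@dg K).
Local Notation tt := (@tt K).
Local Notation fE := (@fE C K).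
Local Notation fO := (@fO C K).
Variables (E : lmodType C) (rho : M2 -> E -> E).
Hypothesis rhoR : is_rep rho.
Hypothesis rhoS : smooth_rep v rho.
Variables (Th : lmodType C) (tact : M2 -> Th -> Th) (B : fn -> E -> Th).
Hypothesis Bl1 : forall a f1 f2 l, SW f1 -> SW f2 ->
  B (sch_lin a f1 f2) l = a *: B f1 l + B f2 l.
Hypothesis Bl2 : forall a f l1 l2, SW f -> B f (a *: l1 + l2) = a *: B f l1 + B f l2.
Hypothesis Binv : forall g f l, GL g -> SW f -> B (weil g 1%:M f) (rho g l) = B f l.
Hypothesis tlin : forall h, GL h -> lin_map (tact h).
Hypothesis tB : forall h f l, GL h -> SW f -> tact h (B f l) = B (weil 1%:M h f) l.
Implicit Types (N n : int) (M X Y g h k : M2) (f : fn) (l m : E).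

Lemma B_f0 l : B fn0 l = 0.
Proof.
have := Bl1 (-1) l (SW_0 C K) (SW_0 C K).
rewrite (_ : sch_lin _ _ _ = fn0); first by rewrite scaleN1r addNr.
by apply/funext => M; rewrite /sch_lin /fn0 mulr0 addr0.
Qed.

Lemma B_l0 f : SW f -> B f 0 = 0.
Proof.
by move=> hf; have := Bl2 (-1) 0 0 hf; rewrite scaler0 addr0 scaleN1r addNr.
Qed.

Lemma B_lZ a f l : SW f -> B f (a *: l) = a *: B f l.
Proof. by move=> hf; rewrite -[a *: l]addr0 Bl2 // B_l0 // addr0. Qed.

Lemma B_lD f l m : SW f -> B f (l + m) = B f l + B f m.
Proof. by move=> hf; rewrite -[l]scale1r Bl2 // !scale1r. Qed.

Lemma B_lB f l m : SW f -> B f (l - m) = B f l - B f m.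
Proof. by move=> hf; rewrite B_lD // -scaleN1r B_lZ // scaleN1r. Qed.

Lemma B_sum (I : Type) (s : seq I) (c : I -> C) (F : I -> fn) l : (forall i, SW (F i)) ->
  B (fun M => \sum_(i <- s) c i * F i M) l = \sum_(i <- s) c i *: B (F i) l.
Proof.
move=> h; elim: s => [|i s IH].
  rewrite big_nil -(B_f0 l); congr B; apply/funext => M; by rewrite big_nil.
rewrite big_cons -IH -Bl1 //; last exact: SW_sum.
by congr B; apply/funext => M; rewrite /sch_lin big_cons.
Qed.

Lemma B_weil g f l : GL g -> SW f -> B (weil g 1%:M f) l = B f (rho (invmx g) l).
Proof. by move=> hg hf; rewrite -{1}(rhoVK rhoR l hg) Binv. Qed.

Lemma B_weil2 g h f l : GL g -> GL h -> SW f ->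
  B (weil g h f) l = tact h (B f (rho (invmx g) l)).
Proof.
move=> hg hh hf; rewrite -B_weil // tB //; last exact: SW_weil (GL1 K) hf.
by rewrite weilM //; [rewrite mul1mx mulmx1|exact: GL1|exact: GL1].
Qed.

(** The span of the values of B on functions supported in $GL_2$. *)
Definition WG (x : Th) : Prop := forall Y : Th -> Prop, subspace Y ->
  (forall f l, SG f -> Y (B f l)) -> Y x.

Lemma WG_sub : subspace WG.
Proof.
split=> [Y [Y0 _ _] _|x y hx hy Y Ys YH|a x hx Y Ys YH]; first exact: Y0.
  by have [_ YD _] := Ys; apply: YD; [exact: hx|exact: hy].
by have [_ _ YZ] := Ys; apply: YZ; exact: hx.
Qed.

Lemma WG_in f l : SG f -> WG (B f l).
Proof. by move=> hf Y _ h; exact: h. Qed.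

Lemma tact0 h : GL h -> tact h 0 = 0.
Proof. by move=> hh; have := tlin hh (-1) 0 0; rewrite scaler0 addr0 scaleN1r addNr. Qed.

Lemma WG_tact h x : GL h -> WG x -> WG (tact h x).
Proof.
move=> hh hx; have [W0 WD WZ] := WG_sub.
apply: (hx (fun x => WG (tact h x))) => [|f l hf].
  split=> [|x1 y1 h1 h2|a x1 h1]; first by rewrite tact0.
    by rewrite -[x1]scale1r tlin // scale1r; exact: WD.
  by rewrite -[a *: x1]addr0 tlin // tact0 // addr0; exact: WZ.
rewrite tB //; last by case: hf.
by apply: WG_in; apply: SG_weil => //; exact: GL1.
Qed.

Local Notation eqW := (eqm WG).

(** In [fE_decomp] the unipotent part of each [gz n u] lies in $K_n$ and fixes m, so all q
    translates contribute the same value. *)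
Lemma fE_step n m : 0 < n -> fixed rho n m -> eqW (B (fE n) m) (B (fE n) (rho (invmx tt) m)).
Proof.
move=> n0 hm; rewrite {1}fE_decomp.
have hs : forall u, SW (weil (gz n u) 1%:M (fE n)).
  by move=> u; apply: SW_weil; [exact: GL_gz|exact: GL1|exact: SW_fE].
rewrite Bl1; [|by case: (sE_SG C K n0)|exact: SW_sum].
rewrite B_sum // scale1r.
rewrite (eq_bigr (fun=> q%:R^-1 *: B (fE n) (rho (invmx tt) m))) => [|u _].
  rewrite sumr_const card_digI expn1 -scaler_nat scalerA divff ?q_neq0 // scale1r.
  by rewrite /eqm addrK; apply: WG_in; exact: sE_SG.
rewrite B_weil //; [|exact: GL_gz|exact: SW_fE].
congr (_ *: B _ _); rewrite /gz invmxM; [|exact: GL_nl|exact: GL_tt].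
rewrite (rhoM rhoR); [|exact/GLV/GL_tt|exact/GLV/GL_nl]; congr (rho _ _).
apply: hm; rewrite nlV; apply/(congrP _ n0).
by rewrite mx2_1 /nl mx2_sub mge_mx2 !subrr !subr0 !vge0 vgeN zr_vge.
Qed.

(** Only large n are asked for, because [fE_step] applies only from the level of the vector on. *)
Definition evW m : Prop := exists n0 : nat, forall n, 0 < n -> n0%:Z <= n -> WG (B (fE n) m).

Lemma evW_sub : subspace evW.
Proof.
have [W0 WD WZ] := WG_sub; split=> [|x y [n1 h1] [n2 h2]|a x [n1 h1]].
- by exists 0%N => n _ _; rewrite B_l0 //; exact: SW_fE.
- exists (maxn n1 n2) => n n0 hn; rewrite B_lD; last exact: SW_fE.
  by apply: WD; [apply: h1|apply: h2] => //; lia.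
- by exists n1 => n n0 hn; rewrite B_lZ; [apply: WZ; exact: h1|exact: SW_fE].
Qed.

Definition evinv g : Prop := GL g /\ forall m, evW (rho g m - m).

Lemma evinvM g h : evinv g -> evinv h -> evinv (g *m h).
Proof.
move=> [hg g1] [hh h1]; split=> [|m]; first exact: GLM.
rewrite (rhoM rhoR) // -(subrKA (rho h m)); have [_ WD _] := evW_sub.
by apply: WD; [exact: g1|exact: h1].
Qed.

Lemma evinvV g : evinv g -> evinv (invmx g).
Proof.
move=> [hg g1]; split=> [|m]; first exact: GLV.
rewrite -opprB; apply: (subspaceN evW_sub).
by rewrite -{1}(rhoVK rhoR m hg); exact: g1.
Qed.

Lemma evinv_exact g : GL g -> (forall n, weil g 1%:M (fE n) = fE n) -> evinv g.
Proof.
move=> hg h; split=> // m; exists 0%N => n n0 _; have hE := SW_fE C K n.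
rewrite B_lB // -{1}(h n) Binv // subrr; by case: WG_sub.
Qed.

Lemma evinv_tt : evinv tt.
Proof.
rewrite -(invmxK tt); apply: evinvV; split=> [|m]; first exact/GLV/GL_tt.
have [N [N0 hN]] := rhoS m; exists `|N|%N => n n0 hn.
have hE := SW_fE C K n; rewrite B_lB //; apply: (eqm_sym WG_sub).
by apply: fE_step => //; apply: fixed_le hN; lia.
Qed.

Lemma evinv_dg (k : int) : evinv (dg 1 (pi ^ k)).
Proof.
have o0 := oner_neq0 (lfF K).
have nat_case (i : nat) : evinv (dg 1 (pi ^ i%:Z)).
  elim: i => [|i IH].
    rewrite expr0z; apply: evinv_exact => [|n]; first exact: GL_dg.
    by apply: fE_dg; rewrite ?v1.
  have -> : dg 1 (pi ^ i.+1%:Z) = tt *m dg 1 (pi ^ i%:Z).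
    by rewrite /tt /dg mx2_mul -!exprnP exprS; congr mx2; ring.
  by apply: evinvM => //; exact: evinv_tt.
case: k => i; first exact: nat_case.
have -> : dg 1 (pi ^ Negz i) = invmx (dg 1 (pi ^ i.+1%:Z)).
  by rewrite dgV ?piX_neq0 // invr1 invr_expz NegzE.
exact/evinvV/nat_case.
Qed.

(** Q is generated by [tt], the units [dg 1 d] and the integral [nu x]: the latter two fix [fE n],
    and conjugation by powers of [tt] reaches every [nu x]. *)
Lemma evinv_Q g : Qgrp g -> evinv g.
Proof.
move=> [b [d [d0 ->]]]; have o0 := oner_neq0 (lfF K).
have hd : evinv (dg 1 d).
  pose p := pi ^ v d; have p0 : p != 0 by exact: piX_neq0.
  have -> : dg 1 d = dg 1 (pi ^ v d) *m dg 1 (d / p).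
    by rewrite /dg mx2_mul -/p; congr mx2; field.
  apply: evinvM; first exact: evinv_dg.
  have vu : v (d / p) = 0 by rewrite lf_vM ?invr_eq0 // vV // vpiX subrr.
  have u0 : d / p != 0 by rewrite mulf_neq0 ?invr_eq0.
  by apply: evinv_exact => [|n]; [exact: GL_dg|exact: fE_dg].
have hn x : evinv (nu x).
  have [N hN] := vge_ex x; have p0 := piX_neq0 K (- N).
  have -> : nu x = dg 1 (pi ^ - N) *m nu (x * pi ^ (- N)) *m invmx (dg 1 (pi ^ - N)).
    by rewrite dgV // /dg /nu !mx2_mul; congr mx2; field; rewrite ?o0 ?p0.
  apply: evinvM; last exact/evinvV/evinv_dg.
  apply: evinvM; first exact: evinv_dg.
  apply: evinv_exact => [|n]; first exact: GL_nu.
  by apply: fE_nu; rewrite mulrC vge_pi opprK add0r.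
have -> : mx2 1 b 0 d = nu (b / d) *m dg 1 d.
  by rewrite /nu /dg mx2_mul; congr mx2; field.
exact: evinvM.
Qed.

Hypothesis coQ : forall x, coinv rho (@Qgrp K) x.

Lemma evW_all m : evW m.
Proof.
apply: (coQ m evW_sub).
by move=> g x /evinv_Q[_]; exact.
Qed.

(** $GL_2(O)$ moves m through finitely many vectors, so one bound serves all of them. *)
Lemma evW_Kz m : exists n0 : nat, forall k, Kz k -> forall n, 0 < n -> n0%:Z <= n ->
  WG (B (fE n) (rho k m)).
Proof.
have [N [N0 hN]] := rhoS m; pose j : nat := `|N|%N.
have hj : fixed rho (0 + j%:Z) m by apply: fixed_le hN; rewrite /j; lia.
have /choice[nn hnn] (u : mI K j) : exists nu0 : nat, forall k, Kz k ->
    mge (0 + j%:Z) (k - mrep 0 u) -> forall n, 0 < n -> nu0%:Z <= n -> WG (B (fE n) (rho k m)).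
  case: (pselect (exists2 k, Kz k & mge (0 + j%:Z) (k - mrep 0 u))) => [[k hk hku]|nk].
    have [nu0 hnu0] := evW_all (rho k m); exists nu0 => k' hk' hk'u n n0 hn.
    rewrite (fixed_eq rhoR (N := 0 + j%:Z) (g := k)) //; first exact: hnu0.
      by rewrite /j; lia.
    by rewrite -(subrKA (mrep 0 u)) mgeD // mge_subC.
  by exists 0%N => k hk hku; case: nk; exists k.
exists (\max_u nn u) => k hk n n0 hn.
have [u hu] : exists u : mI K j, mge (0 + j%:Z) (k - mrep 0 u).
  by apply: mrep_surj; case: hk.
apply: (hnn u) => //; apply: le_trans hn.
by have := leq_bigmax (F := nn) u; lia.
Qed.

(** The translates of [fE n] that occur involve finitely many scalars $\pi^j$ and elements of
    $GL_2(O)$, so a single bound on n works. *)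
Lemma WG_nz f l (c : int) : SW f -> (forall M, mge c M -> f M = 0) -> WG (B f l).
Proof.
move=> /schwartzP[a [b hf]] fc; have [W0 WD WZ] := WG_sub.
have sjG (i : int) : GL ((pi ^ i)%:M : M2).
  by rewrite /GL unitmxE det_scalar unitfE expf_neq0 // piX_neq0.
pose r := absz (c - a)%R.
have /choice[nn hnn] (i : 'I_r) : exists n0 : nat, forall k, Kz k -> forall n, 0 < n -> n0%:Z <= n ->
    WG (B (fE n) (rho k (rho (invmx (pi ^ (a + (i : nat)%:Z))%:M) l))) by exact: evW_Kz.
pose n0 : int := (\max_i nn i).+1%:Z.
apply: (@SW_ind_nz C K (fun f => WG (B f l)) a b c n0 f) => //.
- move=> x f1 f2 h1 h2 w1 w2; rewrite Bl1 //; apply: WD => //; exact: WZ.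
- by move=> f1 h1; exact: WG_in.
move=> j k1 k2 n hk1 hk2 hj hn; have k1G : GL k1 by case: hk1.
rewrite B_weil2; [|exact: GL_piK|by case: hk2|exact: SW_fE].
apply: WG_tact; first by case: hk2.
rewrite -mul_scalar_mx invmxM // (rhoM rhoR); [|exact: GLV|exact: GLV].
have hi : (`|j - a|%N < r)%N by rewrite /r; lia.
have ej : a + (Ordinal hi : nat)%:Z = j by rewrite /=; lia.
have := hnn (Ordinal hi); rewrite ej; apply; [exact: KzV|by rewrite /n0 in hn; lia|].
have := leq_bigmax (F := nn) (Ordinal hi); rewrite /n0 in hn; lia.
Qed.

Hypothesis coG : forall x, forall Y : E -> Prop, subspace Y ->
  (forall g m, GL g -> Y (rho g m - qp (- vd g) *: m)) -> Y x.

Lemma SW_fO : SW fO. Proof. exact: SW_box. Qed.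

(** Near 0 the Weil action of g multiplies [fO] by $|\det g|^{-1}$, so $B(fO, \_)$ transforms by
    $|\det g|$ up to functions vanishing near 0, which [WG_nz] handles. *)
Lemma WG_fO l : WG (B fO l).
Proof.
have hO := SW_fO; have [W0 WD WZ] := WG_sub.
apply: (@coG l (fun l => WG (B fO l))) => [|g m hg].
  split=> [|x y hx hy|a x hx]; first by rewrite B_l0.
    by rewrite B_lD //; exact: WD.
  by rewrite B_lZ //; exact: WZ.
have hw : SW (weil g 1%:M fO) by apply: SW_weil => //; exact: GL1.
have -> : B fO (rho g m - qp (- vd g) *: m) =
    B (sch_lin (- qp (- vd g)) (weil g 1%:M fO) fO) (rho g m).
  by rewrite Bl1 // Binv // B_lB // B_lZ // scaleNr addrC.
have [N hN] := mge_ex (invmx g).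
apply: (@WG_nz _ _ (Num.max 0 (- N))); first exact: SW_lin.
move=> M hM; rewrite /sch_lin weilE vd1 subr0 mulrA mulNr -qpD addNr qp0 mulmx1 /fO /box !subr0.
rewrite (mge_le _ hM) ?(mgeM _ hN hM) //; first by rewrite mulN1r addNr.
  by lia.
by lia.
Qed.

Lemma WG_all f l : SW f -> WG (B f l).
Proof.
move=> hf; have /schwartzP[a [b hs]] := hf; have [W0 WD WZ] := WG_sub.
have hO := SW_fO.
(* After subtracting [f 0] times [fO], the function vanishes near 0. *)
have -> : f = sch_lin (f 0) fO (sch_lin (- f 0) fO f).
  by apply/funext => M; rewrite /sch_lin mulNr addNKr.
have hl : SW (sch_lin (- f 0) fO f) by exact: SW_lin.
rewrite Bl1 //; apply: WD; first by apply: WZ; exact: WG_fO.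
apply: (@WG_nz _ _ (Num.max 0 b)) => // M hM; rewrite /sch_lin /fO /box subr0.
rewrite (mge_le _ hM); last by lia.
rewrite -(add0r M) hs.2 ?mulr1 ?addNr //.
by apply: mge_le hM; lia.
Qed.

End Bilinear.

(** * Irreducibility when functions supported in $GL_2$ span the lift *)

Section Irreducibility.
Variables (C : numClosedFieldType) (K : lfield).
Local Notation v := (@lfv K).
Local Notation q := (lfq K).
Local Notation M2 := 'M[lfF K]_2.
Local Notation fn := (M2 -> C).
Local Notation SW := (@SW C K).
Local Notation SG := (@SG C K).
Local Notation weil g1 g2 f := (@weil_act C K v q 2 2 g1 g2 f).
Variables (E : lmodType C) (rho : M2 -> E -> E).
Hypothesis rhoR : is_rep rho.
Hypothesis rhoS : smooth_rep v rho.
Hypothesis rhoI : irreducible_rep rho.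
Variables (Th : lmodType C) (tact : M2 -> Th -> Th) (B : fn -> E -> Th).
Hypothesis Bl1 : forall a f1 f2 l, SW f1 -> SW f2 ->
  B (sch_lin a f1 f2) l = a *: B f1 l + B f2 l.
Hypothesis Bl2 : forall a f l1 l2, SW f -> B f (a *: l1 + l2) = a *: B f l1 + B f l2.
Hypothesis Binv : forall g f l, GL g -> SW f -> B (weil g 1%:M f) (rho g l) = B f l.
Hypothesis tB : forall h f l, GL h -> SW f -> tact h (B f l) = B (weil 1%:M h f) l.
Hypothesis WGall : forall x, WG B x.
Implicit Types (N n : int) (g h k : M2) (f : fn) (l m : E).

Let SWb N : SW (box 1%:M N). Proof. exact: SW_box. Qed.

(** The translating elements lie in $K_n$ and can be moved onto l, which they fix. *)
Lemma B_box_refine n (j : nat) l : 0 < n -> fixed rho n l ->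
  B (box 1%:M n) l = #|mI K j|%:R *: B (box 1%:M (n + j%:Z)) l.
Proof.
move=> n0 hl; have hk u := Kz_1D n0 (mrep_in n (u : mI K j)).
have kG u : GL (1%:M + mrep n (u : mI K j)) by case: (hk u).
rewrite (box1_decomp C K j n0) (B_sum Bl1) => [|u]; last by apply: SW_weil => //; exact: GL1.
rewrite (eq_bigr (fun=> B (box 1%:M (n + j%:Z)) l)) => [|u _].
  by rewrite sumr_const scaler_nat.
by rewrite scale1r (B_weil rhoR Binv) // hl //; exact: congrV.
Qed.

Lemma B_box_avg N l : 0 < N -> B (box 1%:M N) (Avg rhoS N l) = B (box 1%:M N) l.
Proof.
move=> N0; apply: (@Avg_inv C K E rho rhoS Th (B (box 1%:M N))) => // [a x y|k x hk].
  exact: Bl2.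
have kG : GL k by case: hk.
by rewrite -{1}(box1_weil C N0 hk) Binv.
Qed.

(** Sums collapse to one term: after refinement to a common N the vectors add, and a translate of
    the box can be moved onto the vector and averaged. *)
Lemma B_box_ex (w : Th) : exists N l, [/\ 0 < N, fixed rho N l & w = B (box 1%:M N) l].
Proof.
pose P (w : Th) := exists N l, [/\ 0 < N, fixed rho N l & w = B (box 1%:M N) l].
have refine w1 N l n : 0 < N -> N <= n -> fixed rho N l -> w1 = B (box 1%:M N) l ->
    exists2 l', fixed rho n l' & w1 = B (box 1%:M n) l'.
  move=> N0 hn hl ->; exists (#|mI K `|n - N|%N|%:R *: l).
    by apply: (fixedZ rhoR); apply: fixed_le hl.
  by rewrite (B_lZ Bl2) // (B_box_refine `|n - N|%N N0 hl); congr (_ *: B (box _ _) _); lia.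
have comb a w1 w2 : P w1 -> P w2 -> P (a *: w1 + w2).
  move=> [N1 [l1 [p1 f1 e1]]] [N2 [l2 [p2 f2 e2]]]; exists (Num.max N1 N2).
  have [|l1' f1' ->] := refine _ _ _ (Num.max N1 N2) p1 _ f1 e1; first by lia.
  have [|l2' f2' ->] := refine _ _ _ (Num.max N1 N2) p2 _ f2 e2; first by lia.
  by exists (a *: l1' + l2'); split; [lia|exact: (fixed_lin rhoR)|rewrite Bl2].
have P0 : P 0.
  by exists 1, 0; split; [|exact: (fixed0 rhoR)|rewrite (B_l0 Bl2)].
have/(_ P) := WGall w; apply => [|f l hf].
  split=> // [x y hx hy|a x hx]; first by rewrite -[x]scale1r; exact: comb.
  by rewrite -[a *: x]addr0; exact: comb.
have [|x f1 f2 h1 h2 p1 p2|N [N0 hN]] := @SG_indL C K (fun f => P (B f l)) f _ _ hf.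
- by rewrite (B_f0 Bl1).
- by rewrite Bl1 //; exact: comb.
apply: (hN N) => // h hh; rewrite (B_weil rhoR Binv) // -B_box_avg //.
by exists N, (Avg rhoS N (rho (invmx h) l)); split=> //; exact: (Avg_fixed rhoR).
Qed.

Lemma irreducible_of_span : (exists w : Th, w != 0) -> irreducible_rep tact.
Proof.
move=> Th0; split=> // W Wsub Wst; have [W0 WD WZ] := Wsub; have [_ irr] := rhoI.
case: (irr (fun l => forall f, SG f -> W (B f l))) => [|g l hg hl f hf|hW|hW].
- split=> [f [hf _]|l m hl hm f hf|a l hl f hf]; have [sf _] := (hf).
  + by rewrite (B_l0 Bl2).
  + by rewrite (B_lD Bl2) //; apply: WD; [exact: hl|exact: hm].
  + by rewrite (B_lZ Bl2) //; apply: WZ; exact: hl.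
- have [sf _] := hf; have gV := GLV hg.
  rewrite -{1}(invmxK g) -(B_weil rhoR Binv) //.
  by apply: hl; apply: SG_weil => //; exact: GL1.
- left=> w Ww; have [N [l [N0 fl ew]]] := B_box_ex w.
  suff l0 : l = 0 by rewrite ew l0 (B_l0 Bl2).
  apply: hW => f hf.
  (* This leaves right translates of a small box, whose values at l are images under [tact] of
     multiples of w. *)
  have [||N' [N'0 hN']] := @SG_indR C K (fun f => W (B f l)) f _ _ hf.
  + by rewrite (B_f0 Bl1).
  + by move=> x f1 f2 h1 h2 w1 w2; rewrite Bl1 //; apply: WD => //; exact: WZ.
  pose j := `|N' - N|%N; apply: (hN' (N + j%:Z)) => [|h hh]; first by rewrite /j; lia.
  rewrite -tB //; apply: Wst => //.
  have := B_box_refine j N0 fl; rewrite -ew => e.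
  have /(congr1 (fun x => (#|mI K j|%:R : C)^-1 *: x)) := e.
  by rewrite scalerA mulVf ?card_mI_neq0 // scale1r => <-; exact: WZ.
- by right=> w; have/(_ W) := WGall w; apply=> // f l hf; exact: hW.
Qed.

End Irreducibility.
(** * Recurrent sequences and moments *)

Section Sequences.
Variable C : fieldType.
Implicit Types (a c : C) (P : {poly C}) (phi : int -> C) (k : int).

(** The operator $P(aT)$ for the shift $T$ of sequences. *)
Definition shiftop a P phi : int -> C := fun k => \sum_(i < size P) P`_i * a ^+ i * phi (k + (i : nat)%:Z).

Definition seq_closed (N : (int -> C) -> Prop) : Prop :=
  [/\ N (fun=> 0), (forall c phi phi', N phi -> N phi' -> N (fun k => c * phi k + phi' k)) &
      (forall phi, N phi -> N (fun k => phi (k + 1)))].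

Lemma seq_closed_sum (N : (int -> C) -> Prop) (I : Type) (s : seq I) (c : I -> C) (F : I -> int -> C) :
  seq_closed N -> (forall i, N (F i)) -> N (fun k => \sum_(i <- s) c i * F i k).
Proof.
move=> [N0 Nl _] hF; elim: s => [|i s IH].
  by rewrite (_ : (fun _ => _) = fun=> 0) //; apply/funext => k; rewrite big_nil.
rewrite (_ : (fun _ => _) = fun k => c i * F i k + \sum_(j <- s) c j * F j k); first exact: Nl.
by apply/funext => k; rewrite big_cons.
Qed.

(* Cayley-Hamilton: modulo [N], the shift acts on the [z i] through the matrix [A]. *)
Lemma shiftop_char_poly (N : (int -> C) -> Prop) (r : nat) (A : 'M[C]_r.+1) (z : 'I_r.+1 -> int -> C) a :
  seq_closed N -> (forall i, N (fun k => a * z i (k + 1) - \sum_j A i j * z j k)) ->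
  forall i, N (shiftop a (char_poly A) (z i)).
Proof.
move=> Ncl hz; have [N0 Nl Ns] := Ncl.
have pw (n : nat) i : N (fun k => a ^+ n * z i (k + n%:Z) - \sum_j (A ^+ n) i j * z j k).
  elim: n i => [|n IH] i.
    rewrite (_ : (fun _ => _) = fun=> 0) //; apply/funext => k.
    rewrite !expr0 mul1r addr0 (bigD1 i) //= mxE eqxx mul1r big1 ?addr0 ?subrr // => j ji.
    by rewrite mxE eq_sym (negPf ji) mul0r.
  have h2 := seq_closed_sum (index_enum 'I_r.+1) ((A ^+ n) i) Ncl hz.
  move: (Nl a _ _ (Ns _ (IH i)) h2); congr N; apply/funext => k.
  rewrite mulrBr mulrA -exprS (_ : k + 1 + n%:Z = k + n.+1%:Z); last by lia.
  rewrite -addrA; congr (_ + _); rewrite mulr_sumr -sumrN -big_split /=.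
  rewrite exprSr.
  transitivity (- \sum_j \sum_l (A ^+ n) i j * A j l * z l k).
    rewrite -sumrN; apply: eq_bigr => j _; rewrite mulrBr addrA [X in - X + _](_ : _ = (A ^+ n) i j * (a * z j (k + 1))).
      by rewrite addNr sub0r mulr_sumr; congr (- _); apply: eq_bigr => l _; rewrite mulrA.
    by ring.
  rewrite exchange_big /=; congr (- _); apply: eq_bigr => l _.
  by rewrite [(A ^+ n * A) i l]mxE mulr_suml.
move=> i; set P := char_poly A.
have h := seq_closed_sum (index_enum 'I_(size P)) (fun n => P`_n) Ncl (fun n => pw n i).
move: h; congr N; apply/funext => k; rewrite /shiftop.
under eq_bigr do rewrite mulrBr mulrA.
rewrite sumrB [X in _ - X](_ : _ = 0) ?subr0 //.
transitivity (\sum_j (\sum_(n < size P) P`_n *: A ^+ n) i j * z j k).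
  under [LHS]eq_bigr do rewrite mulr_sumr.
  rewrite exchange_big /=; apply: eq_bigr => j _.
  by rewrite summxE mulr_suml; apply: eq_bigr => n _; rewrite mxE mulrA.
have -> : \sum_(n < size P) P`_n *: A ^+ n = horner_mx A P.
  rewrite -[in RHS](coefK P) poly_def rmorph_sum; apply: eq_bigr => n _.
  by rewrite /= linearZ /= rmorphXn /= horner_mx_X.
by rewrite Cayley_Hamilton big1 // => j _; rewrite mxE mul0r.
Qed.

Lemma shiftop_lin a P c phi phi' : shiftop a P (fun k => c * phi k + phi' k) =
  fun k => c * shiftop a P phi k + shiftop a P phi' k.
Proof.
apply/funext => k; rewrite /shiftop mulr_sumr -big_split; apply: eq_bigr => i _ /=.
by ring.
Qed.

Lemma shiftop_shift a P phi m : shiftop a P (fun k => phi (k + m)) = fun k => shiftop a P phi (k + m).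
Proof. by apply/funext => k; apply: eq_bigr => i _; rewrite addrAC. Qed.

Definition evzero phi : Prop := exists r : int, forall k, r <= k -> phi k = 0.

Lemma evzero_closed : seq_closed evzero.
Proof.
split=> [|c phi phi' [r hr] [r' hr']|phi [r hr]]; first by exists 0.
- by exists (Num.max r r') => k hk; rewrite hr ?hr' ?mulr0 ?addr0 //; lia.
- by exists r => k hk; rewrite hr //; lia.
Qed.

Lemma evzero_shift phi m : evzero phi -> evzero (fun k => phi (k + m)).
Proof. by move=> [r hr]; exists (r - m) => k hk; apply: hr; lia. Qed.

Lemma seq_closed_shiftop N a P : seq_closed N -> seq_closed (fun phi => N (shiftop a P phi)).
Proof.
move=> [N0 Nl Ns]; split=> [|c phi phi' h h'|phi h].
- rewrite (_ : shiftop a P _ = fun=> 0) //; apply/funext => k.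
  by rewrite /shiftop big1 // => i _; rewrite mulr0.
- by rewrite shiftop_lin; exact: Nl.
- by rewrite (shiftop_shift _ _ _ 1); exact: Ns.
Qed.

Lemma evzero_shiftop a P phi : evzero phi -> evzero (shiftop a P phi).
Proof.
move=> [r hr]; exists r => k hk; rewrite /shiftop big1 // => i _.
by rewrite hr ?mulr0 //; lia.
Qed.

Lemma shiftopC a a' P P' phi : shiftop a P (shiftop a' P' phi) = shiftop a' P' (shiftop a P phi).
Proof.
apply/funext => k; rewrite /shiftop.
under eq_bigr do rewrite mulr_sumr.
rewrite exchange_big /=; apply: eq_bigr => i _; rewrite mulr_sumr.
by apply: eq_bigr => j _; rewrite [k + (j : nat)%:Z + _]addrAC; ring.
Qed.

Definition lowest k0 phi : Prop := phi k0 != 0 /\ forall k, k < k0 -> phi k = 0.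

(** Only the leading coefficient of P reaches the new lowest index. Clearing denominators therefore
    never produces the zero sequence from one with a lowest term. *)
Lemma shiftop_lowest a P phi k0 : a != 0 -> P \is monic -> lowest k0 phi ->
  lowest (k0 - (size P).-1%:Z) (shiftop a P phi).
Proof.
move=> a0 mP [h1 h2]; have sP : (0 < size P)%N by rewrite size_poly_gt0 monic_neq0.
split=> [|k hk]; last first.
  rewrite /shiftop big1 // => i _; rewrite h2 ?mulr0 //.
  by have := ltn_ord i; lia.
have hi : ((size P).-1 < size P)%N by lia.
have far (m n : nat) : (m < n)%N -> m != n.-1 -> k0 - n.-1%:Z + m%:Z < k0 by lia.
rewrite /shiftop (bigD1 (Ordinal hi)) //= big1 ?addr0.
  by rewrite subrK -/(lead_coef P) (monicP mP) mul1r mulf_neq0 // expf_neq0.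
by move=> i ne; rewrite h2 ?mulr0 //; apply: far.
Qed.

End Sequences.

(** * Moments of finitely supported sequences *)

Section Moments.
Variable C : numFieldType.
Implicit Types (c : C) (phi : int -> C) (a k d : int) (n m : nat).

Definition window a n phi : Prop := forall k, ~~ (a <= k < a + n%:Z) -> phi k = 0.

Definition finsupp phi : Prop := exists a n, window a n phi.

Lemma window_le a n a' n' phi : a' <= a -> a + n%:Z <= a' + n'%:Z -> window a n phi -> window a' n' phi.
Proof. by move=> h1 h2 h k hk; apply: h; apply: contra hk => /andP[? ?]; lia. Qed.

Lemma window_sum a n phi i j : window a n phi ->
  \sum_(t < i + n + j) phi (a - i%:Z + (t : nat)%:Z) = \sum_(t < n) phi (a + (t : nat)%:Z).
Proof.
move=> h; rewrite !big_split_ord /= [X in _ + X]big1 ?addr0 => [|t _].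
  rewrite big1 ?add0r => [|t _]; first by apply: eq_bigr => t _; congr phi; lia.
  by apply: h; have := ltn_ord t; lia.
by apply: h; lia.
Qed.

Lemma window_sum_eq a n a' n' phi : window a n phi -> window a' n' phi ->
  \sum_(t < n) phi (a + (t : nat)%:Z) = \sum_(t < n') phi (a' + (t : nat)%:Z).
Proof.
have main a1 n1 a2 n2 : window a1 n1 phi -> a2 <= a1 -> a1 + n1%:Z <= a2 + n2%:Z ->
    \sum_(t < n1) phi (a1 + (t : nat)%:Z) = \sum_(t < n2) phi (a2 + (t : nat)%:Z).
  move=> h h1 h2; rewrite -(window_sum (absz (a1 - a2)%R) (absz (a2 + n2%:Z - (a1 + n1%:Z))%R) h).
  have en : (absz (a1 - a2)%R + n1 + absz (a2 + n2%:Z - (a1 + n1%:Z))%R)%N = n2 by lia.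
  by rewrite en; apply: eq_bigr => t _; congr phi; lia.
move=> h h'; pose b := Num.min a a'.
pose e := absz (Num.max (a + n%:Z) (a' + n'%:Z) - b)%R.
rewrite (main _ _ b e h); [|by rewrite /b; lia|by rewrite /e /b; lia].
by rewrite (main _ _ b e h') // /e /b; lia.
Qed.

(** The sum over all integers, computed on any window containing the support; 0 is a default value
    without finite support. *)
Definition fsum phi : C :=
  if pselect (exists p : int * nat, window p.1 p.2 phi) is left h
  then let p := sval (cid h) in \sum_(t < p.2) phi (p.1 + (t : nat)%:Z) else 0.

Lemma fsumE a n phi : window a n phi -> fsum phi = \sum_(t < n) phi (a + (t : nat)%:Z).
Proof.
move=> h; rewrite /fsum; case: pselect => [h'|]; last by case; exists (a, n).
by apply: window_sum_eq => //; exact: (svalP (cid h')).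
Qed.

Lemma window_common phi phi' : finsupp phi -> finsupp phi' ->
  exists a n, window a n phi /\ window a n phi'.
Proof.
move=> [a [n h]] [a' [n' h']]; pose b := Num.min a a'.
exists b; exists (absz (Num.max (a + n%:Z) (a' + n'%:Z) - b)%R).
by split; [apply: window_le h|apply: window_le h']; rewrite /b; lia.
Qed.

Lemma fsum_lin c phi phi' : finsupp phi -> finsupp phi' ->
  fsum (fun k => c * phi k + phi' k) = c * fsum phi + fsum phi'.
Proof.
move=> h h'; have [a [n [w w']]] := window_common h h'.
rewrite (fsumE w) (fsumE w') (@fsumE a n) => [|k hk]; last by rewrite w ?w' // mulr0 addr0.
by rewrite mulr_sumr -big_split.
Qed.

Lemma fsum_shift phi d : finsupp phi -> fsum (fun k => phi (k - d)) = fsum phi.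
Proof.
move=> [a [n w]]; rewrite (fsumE w) (@fsumE (a + d) n) => [|k hk].
  by apply: eq_bigr => t _; congr phi; lia.
by apply: w; apply: contra hk => /andP[? ?]; lia.
Qed.

(** The value at t = 1 of $(t\, d/dt)^m \sum_k \phi(k) t^k$. *)
Definition moment m phi : C := fsum (fun k => k%:~R ^+ m * phi k).

Lemma finsupp_mul (p : int -> C) phi : finsupp phi -> finsupp (fun k => p k * phi k).
Proof. by move=> [a [n w]]; exists a, n => k hk; rewrite w ?mulr0. Qed.

Lemma moment_lin m c phi phi' : finsupp phi -> finsupp phi' ->
  moment m (fun k => c * phi k + phi' k) = c * moment m phi + moment m phi'.
Proof.
move=> h h'; rewrite /moment -fsum_lin; try exact: finsupp_mul.
by congr fsum; apply/funext => k; ring.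
Qed.

(** In the binomial expansion of $(k+d)^m$ all terms but $k^m$ give lower moments. *)
Lemma moment_shift m phi d : finsupp phi -> (forall i, (i < m)%N -> moment i phi = 0) ->
  moment m (fun k => phi (k - d)) = moment m phi.
Proof.
move=> h hm; have [a [n w]] := h.
have w' i : window a n (fun k => k%:~R ^+ i * phi k) by move=> k hk; rewrite w ?mulr0.
rewrite /moment -(fsum_shift (- d)); last first.
  by apply: (finsupp_mul (fun k => k%:~R ^+ m)); exists (a + d), n => k hk; apply: w; lia.
rewrite (_ : (fun k => _) = fun k => (k%:~R + d%:~R) ^+ m * phi k); last first.
  by apply/funext => k; rewrite opprK addrK intrD.
have wd : window a n (fun k => (k%:~R + d%:~R) ^+ m * phi k) by move=> k hk; rewrite w ?mulr0.
rewrite (fsumE wd) (fsumE (w' m)).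
under eq_bigr do rewrite addrC exprDn mulr_suml.
rewrite exchange_big /= big_ord_recr /= [X in _ + X](_ : _ = \sum_(t < n) (a + (t : nat)%:Z)%:~R ^+ m * phi (a + (t : nat)%:Z)).
  rewrite big1 ?add0r // => i _.
  transitivity ((d%:~R ^+ (m - i) *+ 'C(m, i)) * moment i phi); last by rewrite hm ?mulr0.
  by rewrite /moment (fsumE (w' i)) mulr_sumr; apply: eq_bigr => t _; rewrite !mulrnAl mulrA.
by apply: eq_bigr => t _; rewrite subnn expr0 mul1r binn mulr1n.
Qed.

(** Otherwise every polynomial sums to 0 against [phi]; one vanishing at all points of the window
    except [k0] gives a contradiction. *)
Lemma moment_neq0 phi : finsupp phi -> (exists k, phi k != 0) -> exists m, moment m phi != 0.
Proof.
move=> [a [n w]] [k0 hk0]; apply: contrapT => nm.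
have w' m : window a n (fun k => k%:~R ^+ m * phi k) by move=> k hk; rewrite w ?mulr0.
have hm m : moment m phi = 0 by apply/eqP/negP => /negP h; apply: nm; exists m.
have hp (p : {poly C}) : \sum_(t < n) p.[(a + (t : nat)%:Z)%:~R] * phi (a + (t : nat)%:Z) = 0.
  under eq_bigr do rewrite horner_coef mulr_suml.
  rewrite exchange_big /= big1 // => i _.
  transitivity (p`_i * moment i phi); last by rewrite hm mulr0.
  by rewrite /moment (fsumE (w' i)) mulr_sumr; apply: eq_bigr => t _; rewrite mulrA.
have ak : a <= k0 < a + n%:Z by apply: contraNT hk0 => /w ->.
have ht : (absz (k0 - a)%R < n)%N by lia.
have et : a + (absz (k0 - a)%R)%:Z = k0 by lia.
pose p : {poly C} := \prod_(t < n | t != Ordinal ht) ('X - ((a + (t : nat)%:Z)%:~R)%:P).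
have := hp p; rewrite (bigD1 (Ordinal ht)) //= big1 ?addr0 => [|t nt]; last first.
  rewrite /p horner_prod (bigD1 t) //= !hornerE subrr !mul0r //.
move/eqP; rewrite et mulf_eq0 (negPf hk0) orbF /p horner_prod => /prodf_eq0[t nt].
rewrite !hornerE subr_eq0 eqr_int => /eqP e; case/eqP: nt; apply: val_inj => /=; lia.
Qed.

Lemma leading_moment (T : Type) (c : T -> int -> C) : (forall t, finsupp (c t)) ->
  (exists t k, c t k != 0) ->
  exists m, (forall t i, (i < m)%N -> moment i (c t) = 0) /\ exists t, moment m (c t) != 0.
Proof.
move=> hc [t0 [k hk]]; pose P m := `[< exists t, moment m (c t) != 0 >].
have [|m hm] := moment_neq0 (hc t0); first by exists k.
have exP : exists m, P m by exists m; apply/asboolP; exists t0.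
case: (ex_minnP exP) => m0 /asboolP h0 min; exists m0; split=> // t i hi.
apply/eqP/negP => /negP h; have : P i by apply/asboolP; exists t.
by move/min; lia.
Qed.

End Moments.
(** * Zeta integrals *)

Section Zeta.
Variables (C : numClosedFieldType) (K : lfield).
Local Notation v := (@lfv K).
Local Notation q := (lfq K).
Local Notation M2 := 'M[lfF K]_2.
Local Notation fn := (M2 -> C).
Local Notation qp := (@qp C K).
Local Notation SW := (@SW C K).
Local Notation SG := (@SG C K).
Local Notation weil g1 g2 f := (@weil_act C K v q 2 2 g1 g2 f).
Variables (V : lmodType C) (act : M2 -> V -> V).
Local Notation E := (sdual act).
Hypothesis actR : is_rep act.
Hypothesis actS : smooth_rep v act.
Local Notation rho := (drho actR).
Implicit Types (g h M X Y : M2) (f : fn) (l : E) (x : V) (k a b N : int).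

Definition coefE l x k : fn := fun M => if (dt M != 0) && (vd M == k) then ev l (act M x) else 0.
Definition zfun f l x k : fn := fun M => f M * coefE l x k M.

(* The coefficient of [t ^ k] in the Godement-Jacquet zeta integral of [f] and of the matrix coefficient
   [ev l (act M x)]. *)
Definition Z f l x k : C := qp k * Int (zfun f l x k).

(** On bounded matrices of fixed determinant valuation the inverse is bounded, so a small additive
    change is right multiplication by $K_N$. *)
Lemma GL_add a k N M X : 0 < N -> mge a M -> dt M != 0 -> vd M = k -> mge (N - a + k) X ->
  exists2 u, congr_sub v N u & M + X = M *m u.
Proof.
move=> N0 hM M0 hk hX; have MG := det_GL M0.
exists (1%:M + invmx M *m X); last by rewrite mulmxDr mulmx1 mulKVmx.
apply: Kz_1D => //; apply: mgeM (mge_inv MG hM) hX; lia.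
Qed.

Lemma vd_congr N M u : 0 < N -> dt M != 0 -> congr_sub v N u -> dt (M *m u) != 0 /\ vd (M *m u) = vd M.
Proof.
move=> N0 M0 hu; have uK := congr_Kz N0 hu; have uG : GL u by case: uK.
split; first by rewrite dtM mulf_neq0 // GL_det.
by rewrite vdetM ?(Kz_vdet uK) ?addr0 //; exact: det_GL.
Qed.

(** Restricting to $v(\det M) = k$ makes the matrix coefficient uniformly locally constant on the
    support of f. *)
Lemma SW_zfun f l x k : SW f -> SW (zfun f l x k).
Proof.
move=> /schwartzP[a [b hf]]; have [N [N0 hx]] := actS x; have [h1 h2] := hf.
apply/schwartzP; exists a, (Num.max a (Num.max b (N - a + k))); split=> [M hM|M X hX].
  by rewrite /zfun h1 ?mul0r.
have Xb : mge b X by apply: mge_le hX; lia.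
have Xa : mge a X by apply: mge_le hX; lia.
have XN : mge (N - a + k) X by apply: mge_le hX; lia.
rewrite /zfun h2 //; case: (boolP (mge a M)) => hM; last by rewrite h1 // !mul0r.
congr (_ * _); rewrite /coefE; case: ifP => hc1; case: ifP => hc2 //.
- have /andP[M0 /eqP Mk] := hc2.
  have [u hu ->] := GL_add N0 hM M0 Mk XN; have uG : GL u by case: hu.
  by rewrite (rhoM actR) ?(hx u hu) //; exact: det_GL.
- have /andP[M0 /eqP Mk] := hc1.
  have [||u hu e] := @GL_add a k N (M + X) (- X) N0 _ M0 Mk; rewrite ?mgeN ?mgeD //.
  have [] := vd_congr N0 M0 hu; rewrite -e addrK => M0' Mk'.
  by rewrite M0' Mk' Mk eqxx in hc2.
- have /andP[M0 /eqP Mk] := hc2.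
  have [u hu e] := GL_add N0 hM M0 Mk XN.
  have [] := vd_congr N0 M0 hu; rewrite -e => M0' Mk'.
  by rewrite M0' Mk' Mk eqxx in hc1.
Qed.

Lemma Z_linf c f1 f2 l x k : SW f1 -> SW f2 -> Z (sch_lin c f1 f2) l x k = c * Z f1 l x k + Z f2 l x k.
Proof.
move=> h1 h2; rewrite /Z mulrCA -mulrDr -Int_lin; [|exact: SW_zfun|exact: SW_zfun].
by congr (_ * Int _); apply/funext => M; rewrite /zfun /sch_lin; ring.
Qed.

Lemma Z_linl c f l1 l2 x k : SW f -> Z f (c *: l1 + l2) x k = c * Z f l1 x k + Z f l2 x k.
Proof.
move=> hf; rewrite /Z mulrCA -mulrDr -Int_lin; [|exact: SW_zfun|exact: SW_zfun].
congr (_ * Int _); apply/funext => M; rewrite /zfun /sch_lin /coefE.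
by case: ifP => _; rewrite ?evD ?evZ; ring.
Qed.

Lemma Z_sumf (I : Type) (s : seq I) (c : I -> C) (F : I -> fn) l x k : (forall i, SW (F i)) ->
  Z (fun M => \sum_(i <- s) c i * F i M) l x k = \sum_(i <- s) c i * Z (F i) l x k.
Proof.
move=> hF; apply: (@B_sum C K E C^o (fun f l => Z f l x k)) => // a f1 f2 l'.
exact: Z_linf.
Qed.

Lemma Z_suml (I : Type) (s : seq I) (c : I -> C) (F : I -> E) f x k : SW f ->
  Z f (\sum_(i <- s) c i *: F i) x k = \sum_(i <- s) c i * Z f (F i) x k.
Proof.
move=> hf; elim: s => [|i s IH]; last by rewrite !big_cons Z_linl // IH.
rewrite !big_nil; have := Z_linl (-1) 0 0 x k hf.
by rewrite scaler0 addr0 mulN1r addNr.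
Qed.

(** The exponent $v(\det g)$ of the Weil factor and $-2 v(\det g)$ of the Jacobian turn [qp k] into
    [qp (k - vd g)]: the factor in [Z] is chosen so that a pure shift remains. *)
Lemma Z_weil g f l x k : GL g -> SW f -> Z (weil g 1%:M f) (rho g l) x k = Z f l x (k - vd g).
Proof.
move=> hg hf; have hgV := GLV hg; rewrite /Z.
pose F0 := zfun f l x (k - vd g); have hF0 : SW F0 by exact: SW_zfun.
have -> : zfun (weil g 1%:M f) (rho g l) x k = sch_lin (qp (vd g)) (fun M => F0 (invmx g *m M)) fn0.
  apply/funext => M; rewrite /sch_lin /fn0 addr0 /F0 /zfun weilE vd1 subr0 mulmx1 -mulrA.
  congr (_ * (_ * _)); rewrite /coefE dtM mulf_eq0 (negPf (GL_det hgV)) /=.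
  case: (eqVneq (dt M) 0) => //= M0; have MG := det_GL M0.
  rewrite vdetM // vdetV // (_ : (vd M == k) = (- vd g + vd M == k - vd g)); last by lia.
  by case: ifP => // _; rewrite drhoE // (rhoM actR).
rewrite Int_lin ?Int_0 ?addr0; [|exact: SW_mull|exact: SW_0].
by rewrite (Int_mull hgV) // !mulrA -!qpD vdetV //; congr (qp _ * _); lia.
Qed.

Lemma Z_weilR h f l x k : GL h -> SW f ->
  Z (weil 1%:M h f) l x k = Z f l (act (invmx h) x) (k + vd h).
Proof.
move=> hh hf; have hV := GLV hh; rewrite /Z.
pose F0 := zfun f l (act (invmx h) x) (k + vd h); have hF0 : SW F0 by exact: SW_zfun.
have -> : zfun (weil 1%:M h f) l x k = sch_lin (qp (- vd h)) (fun M => F0 (M *m h)) fn0.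
  apply/funext => M; rewrite /sch_lin /fn0 addr0 /F0 /zfun weilE vd1 sub0r.
  rewrite (invmx_uniq (mul1mx _)) mul1mx -mulrA.
  congr (_ * (_ * _)); rewrite /coefE dtM mulf_eq0 (negPf (GL_det hh)) orbF /=.
  case: (eqVneq (dt M) 0) => //= M0; have MG := det_GL M0.
  rewrite vdetM // (_ : (vd M == k) = (vd M + vd h == k + vd h)); last by lia.
  by case: ifP => // _; rewrite -(rhoM actR) // ?mulmxK //; exact: GLM.
rewrite Int_lin ?Int_0 ?addr0; [|exact: SW_mulr|exact: SW_0].
by rewrite (Int_mulr hh) // !mulrA -!qpD; congr (qp _ * _); lia.
Qed.

Lemma Z_supp f l x k : (forall M, f M != 0 -> dt M != 0 -> vd M != k) -> Z f l x k = 0.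
Proof.
move=> h; rewrite /Z (_ : zfun f l x k = fn0) ?Int_0 ?mulr0 //.
apply/funext => M; rewrite /zfun /coefE /fn0; have [->|f0] := eqVneq (f M) 0; first by rewrite mul0r.
by case: ifP; rewrite ?mulr0 // => /andP[M0]; rewrite (negPf (h M f0 M0)).
Qed.

Lemma Z_low f : SW f -> exists r : int, forall l x k, k < r -> Z f l x k = 0.
Proof.
move=> /schwartzP[a [b [h1 h2]]]; exists (a + a) => l x k hk; apply: Z_supp => M fM M0.
have /vge_det : mge a M by apply: contraNT fM => /h1 ->.
by rewrite vgeE // /vd => h; lia.
Qed.

Lemma Z_SG f l x : SG f -> evzero (Z f l x).
Proof.
move=> [hf [D hD]]; exists (D + 1) => k hk; apply: Z_supp => M fM _.
by have [_ ?] := hD M fM; lia.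
Qed.

Lemma SW_transl Y f : SW f -> SW (fun M => f (M + Y)).
Proof.
move=> /schwartzP[a [b [h1 h2]]]; have [c hc] := mge_ex Y.
apply/schwartzP; exists (Num.min a c), b; split=> [M hM|M X hX]; last by rewrite (addrAC M X Y) (h2 (M + Y) X hX).
apply: h1; apply: contra hM => hM; rewrite -(addrK Y M).
by apply: mgeB; [apply: mge_le hM|apply: mge_le hc]; lia.
Qed.

(** At k = 0 the integral is the volume of $K_N$ times [ev l x]. This is the zeta integral that will
    be seen not to vanish. *)
Lemma Z_box1 N l x : 0 < N -> fixed act N x -> ev l x != 0 -> lowest 0 (Z (box 1%:M N) l x).
Proof.
move=> N0 hx lx; have bK M : box 1%:M N M != 0 :> C -> Kz M.
  by rewrite /box pnatr_eq0 eqb0 negbK; exact: mge_congr.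
split=> [|k hk]; last first.
  by apply: Z_supp => M /bK/Kz_vdet -> _; lia.
rewrite /Z mulf_neq0 ?qp_neq0 //.
have -> : zfun (box 1%:M N) l x 0 = sch_lin (ev l x) (fun M => box 0 N (M + - 1%:M)) fn0.
  apply/funext => M; rewrite /zfun /sch_lin /fn0 addr0 /coefE {1}/box {1}/box subr0.
  case: (boolP (mge _ _)) => hM; last by rewrite mul0r mulr0.
  have MK := mge_congr N0 hM; rewrite mul1r mulr1 (Kz_vdet MK) eqxx andbT GL_det; last by case: MK.
  by rewrite hx //; apply/(congrP _ N0).
have hb : SW (fun M => box 0 N (M + - 1%:M)) by apply: SW_transl; exact: SW_box.
rewrite (Int_lin _ hb (SW_0 _ _)) Int_0 addr0.
by rewrite Int_transl ?Int_box0 ?mulf_neq0 ?qp_neq0 //; exact: SW_box.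
Qed.

End Zeta.

(** * A Hecke operator on fixed vectors *)

Section HeckeOperator.
Variables (C : numClosedFieldType) (K : lfield).
Local Notation v := (@lfv K).
Local Notation pi := (lfpi K).
Local Notation q := (lfq K).
Local Notation M2 := 'M[lfF K]_2.
Local Notation nu := (@nu K).
Local Notation dg := (@dg K).
Local Notation tt := (@tt K).
Variables (E : lmodType C) (rho : M2 -> E -> E).
Hypothesis rhoR : is_rep rho.
Implicit Types (N k : int) (l y : E).

(** Moving j past the inverse of [tt] divides its upper right entry by $\pi$, hence the stronger
    condition there. *)
Lemma rho_inv_tt_fixed N l j : 0 < N -> fixed rho N l ->
  mge N (j - 1%:M) -> vge v (N + 1) (j 0 1) -> rho j (rho (invmx tt) l) = rho (invmx tt) l.
Proof.
move=> N0 hl; rewrite (mx2P j); move: (j 0 0) (j 0 1) (j 1 0) (j 1 1) => a b c d.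
rewrite mx2_1 mx2_sub !subr0 mge_mx2 => /and4P[ha hb hc hd]; rewrite mxE /= => hb'.
have o0 := oner_neq0 (lfF K); have p0 := lf_pi0 K; have tG := GL_tt K; have tV := GLV tG.
have jG : GL (mx2 a b c d).
  have : mge N (mx2 a b c d - 1%:M) by rewrite mx2_1 mx2_sub !subr0 mge_mx2 ha hb hc hd.
  by move/(mge_congr N0); case.
pose k := mx2 a (b / pi) (c * pi) d.
have hk : congr_sub v N k.
  apply/(congrP _ N0); rewrite mx2_1 mx2_sub !subr0 mge_mx2 ha hd.
  rewrite [b / pi]mulrC vge_mull ?invr_eq0 // vV // lf_vpi opprK hb' /= andbT.
  by rewrite mulrC vge_dpi; apply: vge_le hc; lia.
have kG : GL k by case: hk.
have -> : rho (mx2 a b c d) (rho (invmx tt) l) = rho (invmx tt *m k) l.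
  rewrite -(rhoM rhoR) //; congr (rho _ _).
  by rewrite dgV // /dg /k !mx2_mul; congr mx2; field; rewrite ?p0 ?o0.
by rewrite (rhoM rhoR) // hl.
Qed.

(** The $U$-operator: [rho (invmx tt) l] is no longer fixed by $K_N$, and averaging over
    $nu(p^N/p^{N+1})$ restores this. *)
Definition heckeU N l : E := (q%:R : C)^-1 *:
  \sum_(u : digI K 1) rho (nu (pi ^ N * dig u)) (rho (invmx tt) l).

(** Up to an element allowed by [rho_inv_tt_fixed], k times [nu x] is [nu (x + k 0 1)], so k
    permutes the terms. *)
Lemma heckeU_fixed N l : 0 < N -> fixed rho N l -> fixed rho N (heckeU N l).
Proof.
move=> N0 hl k hk; have kG : GL k by case: hk.
have hJ j := @rho_inv_tt_fixed N l j N0 hl; set y := rho (invmx tt) l in hJ *.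
have yGM x z : GL (nu x *m nu z) by apply: GLM; exact: GL_nu.
rewrite (rhoZ rhoR) // (rho_sum rhoR) //; congr (_ *: _).
have kb : vge v N (k 0 1).
  by have /(congrP _ N0)/mgeP/(_ 0 1) := hk; rewrite !mxE subr0.
transitivity (\sum_(u : digI K 1) (fun x => rho (nu x) y) (pi ^ N * dig u + k 0 1)).
  apply: eq_bigr => u _ /=; set x := pi ^ N * dig u.
  have hx : vge v N x by rewrite /x vge_pi subrr digO.
  pose z := x + k 0 1; have hz : vge v N z by exact: vgeD.
  have hnu w : vge v N w -> congr_sub v N (nu w).
    by move=> hw; apply/(congrP _ N0); rewrite mx2_1 mx2_sub mge_mx2 !subrr !subr0 !vge0 hw.
  have eqn : k *m nu x = nu z *m (nu (- z) *m (k *m nu x)).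
    by rewrite mulmxA nuD subrr nu0 mul1mx.
  have hc : congr_sub v N (nu (- z) *m (k *m nu x)).
    by apply: congrM => //; [apply: hnu; rewrite vgeN|apply: congrM => //; exact: hnu].
  rewrite -(rhoM rhoR) //; last exact: GL_nu.
  rewrite eqn (rhoM rhoR); [|exact: GL_nu|by case: hc].
  congr (rho _ _); apply: hJ; first exact/(congrP _ N0).
  have /(congrP _ N0) := hk; rewrite /z (mx2P k).
  move: (k 0 0) (k 0 1) (k 1 0) (k 1 1) kb => a b c d kb.
  rewrite mx2_1 mx2_sub !subr0 mge_mx2 => /and4P[ha hb hc' hd].
  rewrite /nu !mx2_mul !mxE /=.
  rewrite (_ : _ + _ = (a - 1) * x - (x * c * x + x * (d - 1)) - (b * (c * x) + b * (d - 1))); last by ring.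
  have m2 a' b' : vge v N a' -> vge v N b' -> vge v (N + 1) (a' * b').
    by apply: vgeM_le; lia.
  have m3 a' b' : vge v N a' -> vge v N b' -> vge v N (a' * b').
    by apply: vgeM_le; lia.
  by apply: vgeB; [apply: vgeB; [|apply: vgeD]|apply: vgeD]; apply: m2 => //; exact: m3.
rewrite (@sum_dig_transl K E (fun x => rho (nu x) y) N 1 (k 0 1)) // => x z hxz.
rewrite -(subrK z x) addrC -nuD (rhoM rhoR); [|exact: GL_nu|exact: GL_nu].
rewrite (hJ (nu (x - z))) //; last by rewrite mxE.
rewrite mx2_1 mx2_sub mge_mx2 !subrr !subr0 !vge0 /= andbT.
by apply: vge_le hxz; lia.
Qed.

Lemma fixed_scalar N (c : K) l : c != 0 -> fixed rho N l -> fixed rho N (rho c%:M l).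
Proof.
move=> c0 hl k hk; have kG : GL k by case: hk.
have cG : GL (c%:M : M2) by rewrite /GL unitmxE det_scalar unitfE expf_neq0.
by rewrite -(rhoM rhoR) // scalar_mxC (rhoM rhoR) // hl.
Qed.

End HeckeOperator.

(** * A common denominator for all zeta integrals *)

Section InvariantForm.
Variables (C : numClosedFieldType) (K : lfield).
Local Notation v := (@lfv K).
Local Notation pi := (lfpi K).
Local Notation q := (lfq K).
Local Notation M2 := 'M[lfF K]_2.
Local Notation fn := (M2 -> C).
Local Notation SW := (@SW C K).
Local Notation weil g1 g2 f := (@weil_act C K v q 2 2 g1 g2 f).
Local Notation nu := (@nu K).
Local Notation tt := (@tt K).
Local Notation fE := (@fE C K).
Local Notation fO := (@fO C K).
Variables (V : lmodType C) (act : M2 -> V -> V).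
Local Notation E := (sdual act).
Hypothesis actR : is_rep act.
Hypothesis actS : smooth_rep v act.
Local Notation rho := (drho actR).
Local Notation Z := (@Z C K V act).
Implicit Types (g h M X Y : M2) (f : fn) (l : E) (x : V) (k a b : int).

Let rhoR : is_rep rho := drhoR actR.

Lemma Z_weil_inv g f l x : GL g -> SW f ->
  Z (weil g 1%:M f) l x = fun k => Z f (rho (invmx g) l) x (k - vd g).
Proof.
move=> hg hf; apply/funext => k.
by rewrite -{1}(rhoVK rhoR l hg) (Z_weil actR).
Qed.

(** A function invariant under integral unipotents does not see the averaging in [heckeU]. *)
Lemma Z_heckeU N f l x : SW f -> 0 <= N ->
  (forall y, vge v 0 y -> weil (nu y) 1%:M f = f) ->
  Z f (heckeU rho N l) x = Z f (rho (invmx tt) l) x.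
Proof.
move=> hf N0 inv; apply/funext => k; rewrite /heckeU scaler_sumr (Z_suml actR actS) //.
rewrite (eq_bigr (fun=> q%:R^-1 * Z f (rho (invmx tt) l) x k)) => [|u _].
  by rewrite sumr_const card_digI expn1 -[_ *+ q]mulr_natl mulrA divff ?q_neq0 // mul1r.
congr (_ * _); have hu : vge v 0 (pi ^ N * dig u) by by apply: (vge_le N0); rewrite vge_pi subrr digO.
by rewrite -{1}(inv _ hu) (Z_weil actR) ?vd_nu ?subr0 //; exact: GL_nu.
Qed.

Variables (N : int) (r : nat) (t : 'I_r.+1 -> E).
Hypothesis N0 : 0 < N.
Hypothesis t_fixed : forall i, fixed rho N (t i).
Hypothesis t_span : forall l, fixed rho N l -> exists c : 'rV[C]_r.+1, l = \sum_i c 0 i *: t i.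

Lemma heckeU_matrix : exists A : 'M[C]_r.+1, forall i, heckeU rho N (t i) = \sum_j A i j *: t j.
Proof.
have /choice[c hc] i : exists c : 'rV[C]_r.+1, heckeU rho N (t i) = \sum_j c 0 j *: t j.
  by apply: t_span; exact: heckeU_fixed.
by exists (\matrix_(i, j) c i 0 j) => i; rewrite hc; apply: eq_bigr => j _; rewrite mxE.
Qed.

Lemma seq_closed_Z (Nn : (int -> C) -> Prop) f x : seq_closed Nn -> SW f ->
  (forall i, Nn (Z f (t i) x)) -> forall l, fixed rho N l -> Nn (Z f l x).
Proof.
move=> hN hf ht l /t_span[c ->].
have := seq_closed_sum (index_enum 'I_r.+1) (c 0) hN ht; congr Nn.
by apply/funext => k; rewrite (Z_suml actR actS).
Qed.

Variable A : 'M[C]_r.+1.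
Hypothesis hA : forall i, heckeU rho N (t i) = \sum_j A i j *: t j.
Let P := char_poly A.

(** [fE_decomp] gives, up to finitely many terms upwards, the recursion: the shift of the sequence
    for [t i] is the sequence for [heckeU] of [t i], so Cayley-Hamilton applies with the matrix
    A. *)
Lemma kill_fE n l x : N <= n -> fixed rho N l -> evzero (shiftop 1 P (Z (fE n) l x)).
Proof.
move=> hn; have n0 : 0 < n by lia.
have hE := SW_fE C K n; have ecl := evzero_closed C.
apply: (@seq_closed_Z (fun phi => evzero (shiftop 1 P phi))) => //.
  exact: seq_closed_shiftop.
apply: shiftop_char_poly => // i.
have hs : forall u, SW (weil (gz n u) 1%:M (fE n)).
  by move=> u; apply: SW_weil; [exact: GL_gz|exact: GL1|exact: SW_fE].
have := evzero_shift 1 (Z_SG (t i) x (sE_SG C K n0)); congr evzero; apply/funext => k.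
rewrite mul1r {1}fE_decomp (Z_linf actR actS); [|by case: (sE_SG C K n0)|exact: SW_sum].
rewrite mul1r -addrA (Z_sumf actR actS) //.
rewrite (eq_bigr (fun=> q%:R^-1 * Z (fE n) (rho (invmx tt) (t i)) x k)) => [|u _].
  rewrite sumr_const card_digI expn1 -[_ *+ q]mulr_natl mulrA divff ?q_neq0 // mul1r.
  rewrite -(Z_heckeU (N := N)) ?ltW //; last by move=> y hy; exact: fE_nu.
  by rewrite hA (Z_suml actR actS) // subrr addr0.
have gG := GL_gz n u; rewrite Z_weil_inv // vd_gz addrK; congr (_ * Z _ _ _ _).
rewrite /gz invmxM; [|exact: GL_nl|exact: GL_tt].
rewrite (rhoM rhoR); [|exact/GLV/GL_tt|exact/GLV/GL_nl]; congr (rho _ _).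
apply: t_fixed; rewrite nlV; apply/(congrP _ N0).
rewrite mx2_1 /nl mx2_sub mge_mx2 !subrr !subr0 !vge0 vgeN /= andbT.
by apply: vge_le (zr_vge n u).
Qed.

Lemma kill_nz f l x (c : int) : SW f -> (forall M, mge c M -> f M = 0) -> fixed rho N l ->
  evzero (shiftop 1 P (Z f l x)).
Proof.
move=> hf fc; have /schwartzP[a [b hs]] := hf.
have [_ Nl _] := seq_closed_shiftop 1 P (evzero_closed C).
(* Both l and x vary since translation of f moves them; l stays fixed at level N because scalars are
   central and $GL_2(O)$ normalizes $K_N$. *)
pose Q f := forall l x, fixed rho N l -> evzero (shiftop 1 P (Z f l x)).
suff : Q f by apply.
apply: (@SW_ind_nz C K Q a b c N f) => // [c1 f1 f2 h1 h2 q1 q2 l1 x1 fl|f1 hf1 l1 x1 _|].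
- move: (Nl c1 _ _ (q1 l1 x1 fl) (q2 l1 x1 fl)); congr (evzero (shiftop 1 P _)).
  by apply/funext => k; rewrite (Z_linf actR actS).
- by apply: evzero_shiftop; exact: Z_SG.
move=> j k1 k2 n hk1 hk2 _ hn l1 x1 fl.
have gG := GL_piK j hk1; have k2G : GL k2 by case: hk2.
have hE := SW_fE C K n; set g := pi ^ j *: k1.
have -> : Z (weil g k2 (fE n)) l1 x1 =
    fun k => Z (fE n) (rho (invmx g) l1) (act (invmx k2) x1) (k + (vd k2 - vd g)).
  apply/funext => k.
  have -> : weil g k2 (fE n) = weil g 1%:M (weil 1%:M k2 (fE n)).
    by rewrite weilM ?mulmx1 ?mul1mx //; exact: GL1.
  rewrite Z_weil_inv //; last by apply: SW_weil => //; exact: GL1.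
  by rewrite (Z_weilR actR actS) //; congr (Z _ _ _ _); lia.
rewrite (shiftop_shift _ _ (Z (fE n) (rho (invmx g) l1) (act (invmx k2) x1))).
apply: evzero_shift; apply: kill_fE => //.
have p0 : pi ^ j != 0 by exact: piX_neq0.
have k1V := KzV hk1; have k1G : GL k1 by case: hk1.
have pG : GL ((pi ^ j)%:M : M2) by rewrite /GL unitmxE det_scalar unitfE expf_neq0.
have -> : invmx g = (pi ^ j)^-1%:M *m invmx k1.
  by rewrite /g -mul_scalar_mx invmxM // invmx_scalar -scalar_mxC.
rewrite (rhoM rhoR); [|by rewrite /GL unitmxE det_scalar unitfE expf_neq0 ?invr_neq0|by case: k1V].
by apply: (fixed_scalar rhoR); [exact: invr_neq0|exact: (fixed_Kz rhoR)].
Qed.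

(** The factor $P(T)$ clears the contribution of nonzero singular matrices and $P(qT)$ that of the
    zero matrix. *)
Let D (phi : int -> C) := shiftop 1 P (shiftop q%:R P phi).

Lemma kill_nz2 f l x (c : int) : SW f -> (forall M, mge c M -> f M = 0) -> fixed rho N l ->
  evzero (D (Z f l x)).
Proof. by move=> *; rewrite /D shiftopC; apply: evzero_shiftop; apply: kill_nz; eassumption. Qed.

Lemma fO_nu y : vge v 0 y -> weil (nu y) 1%:M fO = fO.
Proof.
move=> hy; apply/funext => M; rewrite weilE vd_nu vd1 subr0 qp0 mul1r mulmx1 /fO /box !subr0.
by rewrite (Kz_mgeL _ _ (KzV (Kz_nu hy))).
Qed.

(** [fO_decomp] has a single translate with weight $q^{-1}$, so the recursion involves q times the
    shift, up to sequences that the other factor kills. *)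
Lemma kill_fO l x : fixed rho N l -> evzero (D (Z fO l x)).
Proof.
have hO := SW_fO C K; have cl1 := seq_closed_shiftop 1 P (evzero_closed C).
apply: (@seq_closed_Z (fun phi => evzero (D phi))) => //.
  exact: (@seq_closed_shiftop C (fun phi => evzero (shiftop 1 P phi))).
apply: (@shiftop_char_poly C (fun phi => evzero (shiftop 1 P phi))) => // i.
have hw : SW (weil tt 1%:M fO) by apply: SW_weil => //; [exact: GL_tt|exact: GL1].
have [_ Nl Ns] := cl1.
have h0 : evzero (shiftop 1 P (fun=> 0)) by case: cl1.
have hv M : mge 1 M -> sch_lin (- q%:R^-1) (weil tt 1%:M fO) fO M = 0.
  by move=> /(fO_decomp C) h; rewrite /sch_lin mulNr addrC.
have hz := kill_nz x (SW_lin (- q%:R^-1) hw hO) hv (t_fixed i).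
move: (Nl q%:R _ _ (Ns _ hz) h0); congr (evzero (shiftop 1 P _)); apply/funext => k.
have tG := GL_tt K; rewrite (Z_linf actR actS) // Z_weil_inv //.
rewrite vd_tt addrK addr0 mulrDr mulrA mulrN divff ?q_neq0 // mulN1r addrC.
congr (_ - _); rewrite -(Z_heckeU (N := N)) ?ltW //; last exact: fO_nu.
by rewrite hA (Z_suml actR actS).
Qed.

Lemma kill_fixed f l x : SW f -> fixed rho N l -> evzero (D (Z f l x)).
Proof.
move=> hf fl; have /schwartzP[a [b hs]] := hf; have hO := SW_fO C K.
have [_ Nl _] := seq_closed_shiftop q%:R P (seq_closed_shiftop 1 P (evzero_closed C)).
have e : f = sch_lin (f 0) fO (sch_lin (- f 0) fO f).
  by apply/funext => M; rewrite /sch_lin mulNr addNKr.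
have hl : SW (sch_lin (- f 0) fO f) by exact: SW_lin.
have h2 : evzero (D (Z (sch_lin (- f 0) fO f) l x)).
  apply: (@kill_nz2 _ _ _ (Num.max 0 b)) => // M hM; rewrite /sch_lin /fO /box subr0.
  rewrite (mge_le _ hM); last by lia.
  rewrite -(add0r M) hs.2 ?mulr1 ?addNr //.
  by apply: mge_le hM; lia.
suff -> : Z f l x = fun k => f 0 * Z fO l x k + Z (sch_lin (- f 0) fO f) l x k.
  exact: (Nl (f 0) _ _ (kill_fO x fl) h2).
by apply/funext => k; rewrite {1}e (Z_linf actR actS).
Qed.

(** The vectors l for which D works with all f and x form a stable subspace containing [l0], hence
    all of E; one level N suffices. *)
Lemma kill_all f l l0 x : irreducible_rep rho -> l0 != 0 -> fixed rho N l0 -> SW f -> evzero (D (Z f l x)).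
Proof.
move=> [_ irr] l00 fl0 hf.
have [Z0 Nl _] := seq_closed_shiftop q%:R P (seq_closed_shiftop 1 P (evzero_closed C)).
pose W l := forall f x, SW f -> evzero (D (Z f l x)).
have comb c l1 l2 : W l1 -> W l2 -> W (c *: l1 + l2).
  move=> w1 w2 f1 x1 hf1; move: (Nl c _ _ (w1 f1 x1 hf1) (w2 f1 x1 hf1)).
  by congr (evzero (D _)); apply/funext => k; rewrite (Z_linl actR actS).
have W0 : W 0.
  move=> f1 x1 hf1; move: Z0; congr (evzero (D _)); apply/funext => k.
  by have := Z_linl actR actS (-1) 0 0 x1 k hf1; rewrite scaler0 addr0 mulN1r addNr.
case: (irr W) => [|g l1 hg w1 f1 x1 hf1|h|h]; last by exact: h.
- split=> // [l1 l2|c l1] w1; first by move=> w2; rewrite -[l1]scale1r; exact: comb.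
  by rewrite -[c *: l1]addr0; exact: comb.
- have gV := GLV hg; have hw : SW (weil (invmx g) 1%:M f1) by apply: SW_weil => //; exact: GL1.
  have -> : Z f1 (rho g l1) x1 = fun k => Z (weil (invmx g) 1%:M f1) l1 x1 (k - vd g).
    apply/funext => k; rewrite -(Z_weil actR actS) // weilM //; try exact: GL1.
    by rewrite mulmxV // mulmx1 weil11.
  rewrite /D (shiftop_shift _ _ (Z (weil (invmx g) 1%:M f1) l1 x1)).
  by rewrite (shiftop_shift _ _ (shiftop q%:R P (Z (weil (invmx g) 1%:M f1) l1 x1))); apply: evzero_shift; exact: w1.
- by case/eqP: l00; apply: h => f1 x1 hf1; exact: kill_fixed.
Qed.

End InvariantForm.

(** * The invariant form *)

Section FormExistence.
Variables (C : numClosedFieldType) (K : lfield).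
Local Notation v := (@lfv K).
Local Notation q := (lfq K).
Local Notation M2 := 'M[lfF K]_2.
Local Notation fn := (M2 -> C).
Local Notation SW := (@SW C K).
Local Notation weil g1 g2 f := (@weil_act C K v q 2 2 g1 g2 f).

Definition lowzero (phi : int -> C) : Prop := exists s : int, forall k, k < s -> phi k = 0.

Lemma lowzero_shiftop a P phi : lowzero phi -> lowzero (shiftop a P phi).
Proof.
move=> [s hs]; exists (s - (size P)%:Z) => k hk; rewrite /shiftop big1 // => i _.
by rewrite hs ?mulr0 //; have := ltn_ord i; move: hk; set n := size P => hk hi; lia.
Qed.

Lemma finsupp_evzero phi : lowzero phi -> evzero phi -> finsupp phi.
Proof.
move=> [s hs] [s' hs']; exists s, (absz (s' - s)%R) => k hk.
by case: (ltP k s) => h; [exact: hs|apply: hs'; lia].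
Qed.

(* [D] clears the poles of all zeta integrals at once. The least moment of [D Z] that does not vanish identically
   is invariant, because a shift changes a moment only by lower ones. *)
Lemma invariant_form_ex (V : lmodType C) (act : M2 -> V -> V) (actR : is_rep act) :
  smooth_rep v act -> admissible_rep v act -> irreducible_rep act ->
  exists b : fn -> sdual act -> C,
    [/\ forall a f1 f2 l, SW f1 -> SW f2 -> b (sch_lin a f1 f2) l = a * b f1 l + b f2 l,
        forall a f l1 l2, SW f -> b f (a *: l1 + l2) = a * b f l1 + b f l2,
        forall g f l, GL g -> SW f -> b (weil g 1%:M f) (drho actR g l) = b f l &
        exists f l, SW f /\ b f l != 0].
Proof.
move=> actS actA actI; have rhoI := dual_irr actR actS actA actI.
have [l0 l00] := dual_neq0 actR actS actA actI.
have [N [N0 fl0]] := drhoS actR l0.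
have [r [t [ht span]]] := dual_fixed_span actR actS actA N0.
case: r t ht span => [|r] t ht span.
  by have [c e] := span l0 fl0; case/eqP: l00; rewrite e big_ord0.
have [A hA] := heckeU_matrix N0 ht span; set P := char_poly A.
have [x0 lx0] : exists x, ev l0 x != 0.
  apply: contrapT => h; case/eqP: l00; apply: ev_inj => x.
  by apply/eqP/negP => /negP hx; apply: h; exists x.
pose D (phi : int -> C) := shiftop 1 P (shiftop q%:R P phi).
have Dlin a phi phi' : D (fun k => a * phi k + phi' k) = fun k => a * D phi k + D phi' k.
  by rewrite /D !shiftop_lin.
pose c (f : fn) (l : sdual act) : int -> C := D (Z f l x0).
have cfin f l : SW f -> finsupp (c f l).
  move=> hf; apply: finsupp_evzero; last exact: (kill_all actS N0 ht span hA l x0 rhoI l00 fl0 hf).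
  by do 2 apply: lowzero_shiftop; have [s hs] := Z_low act hf; exists s => k; exact: hs.
have cf a f1 f2 l : SW f1 -> SW f2 -> c (sch_lin a f1 f2) l = fun k => a * c f1 l k + c f2 l k.
  move=> h1 h2; rewrite /c -Dlin; congr D; apply/funext => k; exact: Z_linf.
have cl a f l1 l2 : SW f -> c f (a *: l1 + l2) = fun k => a * c f l1 k + c f l2 k.
  move=> hf; rewrite /c -Dlin; congr D; apply/funext => k; exact: Z_linl.
have cinv g f l : GL g -> SW f -> c (weil g 1%:M f) (drho actR g l) = fun k => c f l (k - vd g).
  move=> hg hf; rewrite /c /D -(shiftop_shift _ _ (shiftop _ _ _)) -(shiftop_shift _ _ (Z _ _ _)).
  by congr (shiftop _ _ (shiftop _ _ _)); apply/funext => k; exact: Z_weil.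
(* Finite support of [c f l] is known for Schwartz f only, so the family is indexed by those. *)
pose T := ({f : fn | SW f} * sdual act)%type.
have [||m [hm [[[f hf] l] hne]]] := @leading_moment C T (fun p => c (sval p.1) p.2).
- by move=> [[f hf] l]; exact: cfin.
(* Some sequence survives D: the one of a small box around 1 has a lowest term, which both factors
   preserve. *)
- have [N1 [N10 hx0]] := actS x0; have hb := SW_box C (1%:M : M2) N1.
  have q0 := q_neq0 C K; have mP : P \is monic by exact: char_poly_monic.
  have low := Z_box1 N10 hx0 lx0.
  have [ne _] := shiftop_lowest (oner_neq0 C) mP (shiftop_lowest q0 mP low).
  by exists (exist _ _ hb, l0); eexists; exact: ne.
exists (fun f l => moment m (c f l)); split=> [a f1 f2 l1 h1 h2|a f1 l1 l2 h1|g f1 l1 hg h1|].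
- by rewrite cf // moment_lin //; exact: cfin.
- by rewrite cl // moment_lin //; exact: cfin.
- rewrite cinv // moment_shift //; first exact: cfin.
  by move=> i hi; exact: (hm (exist _ _ h1, l1) i hi).
- by exists f, l.
Qed.

End FormExistence.
(** * The theta lift *)

Section SubspaceModule.
Variables (C : fieldType) (T : lmodType C) (Y : T -> Prop) (Ysub : subspace Y).

(** The subspace becomes a module in its own right, so that it can serve as a target in the
    universal property. *)
Definition sub_pred of subspace Y : {pred T} := fun x => `[<Y x>].

Lemma sub_pred_closed : GRing.submod_closed (sub_pred Ysub).
Proof.
have [Y0 YD YZ] := Ysub; split=> [|a x y /asboolP hx /asboolP hy]; first exact/asboolP.
by apply/asboolP/YD => //; exact: YZ.
Qed.

HB.instance Definition _ := GRing.isSubmodClosed.Build C T (sub_pred Ysub) sub_pred_closed.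

Record submod := SubMod { submod_val : T; _ : submod_val \in sub_pred Ysub }.
HB.instance Definition _ := [isSub for submod_val].
HB.instance Definition _ := [Choice of submod by <:].
HB.instance Definition _ := [SubChoice_isSubLmodule of submod by <:].

Lemma submod_valP (x : submod) : Y (submod_val x).
Proof. by case: x => x h; exact: (elimT (asboolP _) h). Qed.

Definition mk_submod x (h : Y x) : submod := @SubMod x (introT (asboolP _) h).

Lemma submod_inj (x y : submod) : submod_val x = submod_val y -> x = y.
Proof. exact: val_inj. Qed.

End SubspaceModule.

Section SpanOfLift.
Variables (C : numClosedFieldType) (F : fieldType) (v : F -> int) (q n m : nat).
Variables (V : lmodType C) (act : 'M[F]_n -> V -> V) (Th : lmodType C) (tact : 'M[F]_m -> Th -> Th).
Variable beta : ('M[F]_(n, m) -> C) -> (V -> C) -> Th.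

(* The universal map into the submodule spanned by the values of [beta], composed with the inclusion,
   agrees with the identity. *)
Lemma theta_span :
  (forall a (f1 f2 : 'M[F]_(n, m) -> C), schwartz v f1 -> schwartz v f2 -> schwartz v (sch_lin a f1 f2)) ->
  (forall a l1 l2, smooth_dual v act l1 -> smooth_dual v act l2 -> smooth_dual v act (dual_lin a l1 l2)) ->
  (forall g (f : 'M[F]_(n, m) -> C), GL g -> schwartz v f -> schwartz v (weil_act v q g 1%:M f)) ->
  (forall g l, GL g -> smooth_dual v act l -> smooth_dual v act (dual_act act g l)) ->
  is_full_theta_lift v q act tact beta ->
  forall Y : Th -> Prop, subspace Y ->
  (forall f l, schwartz v f -> smooth_dual v act l -> Y (beta f l)) -> forall y, Y y.
Proof.
move=> swL sdL swG sdG [bI _ _ univ] Y Ysub hY y; have [b1 b2 b3] := bI.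
pose b f l : submod Ysub := if pselect (schwartz v f /\ smooth_dual v act l) is left h
  then mk_submod Ysub (hY f l h.1 h.2) else 0.
have bE f l : schwartz v f -> smooth_dual v act l -> submod_val (b f l) = beta f l.
  by move=> hf hl; rewrite /b; case: pselect => // -[].
have [|t [tl tb _]] := univ _ b.
  split=> [a f1 f2 l h1 h2 hl|a f l1 l2 hf h1 h2|g f l hg hf hl]; apply: submod_inj.
  - by rewrite bE ?b1 //= ?bE //; exact: swL.
  - by rewrite bE ?b2 //= ?bE //; exact: sdL.
  - by rewrite !bE ?b3 //; [exact: swG|exact: sdG].
have [t0 [_ _ uniq0]] := univ _ beta bI.
have vt f l : schwartz v f -> smooth_dual v act l -> submod_val (t (beta f l)) = beta f l.
  by move=> hf hl; rewrite tb // bE.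
have e1 := uniq0 (fun x => submod_val (t x)) (fun a x z => congr1 (@submod_val _ _ _ _) (tl a x z)) vt y.
by rewrite -(uniq0 id) // in e1; rewrite -e1; exact: submod_valP.
Qed.

End SpanOfLift.

(** * The two sides exchanged by the Fourier transform, and the conclusion *)

Section TwoSides.
Variables (C : numClosedFieldType) (K : lfield).
Local Notation v := (@lfv K).
Local Notation pi := (lfpi K).
Local Notation q := (lfq K).
Local Notation M2 := 'M[lfF K]_2.
Local Notation fn := (M2 -> C).
Local Notation qp := (@qp C K).
Local Notation SW := (@SW C K).
Local Notation weil g1 g2 f := (@weil_act C K v q 2 2 g1 g2 f).
Local Notation tt := (@tt K).
Local Notation ww := (@ww K).

Definition cg (g : M2) : M2 := (invmx g)^T.

Lemma cgK g : cg (cg g) = g.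
Proof. by rewrite /cg -invmxT invmxK trmxK. Qed.

Lemma cgM g h : GL g -> GL h -> cg (g *m h) = cg g *m cg h.
Proof. by move=> hg hh; rewrite /cg invmxM // trmx_mul. Qed.

Lemma cg1 : cg 1%:M = 1%:M.
Proof. by rewrite /cg (invmx_uniq (mul1mx _)) trmx1. Qed.

Lemma vd_cg g : GL g -> vd (cg g) = - vd g.
Proof. by move=> hg; rewrite -vdetV // /vd dt_tr. Qed.

Lemma cg_congr N k : 0 < N -> congr_sub v N k -> congr_sub v N (cg k).
Proof.
move=> N0 hk; apply/(congrP _ N0).
by rewrite -mge_tr linearB /= trmxK trmx1; apply/(congrP _ N0); exact: congrV.
Qed.

Section Rep.
Variables (E : lmodType C) (rho : M2 -> E -> E).
Hypothesis rhoR : is_rep rho.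
Hypothesis rhoS : smooth_rep v rho.
Hypothesis rhoI : irreducible_rep rho.
Implicit Types (g h : M2) (x y m : E).

Lemma cg_is_rep : is_rep (fun g => rho (cg g)).
Proof.
have [r1 r2 r3] := rhoR; split=> [g hg|x|g h x hg hh]; first by apply: r1; exact: GLtr.
  by rewrite cg1.
by rewrite cgM // r3 //; exact: GLtr.
Qed.

Lemma cg_smooth : smooth_rep v (fun g => rho (cg g)).
Proof.
by move=> x; have [N [N0 hN]] := rhoS x; exists N; split=> // k hk; apply: hN; exact: cg_congr.
Qed.

(** The kernel of the largest quotient of E on which g acts by $|\det g|$. *)
Definition coinvdet x : Prop := forall Y : E -> Prop, subspace Y ->
  (forall g m, GL g -> Y (rho g m - qp (- vd g) *: m)) -> Y x.

Lemma coinvdet_sub : subspace coinvdet.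
Proof.
split=> [Y [Y0 _ _] _|x y hx hy Y Ys YH|a x hx Y Ys YH]; first exact: Y0.
  by have [_ YD _] := Ys; apply: YD; [exact: hx|exact: hy].
by have [_ _ YZ] := Ys; apply: YZ; exact: hx.
Qed.

(** The subspace [coinvdet] is stable because the determinant is invariant under conjugation. *)
Lemma coinvdet_or_scalar :
  (forall x, coinvdet x) \/ forall g m, GL g -> rho g m = qp (- vd g) *: m.
Proof.
have [_ irr] := rhoI; case: (irr coinvdet) => [|h x hh hx Y Ysub YH|h|h]; [exact: coinvdet_sub| | |by left].
  have [Y0 YD YZ] := Ysub; apply: (hx (fun x => Y (rho h x))) => [|g m hg].
    split=> [|x1 x2 h1 h2|a x1 h1]; first by rewrite (rho0 rhoR).
      by rewrite (rhoD rhoR) //; exact: YD.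
    by rewrite (rhoZ rhoR) //; exact: YZ.
  have hV := GLV hh; have hc : GL (h *m g *m invmx h) by apply: GLM => //; exact: GLM.
  have := YH _ (rho h m) hc.
  rewrite -(rhoM rhoR) // mulmxKV // (_ : vd _ = vd g); last first.
    by rewrite vdetM ?vdetV ?vdetM //; [lia|exact: GLM].
  by rewrite (rhoB rhoR) // (rhoZ rhoR) // (rhoM rhoR).
right=> g m hg; apply/eqP; rewrite -subr_eq0; apply/eqP; apply: h => Y _ YH; exact: YH.
Qed.

(** On the character $|\det|^{-1}$ the element [tt] acts by q, which is neither 1 nor $q^{-1}$. *)
Lemma scalar_coinv : (forall g m, GL g -> rho g m = qp (vd g) *: m) ->
  (forall x, coinv rho (@Qgrp K) x) /\ (forall x, coinvdet x).
Proof.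
move=> hs; have tG := GL_tt K; have qn := q_neq0 C K; have q1 : (1 < q%:R :> C) by rewrite ltr1n q_gt1.
have cancelY (Y : E -> Prop) c x : c != 0 -> subspace Y -> Y (c *: x) -> Y x.
  by move=> c0 [_ _ YZ] /(YZ c^-1); rewrite scalerA mulVf // scale1r.
split=> x Y Ysub YH.
  have ht : Qgrp tt by exists 0, pi; split=> //; exact: lf_pi0.
  apply: (cancelY Y (q%:R - 1)) => //; first by rewrite subr_eq0 gt_eqF.
  by have := YH _ x ht; rewrite hs // vd_tt qp1 scalerBl scale1r.
apply: (cancelY Y (q%:R - q%:R^-1)) => //.
  by rewrite subr_eq0 gt_eqF // (lt_trans _ q1) // invf_lt1 // (lt_trans ltr01).
by have := YH _ x tG; rewrite hs // vd_tt qpN qp1 scalerBl.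
Qed.

(** Inverse transposition followed by conjugation by [ww] carries Q onto Q2. *)
Lemma coinv_cg : (forall x, coinv rho (@Q2grp K) x) -> forall x, coinv (fun g => rho (cg g)) (@Qgrp K) x.
Proof.
move=> h x Y Ysub YH; have [Y0 YD YZ] := Ysub; have wG := GL_ww K.
rewrite -(rho1 rhoR x) -(wwK K) (rhoM rhoR) //; move: (rho ww x) => z.
apply: (h z (fun z => Y (rho ww z))) => [|g m [c [b [c0 eg]]]].
  split=> [|x1 x2 h1 h2|a x1 h1]; first by rewrite (rho0 rhoR).
    by rewrite (rhoD rhoR) //; exact: YD.
  by rewrite (rhoZ rhoR) //; exact: YZ.
have gG : GL g by rewrite eg /GL mx2_unit mulr1 mulr0 subr0.
pose g' := mx2 1 (- (b / c)) 0 c^-1.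
have ci : c^-1 != 0 by rewrite invr_eq0.
have hQ : Qgrp g' by exists (- (b / c)), c^-1.
have cge : cg g' = ww *m g *m ww.
  rewrite /cg (invmx_uniq (h := mx2 1 b 0 c)); last first.
    by rewrite /g' mx2_mul mx2_1; congr mx2; field.
  by rewrite mx2_tr eg /ww !mx2_mul; congr mx2; ring.
have wgG : GL (ww *m g) by exact: GLM.
have := YH _ (rho ww m) hQ; rewrite cge -(rhoM rhoR) //; last exact: GLM.
by rewrite -mulmxA wwK mulmx1 (rhoM rhoR) // (rhoB rhoR).
Qed.

Section Side.
Variables (Th : lmodType C) (tact : M2 -> Th -> Th) (B : fn -> E -> Th).
Hypothesis Bl1 : forall a f1 f2 l, SW f1 -> SW f2 ->
  B (sch_lin a f1 f2) l = a *: B f1 l + B f2 l.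
Hypothesis Bl2 : forall a f l1 l2, SW f -> B f (a *: l1 + l2) = a *: B f l1 + B f l2.
Hypothesis Binv : forall g f l, GL g -> SW f -> B (weil g 1%:M f) (rho g l) = B f l.
Hypothesis tlin : forall h, GL h -> lin_map (tact h).
Hypothesis tB : forall h f l, GL h -> SW f -> tact h (B f l) = B (weil 1%:M h f) l.
Hypothesis Bspan : forall Y : Th -> Prop, subspace Y -> (forall f l, SW f -> Y (B f l)) -> forall w, Y w.
Hypothesis Th0 : exists w : Th, w != 0.

Lemma irreducible_side : (forall x, coinv rho (@Qgrp K) x) -> (forall x, coinvdet x) ->
  irreducible_rep tact.
Proof.
move=> hQ hG; apply: (irreducible_of_span rhoR rhoS rhoI Bl1 Bl2 Binv tB) => // x.
apply: (Bspan (WG_sub B)) => f l hf.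
exact: (WG_all rhoR rhoS Bl1 Bl2 Binv tlin tB hQ hG).
Qed.

End Side.
End Rep.

Lemma cg_irr (E : lmodType C) (rho : M2 -> E -> E) :
  irreducible_rep (fun g => rho (cg g)) -> irreducible_rep rho.
Proof.
move=> [h0 irr]; split=> // W Wsub Wst; apply: irr => // g x hg; apply: Wst; exact: GLtr.
Qed.

Lemma irr_cg (E : lmodType C) (rho : M2 -> E -> E) :
  irreducible_rep rho -> irreducible_rep (fun g => rho (cg g)).
Proof. by move=> h; apply: cg_irr; rewrite (_ : (fun g => _) = rho) //; apply/funext => g; rewrite cgK. Qed.

(** Each side needs two conditions: no quotient $|\det|$ and no Q-coinvariants. If the first fails
    on one side, E is a character for which the other side meets both; if the second fails on both
    sides, there is a fixed vector. *)
Lemma irreducible_lift (E : lmodType C) (rho : M2 -> E -> E)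
    (Th : lmodType C) (tact : M2 -> Th -> Th) (B : fn -> E -> Th) :
  is_rep rho -> smooth_rep v rho -> irreducible_rep rho ->
  ~ (exists2 y : E, y != 0 & forall g, GL g -> rho g y = y) ->
  (forall a f1 f2 l, SW f1 -> SW f2 -> B (sch_lin a f1 f2) l = a *: B f1 l + B f2 l) ->
  (forall a f l1 l2, SW f -> B f (a *: l1 + l2) = a *: B f l1 + B f l2) ->
  (forall g f l, GL g -> SW f -> B (weil g 1%:M f) (rho g l) = B f l) ->
  (forall h, GL h -> lin_map (tact h)) ->
  (forall h f l, GL h -> SW f -> tact h (B f l) = B (weil 1%:M h f) l) ->
  (forall Y : Th -> Prop, subspace Y -> (forall f l, SW f -> Y (B f l)) -> forall y, Y y) ->
  (exists w : Th, w != 0) -> irreducible_rep tact.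
Proof.
move=> rR rS rI nfix Bl1 Bl2 Binv tlin tB Bspan Th0.
pose rho' g := rho (cg g); have rR' : is_rep rho' := cg_is_rep rR.
have rS' : smooth_rep v rho' := cg_smooth rS; have rI' : irreducible_rep rho' := irr_cg rI.
have rhoE g m : rho g m = rho' (cg g) m by rewrite /rho' cgK.
have side := irreducible_side rR rS rI Bl1 Bl2 Binv tlin tB Bspan Th0.
have side' : (forall x, coinv rho' (@Qgrp K) x) -> (forall x, coinvdet rho' x) -> irreducible_rep tact.
  move=> hQ hG; apply: cg_irr.
  have [psi [p1 p2 p3]] := char_exists C K.
  have FS f : SW f -> SW (FT psi f) by exact: FT_SW.
  (* Precomposed with the Fourier transform, B is invariant for [rho'], with [tact] twisted by [cg]
     as well. *)
  apply: (@irreducible_side E rho' rR' rS' rI' Th _ (fun f l => B (FT psi f) l)) => //.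
  - by move=> a f1 f2 l h1 h2; rewrite FT_lin // Bl1 //; exact: FS.
  - by move=> a f l1 l2 h; rewrite Bl2 //; exact: FS.
  - move=> g f l hg hf; rewrite FT_weil //; last exact: GL1.
    by rewrite -/(cg g) -/(cg 1%:M) cg1 Binv //; [exact: GLtr|exact: FS].
  - by move=> h hh; apply: tlin; exact: GLtr.
  - move=> h f l hh hf; rewrite FT_weil //; last exact: GL1.
    by rewrite -/(cg h) -/(cg 1%:M) cg1 tB //; [exact: GLtr|exact: FS].
  - move=> Y Ysub hY; apply: Bspan => // f l /(FT_surj p1 p2 p3)[f' hf' <-]; exact: hY.
case: (coinvdet_or_scalar rR rI) => [hG|hs]; last first.
  have [|hQ' hG'] := @scalar_coinv E rho'; last exact: side'.
  by move=> g m hg; rewrite /rho' hs ?vd_cg ?opprK //; exact: GLtr.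
case: (coinvdet_or_scalar rR' rI') => [hG'|hs]; last first.
  have [|hQ' _] := @scalar_coinv E rho; last exact: side.
  by move=> g m hg; rewrite rhoE hs ?vd_cg ?opprK //; exact: GLtr.
case: (pselect (forall x, coinv rho (@Qgrp K) x)) => [hQ|/existsNP[x1 n1]]; first exact: side.
case: (pselect (forall x, coinv rho (@Q2grp K) x)) => [hQ|/existsNP[x2 n2]].
  by apply: side' => //; exact: coinv_cg.
by case: nfix; exact: (coinv_fixed rR rS rI n1 n2).
Qed.

(** The kernel of an invariant functional is stable, hence 0, so V is a line. *)
Lemma trivial_of_fixed (V : lmodType C) (act : M2 -> V -> V) (actR : is_rep act) (l : sdual act) :
  irreducible_rep act -> l != 0 -> (forall g, GL g -> drho actR g l = l) -> is_trivial_rep act.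
Proof.
move=> [_ irr] l0 fl; have evg g x : GL g -> ev l (act g x) = ev l x.
  by move=> hg; rewrite -{1}(fl g hg) drho_pair.
have [x1 hx1] : exists x, ev l x != 0.
  apply: contrapT => h; case/eqP: l0; apply: ev_inj => x.
  by apply/eqP/negP => /negP hx; apply: h; exists x.
have ker x : ev l x = 0 -> x = 0.
  case: (irr (fun x => ev l x = 0)) => [|g y hg hy|h|h]; [|by rewrite evg|exact: h|].
    split=> [|y z hy hz|a y hy]; first by rewrite evr0.
      by rewrite evrD hy hz addr0.
    by rewrite evrZ hy mulr0.
  by rewrite h eqxx in hx1.
exists (ev l : V -> C^o); split; [by move=> a x y; exact: ev_lin| |exact: evg].
exists (fun c : C^o => (c / ev l x1) *: x1) => [x|c]; last by rewrite evrZ divfK.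
apply/eqP; rewrite -subr_eq0; apply/eqP/ker.
by rewrite -scaleN1r addrC ev_lin mulN1r evrZ divfK // addNr.
Qed.

Lemma theta_irreducible (V : lmodType C) (act : M2 -> V -> V) (Th : lmodType C)
    (tact : M2 -> Th -> Th) (beta : fn -> (V -> C) -> Th) :
  irr_adm_rep v act -> ~ is_trivial_rep act ->
  @is_full_theta_lift C K v q 2 2 V act Th tact beta -> irreducible_rep tact.
Proof.
move=> [actR actS actA actI] ntriv lift; have [bI tl tb univ] := lift; have [b1 b2 b3] := bI.
have evS := @ev_smooth C K V act.
have sdE f (h : smooth_dual v act f) : ev (mk_sdual h) = f by [].
apply: (@irreducible_lift (sdual act) (drho actR) Th tact (fun f l => beta f (ev l))) => //.
- exact: drhoR.
- exact: drhoS.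
- exact: dual_irr.
- by move=> [l l0 fl]; exact: ntriv (trivial_of_fixed actI l0 fl).
- by move=> a f1 f2 l h1 h2; exact: b1.
- by move=> a f l1 l2 hf; exact: (b2 a f (ev l1) (ev l2)).
- by move=> g f l hg hf; rewrite drho_val // b3.
- by move=> h f l hh hf; exact: tb.
- move=> Y Ysub hY; apply: (theta_span _ _ _ _ lift) => //.
  + by move=> a f1 f2; exact: SW_lin.
  + by move=> a l1 l2 h1 h2; have := evS (a *: mk_sdual h1 + mk_sdual h2).
  + by move=> g f hg hf; apply: SW_weil => //; exact: GL1.
  + by move=> g l hg hl; have := dual_act_smooth actR (mk_sdual hl) hg.
  + by move=> f l hf hl; rewrite -(sdE l hl); exact: hY.
have [b [bl1 bl2 binv [f0 [l0 [hf0 hb0]]]]] := invariant_form_ex actR actS actA actI.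
(* The universal property speaks of maps on all functions on V, so the form is extended by 0 to
   those that are not smooth functionals. *)
pose b' f l : C^o := if pselect (smooth_dual v act l) is left h then b f (mk_sdual h) else 0.
have b'E f l : b' f (ev l) = b f l.
  by rewrite /b'; case: pselect => [h|]; [congr b; exact: ev_inj|case].
have [|t [tlin tE _]] := univ C^o b'.
  split=> [a f1 f2 l h1 h2 hl|a f l1 l2 hf h1 h2|g f l hg hf hl].
  - by rewrite -(sdE l hl) !b'E bl1.
  - rewrite -(sdE l1 h1) -(sdE l2 h2) -[dual_lin _ _ _]/(ev (a *: mk_sdual h1 + mk_sdual h2)).
    by rewrite !b'E bl2.
  - by rewrite -(sdE l hl) -(drho_val actR) // !b'E binv.
exists (beta f0 (ev l0)); apply: contraNneq hb0 => e0.
have := tE f0 (ev l0) hf0 (evS l0); rewrite e0 b'E => <-; apply/eqP.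
by have := tlin (-1) 0 0; rewrite scaler0 addr0 scaleN1r addNr.
Qed.

End TwoSides.
Theorem mainTheorem1 (R : realType) (F : fieldType) (v : F -> int) (q : nat)
  (V : lmodType R[i]) (act : 'M[F]_2 -> V -> V)
  (Th : lmodType R[i]) (tact : 'M[F]_2 -> Th -> Th)
  (beta : ('M[F]_(2, 2) -> R[i]) -> (V -> R[i]) -> Th) :
  nonarch_local_field_char0 v q ->
  irr_adm_rep v act ->
  ~ is_trivial_rep act ->
  @is_full_theta_lift R[i] F v q 2 2 V act Th tact beta ->
  irreducible_rep tact.
Proof.
move=> [ch0 [vM vD [pi [pi0 vpi]] [s [ssz sO sinj ssurj]] _]] adm ntriv lift.
pose K := @LField F v q pi s ch0 vM vD pi0 vpi ssz sO sinj ssurj.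
exact: (@theta_irreducible R[i] K V act Th tact beta adm ntriv lift).
Qed.
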